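(* There is a universal radius $r_0$ with $0<r_0<1$ such that for every analytic function $f:\mathbb{D}\to\mathbb{C}$ with $f(0)=0$ and $f\not\equiv 0$, and for every $0<r<r_0$, \[ \mathcal{A}(r)\geq 1,\qquad\text{where } \mathcal{A}(r)=\frac{A(M(r))}{\pi M(r)^2}. \]
   Context: $\mathbb{D}=\{z\in\mathbb{C}:|z|<1\}$ is the open unit disk. For $f$ analytic on $\mathbb{D}$ and $0<r<1$, $M(r)=\max_{|z|=r}|f(z)|$. For $M>0$, $\Omega(M)=\{z\in\mathbb{D}:|f(z)|<M\}$ and $A(M)=\int_{\Omega(M)}|f'(z)|^2\,dA(z)\in[0,+\infty]$, where $dA(z)$ is two-dimensional Lebesgue measure (so $A(M)$ is the Euclidean area of $f(\Omega(M))$ counting multiplicity). ''Universal'' means that $r_0$ does not depend on $f$ or $r$. *)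

(* Defs.v *)
From HB Require Import structures.
From mathcomp Require Import all_boot all_order all_algebra.
From mathcomp Require Import all_classical all_reals all_analysis.
From mathcomp Require Export complex.

Set Implicit Arguments.
Unset Strict Implicit.
Unset Printing Implicit Defensive.

Import Order.TTheory GRing.Theory Num.Theory numFieldNormedType.Exports.

Local Open Scope classical_set_scope.
Local Open Scope complex_scope.
Local Open Scope ring_scope.

(* R[i] as a one-dimensional normed module over itself. *)
HB.instance Definition _ (R : realType) :=
  PseudoPointedMetric.copy R[i] R[i]^o.
HB.instance Definition _ (R : realType) := Vector.copy R[i] R[i]^o.
HB.instance Definition _ (R : realType) := NormedModule.copy R[i] R[i]^o.

(* The modulus as an element of R; the norm `|z| of z : R[i] lives in R[i]. *)
Notation cmod := ComplexField.Normc.normc.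

Definition unit_disk (R : realType) : set R[i] := [set z | cmod z < 1].

(* Complex differentiability: the scalars of the normed module R[i] are
   R[i] itself, so h^-1 *: (f (h *: 1 + z) - f z) has a limit as the complex
   number h tends to 0.  Values of f outside the disk play no role. *)
Definition analytic_on_disk (R : realType) (f : R[i] -> R[i]) : Prop :=
  forall z, unit_disk z -> derivable f z 1.

(* M(r); f is continuous on the circle when r < 1, so the supremum is a
   maximum. *)
Definition max_modulus (R : realType) (f : R[i] -> R[i]) (r : R) : R :=
  sup [set cmod (f z) | z in [set z | cmod z = r]].

Definition Omega (R : realType) (f : R[i] -> R[i]) (M : R) : set R[i] :=
  [set z | unit_disk z /\ cmod (f z) < M].

(* A(M), with the plane R * R identified with R[i] by (x, y) |-> x +i* y. *)
Definition area (R : realType) (f : R[i] -> R[i]) (M : R) : \bar R :=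
  (\int[(@lebesgue_measure R \x @lebesgue_measure R)]_(p in
      [set p : R * R | Omega f M (p.1 +i* p.2)])
     ((cmod (derive1 f (p.1 +i* p.2)) ^+ 2)%:E))%E.

Definition area_ratio (R : realType) (f : R[i] -> R[i]) (r : R) : \bar R :=
  (area f (max_modulus f r) / (pi * max_modulus f r ^+ 2)%:E)%E.

(* Main.v *)
Require Import Defs.
From mathcomp Require Import all_boot all_order all_algebra.
From mathcomp Require Import all_classical all_reals all_analysis.
From mathcomp Require Import measurable_realfun.
From mathcomp Require Import ring lra.

(** Division of [f] by one of its values on the circle [|z| = r] reduces the
    theorem to this: if [f 0 = 0] and [1 <= |f z1|] with [|z1| <= r] and [r]
    small, then the energy of [f] at level 1, that is the integral of [|f'|^2]
    over [{|f| < 1}], is at least [pi] ([energy_ge_pi]).  The theorem follows by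
    taking all points of the circle for [z1]: [M(r)] is the supremum of [|f|]
    there, and it is positive by the identity theorem ([identity_disk]).

    Area and zeros.  If [t <= |f|] on the boundary of a rectangle, Green's formula
    for [min(|f|^2, t^2) * f' / f], with a smoothed minimum, equates the
    integral of [|f'|^2] over the part of the rectangle where [|f| < t] with
    [t^2 / 2] times the imaginary part of the boundary integral of [f' / f]
    ([truncated_identity], [logint_energy]).  Dividing out a zero splits off
    [2 * pi] from this imaginary part, and what remains for the cofactor is
    nonnegative, by the same identity ([logint_factor], [logint_ge0]).  So one
    zero inside costs an area [pi * t^2], two zeros twice as much.

    Length and area.  If the energy is below [pi], then among many dyadic square
    annuli around 0, all much larger than [|z1|], one carries little of it.
    Fubini's theorem yields four segments in that annulus, bounding a rectangle,
    on whose boundary a truncation of [|f|^2] hardly varies ([good_loop]).  By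
    the maximum principle and [1 <= |f z1|], this forces [3/4 <= |f|] on the
    whole boundary ([good_box_lower]).

    Conclusion.  If [f] has a second zero in the rectangle, the area lemma at
    level [3/4] gives at least [2 * (9/16) * pi > pi].  Otherwise [f = z * h] with
    [h] without zeros there; the positive harmonic function [ln (|h| / c)] is
    large at [z1], because [|h z1| >= 1 / r], hence by [harnack] on a whole square
    around 0, on whose boundary then [1 <= |f|]; the area lemma at level 1 gives
    [pi] after all.

    The function theory is done on rectangles, whose sides and slices are what
    Fubini's theorem provides.  It rests on [green_goursat], Green's formula
    under mere differentiability: it contains Goursat's theorem, and from there
    come [cauchy_formula], the differentiability of derivatives ([holo_dv]),
    division by zeros ([holo_factor]) and [max_principle]. *)

Set Implicit Arguments.
Unset Strict Implicit.
Unset Printing Implicit Defensive.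

Import Order.TTheory GRing.Theory Num.Theory numFieldNormedType.Exports.

Local Open Scope classical_set_scope.
Local Open Scope complex_scope.
Local Open Scope ring_scope.

Notation Re := complex.Re.
Notation Im := complex.Im.

(** * Real numbers: large powers, integrals over segments *)

Section Archimedean.
Variable R : realType.

Lemma nat_above (x : R) : exists n, x < n%:R.
Proof.
by exists (Num.bound `|x|); rewrite (le_lt_trans (ler_norm _)) ?archi_boundP.
Qed.

Lemma pow_unbounded (q K : R) : 1 < q -> exists n, K < q ^+ n.
Proof.
move=> q1; have q0 : 0 <= q by lra.
have bernoulli n : 1 + n%:R * (q - 1) <= q ^+ n.
  elim: n => [|n IH]; first by rewrite mul0r addr0 expr0.
  rewrite exprS -natr1.
  have := ler_wpM2l q0 IH; have := mulr_ge0 (ler0n R n) (sqr_ge0 (q - 1)); lra.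
have [n nK] := nat_above (K / (q - 1)); exists n.
by have := bernoulli n; move: nK; rewrite ltr_pdivrMr; lra.
Qed.

End Archimedean.

Section RealIntegral.
Variable R : realType.
Implicit Types (f g F : R -> R) (a b c x y : R).

Definition rcont f x := forall e, 0 < e ->
  exists2 d : R, 0 < d & forall y, `|y - x| < d -> `|f y - f x| <= e.

Lemma rcont_continuous f x : rcont f x -> {for x, continuous f}.
Proof.
move=> fx; apply/cvgrPdist_le => e e0.
have [d d0 fd] := fx e e0.
apply/nbhs_ballP; exists d => //= y.
by rewrite /ball /= => xy; rewrite distrC; apply: fd; rewrite distrC.
Qed.

(** Integrals are taken of functions continuous at each point of a closed segment
    as functions on the whole line ([rcont_on]): the integrands are restrictions
    of functions on the plane, continuous on an open set. *)
Definition rint1 f a b := \int[@lebesgue_measure R]_(x in `[a, b]) f x.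

Definition rcont_on f a b := forall x, a <= x <= b -> rcont f x.

Lemma rcont_on_within f a b : rcont_on f a b -> {within `[a, b], continuous f}.
Proof.
move=> fc; apply: continuous_in_subspaceT => x; rewrite inE /= in_itv /= => xab.
exact: rcont_continuous (fc _ xab).
Qed.

Lemma rcont_on_integrable f a b : rcont_on f a b ->
  (@lebesgue_measure R).-integrable `[a, b] (EFin \o f).
Proof.
move=> fc; apply: continuous_compact_integrable; first exact: segment_compact.
exact: rcont_on_within.
Qed.

Lemma rcont_onW f a b a' b' : rcont_on f a b -> a <= a' -> b' <= b ->
  rcont_on f a' b'.
Proof. by move=> fc aa bb x /andP[ax xb]; apply: fc; lra. Qed.

Lemma rcontD f g x : rcont f x -> rcont g x -> rcont (fun x => f x + g x) x.
Proof.
move=> cf cg e e0; have e2 : 0 < e / 2 by lra.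
have [d d0 fd] := cf _ e2; have [d' d'0 gd] := cg _ e2.
exists (Num.min d d'); first by rewrite lt_min d0.
move=> y; rewrite lt_min => /andP[/fd h1 /gd h2].
rewrite (_ : _ - _ = (f y - f x) + (g y - g x)); last by ring.
by rewrite (le_trans (ler_normD _ _))//; lra.
Qed.

Lemma rcontZ k f x : rcont f x -> rcont (fun x => k * f x) x.
Proof.
move=> cf e e0; have k0 := normr_ge0 k.
have e2 : 0 < e / (`|k| + 1) by rewrite divr_gt0//; lra.
have [d d0 fd] := cf _ e2; exists d => // y /fd h.
rewrite -mulrBr normrM (le_trans (ler_wpM2l k0 h))//.
by rewrite mulrA ler_pdivrMr; [nra|lra].
Qed.

Lemma rcont_cst k x : rcont (fun=> k) x.
Proof. by move=> e e0; exists 1 => // y _; rewrite subrr normr0 ltW. Qed.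

Lemma rint1D f g a b : rcont_on f a b -> rcont_on g a b ->
  rint1 (fun x => f x + g x) a b = rint1 f a b + rint1 g a b.
Proof. by move=> cf cg; rewrite /rint1 RintegralD//; exact: rcont_on_integrable. Qed.

Lemma rint1Z k f a b : rcont_on f a b ->
  rint1 (fun x => k * f x) a b = k * rint1 f a b.
Proof. by move=> cf; rewrite /rint1 RintegralZl//; exact: rcont_on_integrable. Qed.

Lemma rint1_cst k a b : a <= b -> rint1 (fun=> k) a b = k * (b - a).
Proof.
move=> ab; rewrite /rint1 Rintegral_cst//= lebesgue_measure_itv /= lte_fin.
case: ltP => //= ba; have -> : b = a by lra.
by rewrite subrr.
Qed.

Lemma rint1_le f g a b : rcont_on f a b -> rcont_on g a b ->
  (forall x, a <= x <= b -> f x <= g x) -> rint1 f a b <= rint1 g a b.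
Proof.
move=> cf cg fg; apply: le_Rintegral => //; exact: rcont_on_integrable.
Qed.

Lemma rint1_ext f g a b : (forall x, a <= x <= b -> f x = g x) ->
  rint1 f a b = rint1 g a b.
Proof.
by move=> fg; apply: eq_Rintegral => x; rewrite inE /= in_itv /=; exact: fg.
Qed.

Lemma rint1_bound f a b M : a <= b -> rcont_on f a b ->
  (forall x, a <= x <= b -> `|f x| <= M) -> `|rint1 f a b| <= M * (b - a).
Proof.
move=> ab cf fM; have cM k : rcont_on (fun=> k) a b by move=> *; exact: rcont_cst.
rewrite ler_norml; apply/andP; split.
  rewrite -mulNr -rint1_cst//; apply: rint1_le => // x /fM.
  by rewrite ler_norml => /andP[].
rewrite -rint1_cst//; apply: rint1_le => // x /fM.
by rewrite ler_norml => /andP[].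
Qed.

Lemma rint1_chasles f a b c : a <= b <= c -> rcont_on f a c ->
  rint1 f a c = rint1 f a b + rint1 f b c.
Proof.
move=> /andP[ab bc] cf; have ci := rcont_on_integrable cf.
have h := Rintegral_itvB (x := b) ci.
rewrite /rint1 -(Rintegral_itv_obnd_cbnd (r := b)); last first.
  apply: integrableS ci => //; apply: subset_itv => //=.
by rewrite -h ?bnd_simp//; ring.
Qed.

Lemma rint1_FTC f F a b : a <= b -> rcont_on f a b ->
  (forall x, a <= x <= b -> is_derive x 1 F (f x)) ->
  rint1 f a b = F b - F a.
Proof.
move=> ab cf dF; move: (ab); rewrite le_eqVlt => /predU1P[e|{}ab].
  by rewrite e /rint1 set_itv1 Rintegral_set1 subrr.
rewrite /rint1 /Rintegral (@continuous_FTC2 _ f F)//.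
- exact: rcont_on_within.
- have cF x : a <= x <= b -> {for x, continuous F}.
    move=> xab; apply: differentiable_continuous; apply/derivable1_diffP.
    by have [] := dF x xab.
  split.
  + move=> x; rewrite in_itv /= => /andP[ax xb].
    by have xab : a <= x <= b by [lra]; have [] := dF x xab.
  + by apply: cvg_at_right_filter; apply: cF; lra.
  + by apply: cvg_at_left_filter; apply: cF; lra.
- move=> x; rewrite in_itv /= => /andP[ax xb]; rewrite derive1E.
  by have xab : a <= x <= b by [lra]; have [_ ->] := dF x xab.
Qed.

Lemma is_derive_of_approx F x d :
  (forall e, 0 < e -> exists2 dl : R, 0 < dl & forall y, `|y - x| < dl ->
     `|F y - F x - d * (y - x)| <= e * `|y - x|) -> is_derive x 1 F d.
Proof.
move=> H; suff L : (h^-1 *: ((F \o shift x) (h *: 1) - F x)) @[h --> 0^'] --> d.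
  by apply: DeriveDef; [apply: cvgP L|apply: cvg_lim L].
apply/cvgrPdist_le => e e0; have [dl dl0 Hd] := H e e0.
apply/nbhs_ballP; exists dl => //= h; rewrite /ball /= sub0r normrN => hd h0.
have := Hd (h + x); rewrite addrK => /(_ hd) {}Hd.
rewrite /shift /= [h *: 1]mulr1 distrC.
have hp : 0 < `|h| by rewrite normr_gt0.
rewrite -(ler_pM2r hp) -normrM.
rewrite (_ : _ * h = F (h + x) - F x - d * h)//.
by rewrite /GRing.scale/=; field; exact: h0.
Qed.

End RealIntegral.

(** * The modulus of a complex number *)

Section Modulus.
Variable R : realType.
Implicit Types (z w : R[i]).

Lemma cReD z w : Re (z + w) = Re z + Re w. Proof. by case: z; case: w. Qed.
Lemma cImD z w : Im (z + w) = Im z + Im w. Proof. by case: z; case: w. Qed.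
Lemma cReN z : Re (- z) = - Re z. Proof. by case: z. Qed.
Lemma cImN z : Im (- z) = - Im z. Proof. by case: z. Qed.
Lemma cReB z w : Re (z - w) = Re z - Re w. Proof. by rewrite cReD cReN. Qed.
Lemma cImB z w : Im (z - w) = Im z - Im w. Proof. by rewrite cImD cImN. Qed.
Lemma cReM z w : Re (z * w) = Re z * Re w - Im z * Im w.
Proof. by case: z; case: w. Qed.
Lemma cImM z w : Im (z * w) = Re z * Im w + Im z * Re w.
Proof. by case: z => a b; case: w => c d /=; ring. Qed.

Lemma complex_ext z w : Re z = Re w -> Im z = Im w -> z = w.
Proof. by case: z; case: w => a b c d /= -> ->. Qed.

Lemma cmod_ge0 z : 0 <= cmod z. Proof. by case: z => a b; exact: sqrtr_ge0. Qed.
Lemma cmodD z w : cmod (z + w) <= cmod z + cmod w. Proof. exact: le_normcD. Qed.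
Lemma cmodM z w : cmod (z * w) = cmod z * cmod w.
Proof. exact: ComplexField.Normc.normcM. Qed.
Lemma cmodN z : cmod (- z) = cmod z. Proof. exact: normcN. Qed.
Lemma cmodC z w : cmod (z - w) = cmod (w - z). Proof. by rewrite -cmodN opprB. Qed.
Lemma cmod0 : cmod (0 : R[i]) = 0. Proof. exact: ComplexField.Normc.normc0. Qed.
Lemma cmod1 : cmod (1 : R[i]) = 1. Proof. exact: ComplexField.Normc.normc1. Qed.
Lemma cmodV z : cmod z^-1 = (cmod z)^-1. Proof. exact: ComplexField.Normc.normcV. Qed.
Lemma cmodX z n : cmod (z ^+ n) = cmod z ^+ n.
Proof. by elim: n => [|n IH]; rewrite ?expr0 ?cmod1// !exprS cmodM IH. Qed.
Lemma cmodR (x : R) : cmod x%:C = `|x|.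
Proof. by rewrite /= expr0n /= addr0 sqrtr_sqr. Qed.
Lemma cmod_eq0 z : (cmod z == 0) = (z == 0).
Proof.
by apply/eqP/eqP => [|->]; [exact: ComplexField.Normc.eq0_normc|exact: cmod0].
Qed.
Lemma cmod_gt0 z : (0 < cmod z) = (z != 0).
Proof. by rewrite lt_def cmod_ge0 andbT cmod_eq0. Qed.
Lemma cmod_conj z : cmod (conjc z) = cmod z.
Proof. by case: z => a b /=; rewrite sqrrN. Qed.
Lemma cmodi : cmod (0 +i* 1 : R[i]) = 1.
Proof. by rewrite /= expr0n /= expr1n add0r sqrtr1. Qed.
Lemma cmod_sqr z : cmod z ^+ 2 = Re z ^+ 2 + Im z ^+ 2.
Proof. by case: z => a b /=; rewrite sqr_sqrtr// addr_ge0 ?sqr_ge0. Qed.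
Lemma conjcM_cmod z : z * conjc z = (cmod z ^+ 2)%:C.
Proof. by rewrite cmod_sqr; case: z => a b /=; congr (_ +i* _); ring. Qed.

Lemma cmodB_ge z w : cmod z - cmod w <= cmod (z - w).
Proof. by have := cmodD (z - w) w; rewrite subrK; lra. Qed.

Lemma Re_le_cmod z : `|Re z| <= cmod z.
Proof.
rewrite -(@ler_pXn2r _ 2) ?nnegrE ?cmod_ge0 ?normr_ge0//.
by rewrite cmod_sqr real_normK ?num_real// lerDl sqr_ge0.
Qed.

Lemma Im_le_cmod z : `|Im z| <= cmod z.
Proof.
rewrite -(@ler_pXn2r _ 2) ?nnegrE ?cmod_ge0 ?normr_ge0//.
by rewrite cmod_sqr real_normK ?num_real// lerDr sqr_ge0.
Qed.

Lemma cmod_le_ReIm z : cmod z <= `|Re z| + `|Im z|.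
Proof.
rewrite -(@ler_pXn2r _ 2) ?nnegrE ?cmod_ge0 ?addr_ge0 ?normr_ge0//.
rewrite cmod_sqr -(@real_normK _ (Re z)) ?num_real// -(@real_normK _ (Im z)) ?num_real//.
by have := normr_ge0 (Re z); have := normr_ge0 (Im z); nra.
Qed.

Lemma cmod_lt_sqr z (r : R) : 0 <= r ->
  (cmod z < r) = (Re z ^+ 2 + Im z ^+ 2 < r ^+ 2).
Proof. by move=> r0; rewrite -cmod_sqr ltr_pXn2r// nnegrE cmod_ge0. Qed.

End Modulus.

(** * Continuity and derivatives of functions of a complex variable *)

Section Derivatives.
Variable R : realType.
Implicit Types (z w A B : R[i]) (f g : R[i] -> R[i]).

(** Estimates use the real-valued modulus: the norm of a complex number is itself
    complex, and the order of the complex numbers is only partial. *)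
Definition little_o (E : R[i] -> R[i]) z := forall e : R, 0 < e ->
  exists2 d : R, 0 < d & forall w, cmod (w - z) < d -> cmod (E w) <= e * cmod (w - z).

Definition ccont g z := forall e : R, 0 < e ->
  exists2 d : R, 0 < d & forall w, cmod (w - z) < d -> cmod (g w - g z) <= e.

(** Real differentiability at [z] in Wirtinger's form: [A] and [B] are the
    derivatives with respect to [z] and to its conjugate.  The product rule
    keeps the shape it has for complex derivatives, and complex differentiability
    is the case [B = 0]. *)
Definition rder g z A B :=
  little_o (fun w => g w - g z - (A * (w - z) + B * conjc (w - z))) z.

Definition cder g z A := rder g z A 0.

Definition near_eq f g z :=
  exists2 d : R, 0 < d & forall w, cmod (w - z) < d -> f w = g w.

Lemma little_oD E F z : little_o E z -> little_o F z -> little_o (fun w => E w + F w) z.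
Proof.
move=> nE nF e e0; have e2 : 0 < e / 2 by lra.
have [d d0 Ed] := nE _ e2; have [d' d'0 Fd] := nF _ e2.
exists (Num.min d d'); first by rewrite lt_min d0.
move=> w; rewrite lt_min => /andP[/Ed h1 /Fd h2].
by rewrite (le_trans (cmodD _ _))//; lra.
Qed.

Lemma little_o_bounded E (F : R[i] -> R[i]) z (K d : R) : 0 < d -> little_o E z ->
  (forall w, cmod (w - z) < d -> cmod (F w) <= K * cmod (E w)) -> little_o F z.
Proof.
move=> d0 nE FK e e0.
have K0 : 0 < `|K| + 1 by have := normr_ge0 K; lra.
have [d' d'0 Ed] := nE _ (divr_gt0 e0 K0).
exists (Num.min d d'); first by rewrite lt_min d0.
move=> w; rewrite lt_min => /andP[/FK h1 /Ed]; rewrite mulrAC ler_pdivlMr// => h2.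
have := ler_norm K; have := cmod_ge0 (E w); nra.
Qed.

Lemma little_oZ k E z : little_o E z -> little_o (fun w => k * E w) z.
Proof.
by move=> nE; apply: (little_o_bounded (K := cmod k) ltr01 nE) => w _; rewrite cmodM.
Qed.

Lemma little_o_quadratic E z (K d : R) : 0 < d ->
  (forall w, cmod (w - z) < d -> cmod (E w) <= K * cmod (w - z) ^+ 2) -> little_o E z.
Proof.
move=> d0 EK e e0; have K0 : 0 < `|K| + 1 by have := normr_ge0 K; lra.
exists (Num.min d (e / (`|K| + 1))); first by rewrite lt_min d0 divr_gt0.
move=> w; rewrite lt_min => /andP[/EK h1]; rewrite ltr_pdivlMr// => h2.
have := ler_norm K; have := cmod_ge0 (w - z); nra.
Qed.

Lemma little_o_ext E F z : (forall w, E w = F w) -> little_o E z -> little_o F z.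
Proof. by move=> EF nE e e0; have [d d0 H] := nE e e0; exists d => // w; rewrite -EF; apply: H. Qed.

Lemma rder_lip g z A B : rder g z A B -> exists K : R, exists2 d : R, 0 < d & 0 < K /\
  forall w, cmod (w - z) < d -> cmod (g w - g z) <= K * cmod (w - z).
Proof.
move=> /(_ 1 ltr01)[d d0 H]; exists (1 + cmod A + cmod B); exists d => //.
split; first by have := cmod_ge0 A; have := cmod_ge0 B; lra.
move=> w /H; set L := _ + _ * conjc _; move=> h.
have := cmodD (g w - g z - L) L; rewrite subrK.
have : cmod L <= (cmod A + cmod B) * cmod (w - z).
  by rewrite (le_trans (cmodD _ _))// !cmodM cmod_conj mulrDl.
lra.
Qed.

Lemma rder_cont g z A B : rder g z A B -> ccont g z.
Proof.
move=> /rder_lip[K [d d0 [K0 H]]] e e0.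
exists (Num.min d (e / K)); first by rewrite lt_min d0 divr_gt0.
move=> w; rewrite lt_min => /andP[/H h]; rewrite ltr_pdivlMr// => h2.
by apply: le_trans h _; lra.
Qed.

Lemma rder_near f g z A B : near_eq f g z -> rder f z A B -> rder g z A B.
Proof.
move=> [d d0 fg] df; apply: (little_o_bounded (K := 1) d0 df) => w wd.
by rewrite mul1r -!fg// subrr cmod0.
Qed.

Lemma rder_ext f g z A B A' B' : (forall w, f w = g w) -> A = A' -> B = B' ->
  rder f z A B -> rder g z A' B'.
Proof. by move=> fg -> ->; apply: little_o_ext => w; rewrite !fg. Qed.

Lemma little_o0 E z : (forall w, E w = 0) -> little_o E z.
Proof.
move=> E0 e e0; exists 1 => // w _; rewrite E0 cmod0 mulr_ge0// ?cmod_ge0//.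
exact: ltW.
Qed.

Lemma rder_cst k z : rder (fun=> k) z 0 0.
Proof. by apply: little_o0 => w; ring. Qed.

Lemma rder_id z : rder id z 1 0.
Proof. by apply: little_o0 => w /=; ring. Qed.

Lemma rderD f g z A B A' B' : rder f z A B -> rder g z A' B' ->
  rder (fun w => f w + g w) z (A + A') (B + B').
Proof. by move=> df dg; apply: little_o_ext (little_oD df dg) => w; ring. Qed.

Lemma rder_conj f z A B : rder f z A B ->
  rder (fun w => conjc (f w)) z (conjc B) (conjc A).
Proof.
move=> df e e0; have [d d0 H] := df e e0; exists d => // w /H.
rewrite -cmod_conj !(rmorphB, rmorphD, rmorphM) /= !conjcK => h.
by apply: le_trans h; rewrite le_eqVlt; apply/orP; left; apply/eqP; congr cmod; ring.
Qed.

Lemma rderM f g z A B A' B' : rder f z A B -> rder g z A' B' ->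
  rder (fun w => f w * g w) z (A * g z + f z * A') (B * g z + f z * B').
Proof.
move=> df dg.
have [K [d d0 [K0 Kf]]] := rder_lip df; have [L [d' d'0 [L0 Lg]]] := rder_lip dg.
have dd : 0 < Num.min d d' by rewrite lt_min d0.
have q : little_o (fun w => (f w - f z) * (g w - g z)) z.
  apply: (little_o_quadratic (K := K * L) dd) => w.
  rewrite lt_min => /andP[/Kf h /Lg k]; rewrite cmodM expr2 mulrACA.
  by apply: ler_pM => //; exact: cmod_ge0.
apply: little_o_ext (little_oD (little_oD (little_oZ (g z) df) (little_oZ (f z) dg)) q) => w /=.
by ring.
Qed.

Lemma ccont_neq0 g z : ccont g z -> g z != 0 ->
  exists2 d : R, 0 < d & forall w, cmod (w - z) < d -> cmod (g z) / 2 <= cmod (g w).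
Proof.
move=> cg g0; have h : 0 < cmod (g z) / 2 by rewrite divr_gt0// cmod_gt0.
have [d d0 H] := cg _ h; exists d => // w /H.
by have := cmodB_ge (g z) (g w); rewrite cmodC; lra.
Qed.

Lemma rderV g z A B : rder g z A B -> g z != 0 ->
  rder (fun w => (g w)^-1) z (- A / g z ^+ 2) (- B / g z ^+ 2).
Proof.
move=> dg gz0; have [d d0 gd] := ccont_neq0 (rder_cont dg) gz0.
have [K [d' d'0 [K0 Kf]]] := rder_lip dg.
have dd : 0 < Num.min d d' by rewrite lt_min d0.
have cz : 0 < cmod (g z) by rewrite cmod_gt0.
pose F w := (g w - g z) ^+ 2 / (g w * g z ^+ 2).
have q : little_o F z.
  apply: (little_o_quadratic (K := K ^+ 2 / (cmod (g z) / 2 * cmod (g z) ^+ 2)) dd) => w.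
  rewrite lt_min => /andP[/gd h /Kf k].
  rewrite /F cmodM cmodX cmodV cmodM cmodX [leRHS]mulrAC -exprMn.
  apply: ler_pM.
  - by rewrite sqr_ge0.
  - by rewrite invr_ge0 mulr_ge0 ?cmod_ge0// sqr_ge0.
  - by rewrite lerXn2r ?nnegrE ?cmod_ge0// (le_trans (cmod_ge0 _) k).
  - rewrite lef_pV2 ?posrE ?mulr_gt0 ?exprn_gt0//.
    + by rewrite ler_wpM2r// exprn_ge0// ltW.
    + by apply: lt_le_trans h; lra.
have nn := little_oD (little_oZ (- (g z ^- 2)) dg) q.
apply: (little_o_bounded (K := 1) dd nn) => w; rewrite lt_min => /andP[/gd h _].
have gw0 : g w != 0 by rewrite -cmod_gt0; lra.
rewrite mul1r le_eqVlt; apply/orP; left; apply/eqP; congr cmod.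
by rewrite /F; field; rewrite ?gw0 ?gz0.
Qed.

Lemma cder_cont g z A : cder g z A -> ccont g z. Proof. exact: rder_cont. Qed.

Lemma cder_cst k z : cder (fun=> k) z 0. Proof. exact: rder_cst. Qed.

Lemma cderD f g z A A' : cder f z A -> cder g z A' ->
  cder (fun w => f w + g w) z (A + A').
Proof. by move=> df dg; apply: rder_ext (rderD df dg); rewrite ?addr0. Qed.

Lemma cderM f g z A A' : cder f z A -> cder g z A' ->
  cder (fun w => f w * g w) z (A * g z + f z * A').
Proof. by move=> df dg; apply: rder_ext (rderM df dg) => //; ring. Qed.

Lemma cderV g z A : cder g z A -> g z != 0 ->
  cder (fun w => (g w)^-1) z (- A / g z ^+ 2).
Proof. by move=> dg g0; apply: rder_ext (rderV dg g0) => //; ring. Qed.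

Lemma cderX f z A n : cder f z A ->
  exists A', cder (fun w => f w ^+ n) z A'.
Proof.
move=> df; elim: n => [|n [A' IH]].
  by exists 0; apply: rder_ext (rder_cst 1 z).
by exists (A * f z ^+ n + f z * A'); apply: rder_ext (cderM df IH) => // w;
  rewrite exprS.
Qed.

Lemma cderP g z A : cder g z A <->
  little_o (fun w => g w - g z - A * (w - z)) z.
Proof. by split; apply: little_o_ext => w; ring. Qed.

Lemma cder_near f g z A : near_eq f g z -> cder f z A -> cder g z A.
Proof. exact: rder_near. Qed.

Lemma cder_subr a z : cder (fun w => w - a) z 1.
Proof. by apply: little_o0 => w; ring. Qed.

Lemma ccontM f g z : ccont f z -> ccont g z -> ccont (fun w => f w * g w) z.
Proof.
move=> cf cg e e0.
pose M := cmod (f z) + cmod (g z) + 1.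
have M0 : 1 <= M by have := cmod_ge0 (f z); have := cmod_ge0 (g z); rewrite /M; lra.
pose k := Num.min 1 (e / (2 * M)).
have k0 : 0 < k by rewrite lt_min ltr01 divr_gt0//; lra.
have k1 : k <= 1 by rewrite ge_min lexx.
have kM : k * (2 * M) <= e by rewrite -ler_pdivlMr ?ge_min ?lexx ?orbT//; lra.
have [d d0 fd] := cf _ k0; have [d' d'0 gd] := cg _ k0.
exists (Num.min d d'); first by rewrite lt_min d0.
move=> w; rewrite lt_min => /andP[/fd h1 /gd h2].
rewrite (_ : _ - _ = (f w - f z) * (g w - g z) + (f w - f z) * g z + f z * (g w - g z)); last by ring.
rewrite (le_trans (cmodD _ _))// (le_trans (lerD (cmodD _ _) (lexx _)))// !cmodM.
have := cmod_ge0 (f w - f z); have := cmod_ge0 (g w - g z).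
have := cmod_ge0 (f z); have := cmod_ge0 (g z).
rewrite /M in kM M0; nra.
Qed.

Lemma ccont_ext f g z : (forall w, f w = g w) -> ccont f z -> ccont g z.
Proof. by move=> fg cf e e0; have [d d0 H] := cf e e0; exists d => // w; rewrite -!fg; apply: H. Qed.

Lemma ccontD f g z : ccont f z -> ccont g z -> ccont (fun w => f w + g w) z.
Proof.
move=> cf cg e e0; have e2 : 0 < e / 2 by lra.
have [d d0 fd] := cf _ e2; have [d' d'0 gd] := cg _ e2.
exists (Num.min d d'); first by rewrite lt_min d0.
move=> w; rewrite lt_min => /andP[/fd h1 /gd h2].
rewrite (_ : _ - _ = (f w - f z) + (g w - g z)); last by ring.
by rewrite (le_trans (cmodD _ _))//; lra.
Qed.

Lemma ccont_cst k z : ccont (fun=> k) z. Proof. exact: cder_cont (cder_cst k z). Qed.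
End Derivatives.

(** * Rectangles and bisection *)

Section Boxes.
Variable R : realType.

Record box := Box { lft : R; rgt : R; bot : R; top : R }.
Implicit Types (Q S : box) (z w p : R[i]).

Definition wf Q := (lft Q <= rgt Q) && (bot Q <= top Q).
Definition inbox Q z := (lft Q <= Re z <= rgt Q) && (bot Q <= Im z <= top Q).
Definition inside Q z := (lft Q < Re z < rgt Q) && (bot Q < Im z < top Q).
Definition onbd Q z := inbox Q z &&
  [|| Re z == lft Q, Re z == rgt Q, Im z == bot Q | Im z == top Q].
Definition subbox S Q := [&& lft Q <= lft S, rgt S <= rgt Q, bot Q <= bot S & top S <= top Q].
Definition side Q := (rgt Q - lft Q) + (top Q - bot Q).
Definition barea Q := (rgt Q - lft Q) * (top Q - bot Q).
Definition midx Q := (lft Q + rgt Q) / 2.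
Definition midy Q := (bot Q + top Q) / 2.
Definition quarter Q (i j : bool) :=
  Box (if i then midx Q else lft Q) (if i then rgt Q else midx Q)
      (if j then midy Q else bot Q) (if j then top Q else midy Q).

Lemma inside_inbox Q z : inside Q z -> inbox Q z.
Proof. by rewrite /inside /inbox; lra. Qed.

Lemma inboxP Q z : inbox Q z -> ~~ inside Q z -> onbd Q z.
Proof.
rewrite /onbd => i; rewrite i /=; move: i; rewrite /inside /inbox.
move=> /andP[/andP[]]; rewrite !le_eqVlt [lft Q == _]eq_sym [bot Q == _]eq_sym.
do 4![case: eqP => _ //=; rewrite ?orbT//].
by move=> -> -> /andP[-> ->].
Qed.

Lemma onbd_inbox Q z : onbd Q z -> inbox Q z. Proof. by case/andP. Qed.

Lemma subbox_inbox S Q z : subbox S Q -> inbox S z -> inbox Q z.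
Proof. by rewrite /subbox /inbox; lra. Qed.

Lemma subbox_refl Q : subbox Q Q. Proof. by rewrite /subbox; lra. Qed.

Lemma subbox_trans S Q T : subbox S Q -> subbox Q T -> subbox S T.
Proof. by rewrite /subbox; lra. Qed.

Lemma wf_quarter Q i j : wf Q -> wf (quarter Q i j).
Proof. by rewrite /wf /quarter /midx /midy; case: i; case: j => /=; lra. Qed.

Lemma sub_quarter Q i j : wf Q -> subbox (quarter Q i j) Q.
Proof. by rewrite /wf /quarter /subbox /midx /midy; case: i; case: j => /=; lra. Qed.

Lemma side_quarter Q i j : side (quarter Q i j) = side Q / 2.
Proof. by rewrite /quarter /side /midx /midy; case: i; case: j => /=; lra. Qed.

Lemma side_ge0 Q : wf Q -> 0 <= side Q. Proof. by rewrite /wf /side; lra. Qed.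

Lemma cmod_inbox Q z w : inbox Q z -> inbox Q w -> cmod (z - w) <= side Q.
Proof.
move=> hz hw; apply: le_trans (cmod_le_ReIm _) _; rewrite cReB cImB.
by apply: lerD; rewrite ler_norml; move: hz hw; rewrite /inbox; lra.
Qed.

Lemma pow2_small (C d : R) : 0 < d -> exists n, C / 2 ^+ n < d.
Proof.
move=> d0; have [n Cn] := @pow_unbounded R 2 (C / d) ltac:(by lra).
by exists n; rewrite ltr_pdivrMr ?exprn_gt0// mulrC -ltr_pdivrMr.
Qed.

(** If [P] failed on [Q], it would fail on a quarter of [Q], on a quarter of that
    one, and so on; the corners of these nested boxes converge to a point, near
    which [P] holds on all small boxes. *)
Lemma cousin (P : box -> Prop) Q : wf Q ->
  (forall S, wf S -> subbox S Q -> (forall i j, P (quarter S i j)) -> P S) ->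
  (forall p, inbox Q p -> exists2 d : R, 0 < d & forall S, wf S -> subbox S Q ->
     inbox S p -> side S < d -> P S) ->
  P Q.
Proof.
move=> wfQ glue loc; apply: contrapT => nPQ.
pose bad S := [/\ wf S, subbox S Q & ~ P S].
have step S : exists S', bad S -> bad S' /\ exists i j, S' = quarter S i j.
  have [[wS sS nS]|nb] := pselect (bad S); last by exists S.
  have [[i [j nij]]|h] := pselect (exists i j, ~ P (quarter S i j)).
    exists (quarter S i j) => _; split; last by exists i, j.
    by split=> //; [exact: wf_quarter|exact: subbox_trans (sub_quarter i j wS) sS].
  exfalso; apply: nS; apply: glue => // i j; apply: contrapT => nij.
  by apply: h; exists i, j.
have [nxt nxtP] := choice step.
pose s n := iter n nxt Q.
have bads n : bad (s n).
  elim: n => [|n IH]; first by split=> //; exact: subbox_refl.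
  by have [] := nxtP _ IH.
have subs n : subbox (s n.+1) (s n).
  have [_ [i [j e]]] := nxtP _ (bads n).
  by rewrite [s n.+1]e; apply: sub_quarter; have [] := bads n.
have submn m n : subbox (s (n + m)%N) (s m).
  elim: n => [|n IH]; first exact: subbox_refl.
  exact: subbox_trans (subs _) IH.
have sides n : side (s n) = side Q / 2 ^+ n.
  elim: n => [|n IH]; first by rewrite expr0 divr1.
  have [_ [i [j e]]] := nxtP _ (bads n).
  by rewrite [s n.+1]e side_quarter IH exprS; field; rewrite expf_neq0.
have ordm m n : [/\ lft (s m) <= rgt (s n) & bot (s m) <= top (s n)].
  have h1 := submn m n; have h2 := submn n m; rewrite addnC in h2.
  have [h3 _ _] := bads (n + m)%N.
  by move: h1 h2 h3; rewrite /wf /subbox; split; lra.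
pose X := [set lft (s n) | n in [set: nat]].
pose Y := [set bot (s n) | n in [set: nat]].
have ubX n : ubound X (rgt (s n)) by move=> _ [m _ <-]; have [] := ordm m n.
have ubY n : ubound Y (top (s n)) by move=> _ [m _ <-]; have [] := ordm m n.
pose p := sup X +i* sup Y.
have inp n : inbox (s n) p.
  have X0 : X !=set0 by exists (lft (s 0)), 0%N.
  have Y0 : Y !=set0 by exists (bot (s 0)), 0%N.
  rewrite /inbox /=; apply/andP; split; apply/andP; split.
  - by apply: ub_le_sup; [exists (rgt (s 0)); exact: ubX|exists n].
  - exact: ge_sup.
  - by apply: ub_le_sup; [exists (top (s 0)); exact: ubY|exists n].
  - exact: ge_sup.
have [d d0 Hd] := loc p (inp 0%N).
have [n hn] := pow2_small (side Q) d0.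
have [w1 w2 w3] := bads n; apply: w3; apply: Hd => //.
by rewrite sides.
Qed.

(** [Q] may be degenerate, so that the lemma also applies to the edges of a box
    when the function is continuous on these only. *)
Lemma ccont_bounded (g : R[i] -> R[i]) Q : wf Q ->
  (forall z, inbox Q z -> ccont g z) ->
  exists M, forall z, inbox Q z -> cmod (g z) <= M.
Proof.
move=> wQ cg.
apply: (cousin (P := fun S => exists M, forall z, inbox S z -> cmod (g z) <= M)) => //.
  move=> S wS sS /= H.
  have [M00 H00] := H false false; have [M01 H01] := H false true.
  have [M10 H10] := H true false; have [M11 H11] := H true true.
  exists (Num.max (Num.max M00 M01) (Num.max M10 M11)) => z zS.
  have : exists i j, inbox (quarter S i j) z.
    exists (midx S <= Re z), (midy S <= Im z); move: zS; rewrite /inbox /quarter /=.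
    by case: (lerP (midx S)) => ?; case: (lerP (midy S)) => ? /=; lra.
  move=> [[] [[]]] h; rewrite !le_max; apply/orP.
  - by right; rewrite H11 ?orbT.
  - by right; rewrite H10.
  - by left; rewrite H01 ?orbT.
  - by left; rewrite H00.
move=> p pQ; have [d d0 H] := cg p pQ 1 ltr01; exists d => // S wS sS pS sd.
exists (cmod (g p) + 1) => z zS.
have := H z (le_lt_trans (cmod_inbox zS pS) sd).
by have := cmodD (g z - g p) (g p); rewrite subrK; lra.
Qed.

End Boxes.

(** * Integrals along the boundary of a rectangle and Green's formula *)

Section ContourIntegral.
Variable R : realType.
Implicit Types (Q S : box R) (z w p : R[i]) (a b c x y : R).

Definition cint (g : R -> R[i]) a b :=
  rint1 (fun x => Re (g x)) a b +i* rint1 (fun x => Im (g x)) a b.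

Definition pcont (g : R -> R[i]) a b :=
  rcont_on (fun x => Re (g x)) a b /\ rcont_on (fun x => Im (g x)) a b.

Lemma cint_ext f g a b : (forall x, a <= x <= b -> f x = g x) ->
  cint f a b = cint g a b.
Proof. by move=> fg; congr (_ +i* _); apply: rint1_ext => x /fg ->. Qed.

Lemma cintD f g a b : pcont f a b -> pcont g a b ->
  cint (fun x => f x + g x) a b = cint f a b + cint g a b.
Proof.
move=> [f1 f2] [g1 g2]; apply: complex_ext; rewrite ?cReD ?cImD /= -rint1D//;
  by apply: rint1_ext => x _; rewrite ?cReD ?cImD.
Qed.

Lemma rcont_onZ (f : R -> R) k a b : rcont_on f a b -> rcont_on (fun x => k * f x) a b.
Proof. by move=> cf x xab; apply: rcontZ; exact: cf. Qed.

Lemma cintZ (k : R[i]) f a b : pcont f a b ->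
  cint (fun x => k * f x) a b = k * cint f a b.
Proof.
have lin (u v : R -> R) (p q : R) : rcont_on u a b -> rcont_on v a b ->
    p * rint1 u a b + q * rint1 v a b = rint1 (fun x => p * u x + q * v x) a b.
  by move=> cu cv; rewrite rint1D ?rint1Z//; exact: rcont_onZ.
move=> [f1 f2]; apply: complex_ext; rewrite ?cReM ?cImM /= -?mulNr lin//.
  by apply: rint1_ext => x _; rewrite cReM mulNr.
by apply: rint1_ext => x _; rewrite cImM.
Qed.

Lemma cint_bound g a b M : a <= b -> pcont g a b ->
  (forall x, a <= x <= b -> cmod (g x) <= M) -> cmod (cint g a b) <= 2 * M * (b - a).
Proof.
move=> ab [c1 c2] gM; apply: le_trans (cmod_le_ReIm _) _ => /=.
have -> : 2 * M * (b - a) = M * (b - a) + M * (b - a) by ring.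
apply: lerD; apply: rint1_bound => // x /gM; apply: le_trans.
  exact: Re_le_cmod.
exact: Im_le_cmod.
Qed.

Lemma cint_chasles g a b c : a <= b <= c -> pcont g a c ->
  cint g a c = cint g a b + cint g b c.
Proof. by move=> abc [c1 c2]; apply: complex_ext; rewrite ?cReD ?cImD /=; exact: rint1_chasles. Qed.

Lemma rint1_affine al be a b : a <= b ->
  rint1 (fun x => al * x + be) a b = al * ((b ^+ 2 - a ^+ 2) / 2) + be * (b - a).
Proof.
move=> ab; pose F x := al / 2 * x ^+ 2 + be * x.
transitivity (F b - F a); last by rewrite /F; field.
apply: rint1_FTC => //.
- move=> x _; apply: rcontD; last exact: rcont_cst.
  by apply: rcontZ => e e0; exists e => // y; exact: ltW.
- move=> x _; apply: is_derive_of_approx => e e0; exists (e / (`|al / 2| + 1)).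
    by rewrite divr_gt0//; have := normr_ge0 (al / 2); lra.
  have aux (K D : R) : 0 <= K -> 0 <= D -> D < e / (K + 1) -> K * D * D <= e * D.
    by move=> K0 D0; rewrite ltr_pdivlMr; [nra|lra].
  move=> y yx; rewrite (_ : _ - _ = al / 2 * (y - x) * (y - x)); last by rewrite /F; field.
  by rewrite !(normrM _ (y - x)); apply: aux.
Qed.

Lemma cint_affine C1 C0 a b : a <= b ->
  cint (fun x => C1 * x%:C + C0) a b = C1 * ((b ^+ 2 - a ^+ 2) / 2)%:C + C0 * (b - a)%:C.
Proof.
move=> ab; apply: complex_ext; rewrite /= ?cReD ?cImD ?cReM ?cImM /= !mulr0 ?subr0 ?add0r ?addr0.
  by rewrite -rint1_affine//; apply: rint1_ext => x _; rewrite cReD cReM /= mulr0 subr0.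
by rewrite -rint1_affine//; apply: rint1_ext => x _; rewrite cImD cImM /= mulr0 add0r.
Qed.

Definition hint (g : R[i] -> R[i]) Q y := cint (fun x => g (x +i* y)) (lft Q) (rgt Q).
Definition vint (g : R[i] -> R[i]) Q x := cint (fun y => g (x +i* y)) (bot Q) (top Q).

(** The boundary integral of [g z dz], counterclockwise: [dz] is [i dy] on the
    vertical sides, and the top and left sides are run backwards. *)
Definition rectint (g : R[i] -> R[i]) Q : R[i] :=
  hint g Q (bot Q) + (0 +i* 1) * vint g Q (rgt Q)
  - hint g Q (top Q) - (0 +i* 1) * vint g Q (lft Q).

Definition bdcont (g : R[i] -> R[i]) Q := forall z, onbd Q z -> ccont g z.

Lemma ccont_h g y a b : (forall x, a <= x <= b -> ccont g (x +i* y)) ->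
  pcont (fun x => g (x +i* y)) a b.
Proof.
move=> cg; split=> x /cg cx e e0; have [d d0 H] := cx e e0; exists d => // t tx;
  have /H h : cmod ((t +i* y) - (x +i* y)) < d by
    (rewrite (_ : _ - _ = (t - x)%:C) ?cmodR//; apply: complex_ext;
     rewrite ?cReB ?cImB //= subrr).
- by apply: le_trans h; rewrite -cReB Re_le_cmod.
- by apply: le_trans h; rewrite -cImB Im_le_cmod.
Qed.

Lemma ccont_v g x a b : (forall y, a <= y <= b -> ccont g (x +i* y)) ->
  pcont (fun y => g (x +i* y)) a b.
Proof.
move=> cg; split=> y /cg cx e e0; have [d d0 H] := cx e e0; exists d => // t tx;
  have /H h : cmod ((x +i* t) - (x +i* y)) < d by
    (rewrite (_ : _ - _ = (0 +i* 1) * (t - y)%:C) ?cmodM ?cmodi ?mul1r ?cmodR//;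
     apply: complex_ext; rewrite ?cReB ?cImB ?cReM ?cImM /=; ring).
- by apply: le_trans h; rewrite -cReB Re_le_cmod.
- by apply: le_trans h; rewrite -cImB Im_le_cmod.
Qed.

Lemma onbd_h Q x y : wf Q -> lft Q <= x <= rgt Q -> (y == bot Q) || (y == top Q) ->
  onbd Q (x +i* y).
Proof.
rewrite /wf /onbd /inbox /= => /andP[_ w] ->.
by move=> /orP[] /eqP ->; rewrite ?eqxx ?lexx ?w ?orbT.
Qed.

Lemma onbd_v Q x y : wf Q -> bot Q <= y <= top Q -> (x == lft Q) || (x == rgt Q) ->
  onbd Q (x +i* y).
Proof.
rewrite /wf /onbd /inbox /= => /andP[w _] ->.
by move=> /orP[] /eqP ->; rewrite ?eqxx ?lexx ?w ?orbT.
Qed.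

Lemma bdcont_h g Q y : wf Q -> bdcont g Q -> (y == bot Q) || (y == top Q) ->
  pcont (fun x => g (x +i* y)) (lft Q) (rgt Q).
Proof. by move=> wQ cg yQ; apply: ccont_h => x hx; apply: cg; exact: onbd_h. Qed.

Lemma bdcont_v g Q x : wf Q -> bdcont g Q -> (x == lft Q) || (x == rgt Q) ->
  pcont (fun y => g (x +i* y)) (bot Q) (top Q).
Proof. by move=> wQ cg yQ; apply: ccont_v => y hy; apply: cg; exact: onbd_v. Qed.

Lemma rectint_ext f g Q : wf Q -> (forall z, onbd Q z -> f z = g z) ->
  rectint f Q = rectint g Q.
Proof.
move=> wQ fg; rewrite /rectint /hint /vint; congr (_ + _ * _ - _ - _ * _);
  apply: cint_ext => t ht; apply: fg; by [apply: onbd_h => //; rewrite eqxx ?orbT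
  | apply: onbd_v => //; rewrite eqxx ?orbT].
Qed.

Lemma rectintD f g Q : wf Q -> bdcont f Q -> bdcont g Q ->
  rectint (fun z => f z + g z) Q = rectint f Q + rectint g Q.
Proof.
move=> wQ cf cg; rewrite /rectint /hint /vint.
rewrite !cintD; try (by apply: bdcont_h => //; rewrite eqxx ?orbT);
  try (by apply: bdcont_v => //; rewrite eqxx ?orbT).
by ring.
Qed.

Lemma rectintZ (k : R[i]) f Q : wf Q -> bdcont f Q ->
  rectint (fun z => k * f z) Q = k * rectint f Q.
Proof.
move=> wQ cf; rewrite /rectint /hint /vint.
rewrite !cintZ; try (by apply: bdcont_h => //; rewrite eqxx ?orbT);
  try (by apply: bdcont_v => //; rewrite eqxx ?orbT).
by ring.
Qed.

Lemma rectint_bound g Q M : wf Q -> bdcont g Q ->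
  (forall z, onbd Q z -> cmod (g z) <= M) -> cmod (rectint g Q) <= 4 * M * side Q.
Proof.
move=> wQ cg gM; have [w1 w2] := andP wQ.
have h y : (y == bot Q) || (y == top Q) -> cmod (hint g Q y) <= 2 * M * (rgt Q - lft Q).
  move=> yQ; apply: cint_bound => //; first exact: bdcont_h.
  by move=> x hx; apply: gM; exact: onbd_h.
have v x : (x == lft Q) || (x == rgt Q) -> cmod (vint g Q x) <= 2 * M * (top Q - bot Q).
  move=> yQ; apply: cint_bound => //; first exact: bdcont_v.
  by move=> y hy; apply: gM; exact: onbd_v.
have h1 : cmod (hint g Q (bot Q)) <= 2 * M * (rgt Q - lft Q) by apply: h; rewrite eqxx.
have h2 : cmod (hint g Q (top Q)) <= 2 * M * (rgt Q - lft Q) by apply: h; rewrite eqxx orbT.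
have v1 : cmod (vint g Q (lft Q)) <= 2 * M * (top Q - bot Q) by apply: v; rewrite eqxx.
have v2 : cmod (vint g Q (rgt Q)) <= 2 * M * (top Q - bot Q) by apply: v; rewrite eqxx orbT.
have tri (A B C D : R[i]) : cmod (A + (0 +i* 1) * B - C - (0 +i* 1) * D)
    <= cmod A + cmod B + cmod C + cmod D.
  have := cmodD (A + (0 +i* 1) * B - C) (- ((0 +i* 1) * D)).
  have := cmodD (A + (0 +i* 1) * B) (- C); have := cmodD A ((0 +i* 1) * B).
  by rewrite !cmodN [cmod (_ * B)]cmodM [cmod (_ * D)]cmodM cmodi !mul1r; lra.
by apply: le_trans (tri _ _ _ _) _; rewrite /side; lra.
Qed.

Lemma rectint_hsplit g Q c : wf Q -> bdcont g Q -> lft Q <= c <= rgt Q ->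
  rectint g Q = rectint g (Box (lft Q) c (bot Q) (top Q))
              + rectint g (Box c (rgt Q) (bot Q) (top Q)).
Proof.
move=> wQ cg cQ; rewrite /rectint /hint /vint /=.
rewrite (cint_chasles cQ); last by apply: bdcont_h => //; rewrite eqxx.
rewrite (cint_chasles cQ); last by apply: bdcont_h => //; rewrite eqxx orbT.
by ring.
Qed.

Lemma rectint_vsplit g Q c : wf Q -> bdcont g Q -> bot Q <= c <= top Q ->
  rectint g Q = rectint g (Box (lft Q) (rgt Q) (bot Q) c)
              + rectint g (Box (lft Q) (rgt Q) c (top Q)).
Proof.
move=> wQ cg cQ; rewrite /rectint /hint /vint /=.
rewrite (cint_chasles cQ); last by apply: bdcont_v => //; rewrite eqxx orbT.
rewrite (cint_chasles cQ); last by apply: bdcont_v => //; rewrite eqxx.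
by ring.
Qed.

Lemma rectint_quarter g Q : wf Q -> (forall z, inbox Q z -> ccont g z) ->
  rectint g Q = rectint g (quarter Q false false) + rectint g (quarter Q true false)
              + rectint g (quarter Q false true) + rectint g (quarter Q true true).
Proof.
move=> wQ cg; have bc S : subbox S Q -> bdcont g S.
  by move=> sS z /onbd_inbox /(subbox_inbox sS); exact: cg.
have [w1 w2] := andP wQ.
have cm : lft Q <= midx Q <= rgt Q by rewrite /midx; lra.
rewrite (rectint_hsplit wQ (bc _ (subbox_refl _)) cm).
rewrite (rectint_vsplit (c := midy Q)) /=; first last.
- by rewrite /midy; lra.
- by apply: bc; rewrite /subbox /midx /=; lra.
- by rewrite /wf /midx /=; lra.
rewrite [X in _ + X](rectint_vsplit (c := midy Q)) /=; first last.
- by rewrite /midy; lra.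
- by apply: bc; rewrite /subbox /midx /=; lra.
- by rewrite /wf /midx /=; lra.
by rewrite /quarter /= addrACA addrA.
Qed.

Lemma rectint_affine A B k Q : wf Q ->
  rectint (fun z => k + A * z + B * conjc z) Q = (0 +i* 1) * B * (2 * barea Q)%:C.
Proof.
move=> /andP[w1 w2]; rewrite /rectint /hint /vint.
have eh y : cint (fun x => k + A * (x +i* y) + B * conjc (x +i* y)) (lft Q) (rgt Q)
  = cint (fun x => (A + B) * x%:C + (k + (A - B) * (0 +i* y))) (lft Q) (rgt Q).
  apply: cint_ext => x _; apply: complex_ext; rewrite !(cReD, cImD, cReM, cImM, cReN, cImN) /=; ring.
have ev x : cint (fun y => k + A * (x +i* y) + B * conjc (x +i* y)) (bot Q) (top Q)
  = cint (fun y => (0 +i* 1) * (A - B) * y%:C + (k + (A + B) * x%:C)) (bot Q) (top Q).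
  apply: cint_ext => y _; apply: complex_ext; rewrite !(cReD, cImD, cReM, cImM, cReN, cImN) /=; ring.
rewrite !eh !ev !cint_affine// /barea.
have iE (y : R) : 0 +i* y = (0 +i* 1) * y%:C.
  by apply: complex_ext; rewrite !(cReM, cImM) /=; ring.
rewrite (iE (bot Q)) (iE (top Q)).
set X := ((rgt Q ^+ 2 - _) / 2)%:C; set Y := ((top Q ^+ 2 - _) / 2)%:C.
rewrite !(rmorphM, rmorphB, rmorph1, rmorph_nat) /=.
by ring.
Qed.

Lemma cmod_small_eq0 z (K : R) : (forall e, 0 < e -> cmod z <= e * K) -> z = 0.
Proof.
move=> H; apply/eqP; rewrite -cmod_eq0 eq_le cmod_ge0 andbT leNgt; apply/negP => z0.
have [k k0 Kk] : exists2 k, 0 < k & K <= k.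
  by exists (`|K| + 1); rewrite ?ltr_wpDl// (le_trans (ler_norm K))// lerDl.
have k2 : 0 < 2 * k by rewrite mulr_gt0.
have := H _ (divr_gt0 z0 k2); rewrite mulrAC ler_pdivlMr// => h.
by have := ler_wpM2l (ltW z0) Kk; have := mulr_gt0 z0 k0; lra.
Qed.

(** Both sides are additive under bisection, so it suffices to compare them on
    small boxes around each point [p].  There [g] is [k + A z + B conj z] up to
    an error small compared with the side: the holomorphic part has integral
    zero, the other one contributes [2 i B] times the area, and the error is
    small compared with the squared side.  The area integral of [beta] enters as
    a function [I] of boxes that is additive and close to [beta p] times the
    area near [p]; with [beta = 0] and [I = 0] this is Goursat's theorem, where
    nothing is known about continuity of the derivative. *)
Theorem green_goursat (g : R[i] -> R[i]) (beta : R[i] -> R) (I : box R -> R) Q :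
  wf Q ->
  (forall z, inbox Q z -> exists A, rder g z A (beta z)%:C) ->
  (forall S, wf S -> subbox S Q -> I S = I (quarter S false false) + I (quarter S true false)
     + I (quarter S false true) + I (quarter S true true)) ->
  (forall p, inbox Q p -> forall e, 0 < e -> exists2 d : R, 0 < d & forall S,
     wf S -> subbox S Q -> inbox S p -> side S < d ->
     `|I S - beta p * barea S| <= e * side S ^+ 2) ->
  rectint g Q = (0 +i* (2 * I Q)).
Proof.
move=> wQ dg addI locI.
have cg z : inbox Q z -> ccont g z by move=> /dg[A]; exact: rder_cont.
pose D S := rectint g S - (0 +i* (2 * I S)).
suff D0 e : 0 < e -> cmod (D Q) <= e * side Q ^+ 2.
  by apply/eqP; rewrite -subr_eq0; apply/eqP; exact: cmod_small_eq0 D0.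
move=> e0; apply: (cousin (P := fun S => cmod (D S) <= e * side S ^+ 2)) => //.
  move=> S wS sS H.
  have sum4 (z1 z2 z3 z4 : R[i]) (a b c d : R) :
    z1 + z2 + z3 + z4 - (0 +i* (2 * (a + b + c + d))) = z1 - (0 +i* (2 * a))
      + (z2 - (0 +i* (2 * b))) + (z3 - (0 +i* (2 * c))) + (z4 - (0 +i* (2 * d))).
    by apply: complex_ext; rewrite !(cReD, cImD, cReN, cImN) /=; ring.
  have -> : D S = D (quarter S false false) + D (quarter S true false) + D (quarter S false true)
                + D (quarter S true true).
    have cS z : inbox S z -> ccont g z by move=> /(subbox_inbox sS); exact: cg.
    by rewrite /D (rectint_quarter wS cS) (addI S wS sS) sum4.
  apply: le_trans (cmodD _ _) _; apply: le_trans (lerD (cmodD _ _) (lexx _)) _.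
  apply: le_trans (lerD (lerD (cmodD _ _) (lexx _)) (lexx _)) _.
  have := H false false; have := H false true; have := H true false; have := H true true.
  by rewrite !side_quarter; lra.
move=> p pQ; have [A dA] := dg p pQ.
have e8 : 0 < e / 8 by lra.
have e4 : 0 < e / 4 by lra.
have [d d0 Hd] := dA _ e8; have [d' d'0 Hd'] := locI p pQ _ e4.
exists (Num.min d d'); first by rewrite lt_min d0.
move=> S wS sS pS; rewrite lt_min => /andP[sd sd'].
have {}Hd' := Hd' S wS sS pS sd'.
pose B := (beta p)%:C.
pose L z := (g p - A * p - B * conjc p) + A * z + B * conjc z.
have cL z : ccont L z.
  apply: (@rder_cont _ _ _ (0 + (0 * z + A * 1) + (0 * conjc z + B * conjc 0))
                           (0 + (0 * z + A * 0) + (0 * conjc z + B * conjc 1))).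
  apply: rderD; first apply: rderD.
  - exact: rder_cst.
  - by apply: rderM; [exact: rder_cst|exact: rder_id].
  - by apply: rderM; [exact: rder_cst|apply: rder_conj; exact: rder_id].
pose E z := g z - L z.
have cgS : bdcont g S by move=> z /onbd_inbox /(subbox_inbox sS); exact: cg.
have cE : bdcont E S.
  move=> z /cgS cz; apply: ccont_ext (ccontD cz (ccontM (ccont_cst (-1) z) (cL z))) => w.
  by rewrite mulN1r.
have -> : D S = rectint E S + (0 +i* (2 * (beta p * barea S - I S))).
  have e1 : rectint g S = rectint E S + rectint L S.
    rewrite -(rectintD wS cE (fun z _ => cL z)).
    by apply: rectint_ext => // z _; rewrite /E subrK.
  rewrite /D e1 /L rectint_affine//.
  have -> : 0 +i* (2 * (beta p * barea S - I S)) = (0 +i* 1) * B * (2 * barea S)%:C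
      - (0 +i* (2 * I S)).
    by apply: complex_ext; rewrite !(cReD, cImD, cReM, cImM, cReN, cImN) /=; ring.
  by ring.
have s0 := side_ge0 wS.
have bE : cmod (rectint E S) <= 4 * (e / 8 * side S) * side S.
  apply: rectint_bound => // z /onbd_inbox zS.
  have zp := cmod_inbox zS pS.
  have := Hd z (le_lt_trans zp sd); rewrite (_ : _ - (_ + _) = E z); last first.
    by rewrite /E /L rmorphB /=; ring.
  by nra.
have bI : cmod (0 +i* (2 * (beta p * barea S - I S))) <= 2 * (e / 4 * side S ^+ 2).
  apply: le_trans (cmod_le_ReIm _) _ => /=; rewrite normr0 add0r normrM distrC.
  by rewrite ger0_norm//; lra.
apply: le_trans (cmodD _ _) _.
by lra.
Qed.

Corollary goursat g Q : wf Q -> (forall z, inbox Q z -> exists A, cder g z A) ->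
  rectint g Q = 0.
Proof.
move=> wQ dg; rewrite (@green_goursat g (fun=> 0) (fun=> 0))//.
- by rewrite mulr0.
- by move=> S _ _; rewrite !addr0.
- move=> p _ e e0; exists 1 => // S _ _ _ _; rewrite mul0r subrr normr0.
  by rewrite mulr_ge0 ?sqr_ge0// ltW.
Qed.

End ContourIntegral.

(** * Cauchy's formula and its consequences *)

Section Cauchy.
Variable R : realType.
Implicit Types (Q S : box R) (z w a : R[i]) (f g : R[i] -> R[i]) (s x y : R).

Definition square a s := Box (Re a - s) (Re a + s) (Im a - s) (Im a + s).

Lemma ex_cder_ccont g z : (exists A, cder g z A) -> ccont g z.
Proof. by case=> A; exact: cder_cont. Qed.

(** Cut along the four lines bounding the square: [a] lies outside the four
    outer pieces, where Goursat's theorem applies. *)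
Lemma deform g Q a s : inside Q a -> 0 < s -> subbox (square a s) Q ->
  (forall z, inbox Q z -> z != a -> exists A, cder g z A) ->
  rectint g Q = rectint g (square a s).
Proof.
move=> aQ s0 sQ dg.
have bdc S : subbox S Q -> inside S a -> bdcont g S.
  move=> sS aS z zS; apply: ex_cder_ccont; apply: dg.
    exact: subbox_inbox sS (onbd_inbox zS).
  apply: contraPneq aS => za; move: zS; rewrite za /onbd => /andP[_].
  by move=> /or4P[] /eqP e; apply/negP; rewrite /inside e ltxx ?andbF.
have g0 S : wf S -> subbox S Q -> ~~ inbox S a -> rectint g S = 0.
  move=> wS sS aS; apply: goursat => // z zS; apply: dg.
    exact: subbox_inbox sS zS.
  by apply: contraNneq aS => <-.
have [l r b t] := Q; case: Q aQ sQ dg bdc g0 => l' r' b' t' => {l r b t}.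
rewrite /inside /subbox /square /= => aQ sQ dg bdc g0.
set ax := Re a in aQ sQ bdc g0 *; set ay := Im a in aQ sQ bdc g0 *.
rewrite (rectint_hsplit (c := ax - s)) /=; first last.
- by lra.
- by apply: bdc; rewrite ?/inside /=; lra.
- by rewrite /wf /=; lra.
rewrite g0 ?add0r; first last.
- by rewrite /inbox /= -/ax; lra.
- by rewrite /=; lra.
- by rewrite /wf /=; lra.
rewrite (rectint_hsplit (c := ax + s)) /=; first last.
- by lra.
- by apply: bdc; rewrite ?/inside /=; lra.
- by rewrite /wf /=; lra.
rewrite [X in _ + X]g0 ?addr0; first last.
- by rewrite /inbox /= -/ax; lra.
- by rewrite /=; lra.
- by rewrite /wf /=; lra.
rewrite (rectint_vsplit (c := ay - s)) /=; first last.
- by lra.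
- by apply: bdc; rewrite ?/inside /=; lra.
- by rewrite /wf /=; lra.
rewrite g0 ?add0r; first last.
- by rewrite /inbox /= -/ax; lra.
- by rewrite /=; lra.
- by rewrite /wf /=; lra.
rewrite (rectint_vsplit (c := ay + s)) /=; first last.
- by lra.
- by apply: bdc; rewrite ?/inside /=; lra.
- by rewrite /wf /=; lra.
rewrite [X in _ + X]g0 ?addr0//.
- by rewrite /wf /=; lra.
- by rewrite /=; lra.
- by rewrite /inbox /= -/ax; lra.
Qed.

Lemma is_derive_atan_affine (c s x : R) : s != 0 ->
  is_derive x 1 (fun x => atan ((x - c) / s)) (s / ((x - c) ^+ 2 + s ^+ 2)).
Proof.
move=> s0.
have h : is_derive x 1 (fun x => (x - c) / s) (s^-1).
  apply: is_derive_of_approx => e e0; exists 1 => // y _.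
  rewrite (_ : _ - _ = 0); last by field.
  by rewrite normr0 mulr_ge0// ltW.
have := @is_derive1_comp R atan (fun x => (x - c) / s) x _ _ (is_derive1_atan ((x - c) / s)) h.
move=> D; apply: (is_derive_eq D); rewrite /GRing.scale /=; field.
by rewrite s0 !gt_eqF// ltr_pwDr ?sqr_ge0// exprn_even_gt0.
Qed.

Lemma rint1_atan (c s : R) (f : R -> R) : 0 < s -> rcont_on f (c - s) (c + s) ->
  (forall x, f x = s / ((x - c) ^+ 2 + s ^+ 2)) ->
  rint1 f (c - s) (c + s) = pi / 2.
Proof.
move=> s0 cf fE.
have -> : rint1 f (c - s) (c + s) = atan ((c + s - c) / s) - atan ((c - s - c) / s).
  apply: (rint1_FTC (F := fun x => atan ((x - c) / s))) => //; first lra.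
  by move=> x _; rewrite fE; apply: is_derive_atan_affine; rewrite gt_eqF.
have -> : (c + s - c) / s = 1 by field; rewrite gt_eqF.
have -> : (c - s - c) / s = -1 by field; rewrite gt_eqF.
by rewrite atanN atan1; field.
Qed.

Lemma rint1N (f : R -> R) (p q : R) : rcont_on f p q ->
  rint1 (fun x => - f x) p q = - rint1 f p q.
Proof.
by move=> cf; rewrite -mulN1r -rint1Z//; apply: rint1_ext => x _; rewrite mulN1r.
Qed.

Lemma inside_square a s : 0 < s -> inside (square a s) a.
Proof. by rewrite /inside /square /=; lra. Qed.

Lemma wf_square a s : 0 < s -> wf (square a s).
Proof. by rewrite /wf /square /=; lra. Qed.

Lemma inside_bd Q a z : inside Q a -> onbd Q z -> z - a != 0.
Proof.
move=> aQ zQ; rewrite subr_eq0; apply: contraPneq aQ => za.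
move: zQ; rewrite za /onbd => /andP[_].
by move=> /or4P[] /eqP e; apply/negP; rewrite /inside e ltxx ?andbF.
Qed.

Lemma cder_inv_sub a z : z - a != 0 -> cder (fun w => (w - a)^-1) z (- 1 / (z - a) ^+ 2).
Proof. by move=> za; exact: cderV (cder_subr a z) za. Qed.

(** The real parts on opposite sides cancel, and each side is seen from the centre
    under the angle [pi / 2]. *)
Lemma winding_square a s : 0 < s ->
  rectint (fun w => (w - a)^-1) (square a s) = 0 +i* (2 * pi).
Proof.
move=> s0; have wQ := wf_square a s0.
pose g w := (w - a)^-1.
have bc : bdcont g (square a s).
  move=> z zQ; apply: cder_cont; apply: cder_inv_sub.
  exact: inside_bd (inside_square a s0) zQ.
have ReV (z : R[i]) : Re z^-1 = Re z / (Re z ^+ 2 + Im z ^+ 2) by case: z.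
have ImV (z : R[i]) : Im z^-1 = - Im z / (Re z ^+ 2 + Im z ^+ 2).
  by case: z => p q /=; rewrite mulNr.
have s2 : 0 < s ^+ 2 by rewrite exprn_gt0.
have den x : x ^+ 2 + s ^+ 2 != 0 by rewrite gt_eqF// ltr_wpDl ?sqr_ge0.
have [hb1 hb2] : pcont (fun x => g (x +i* (Im a - s))) (Re a - s) (Re a + s).
  by apply: (bdcont_h (Q := square a s)); rewrite // eqxx.
have [ht1 ht2] : pcont (fun x => g (x +i* (Im a + s))) (Re a - s) (Re a + s).
  by apply: (bdcont_h (Q := square a s)); rewrite // eqxx orbT.
have [vl1 vl2] : pcont (fun y => g ((Re a - s) +i* y)) (Im a - s) (Im a + s).
  by apply: (bdcont_v (Q := square a s)); rewrite // eqxx.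
have [vr1 vr2] : pcont (fun y => g ((Re a + s) +i* y)) (Im a - s) (Im a + s).
  by apply: (bdcont_v (Q := square a s)); rewrite // eqxx orbT.
have e1 : rint1 (fun x => Re (g (x +i* (Im a - s)))) (Re a - s) (Re a + s)
        = rint1 (fun x => Re (g (x +i* (Im a + s)))) (Re a - s) (Re a + s).
  apply: rint1_ext => x _; rewrite /g !ReV !(cReB, cImB) /=.
  by congr (_ / (_ + _)); ring.
have e2 : rint1 (fun y => Im (g ((Re a - s) +i* y))) (Im a - s) (Im a + s)
        = rint1 (fun y => Im (g ((Re a + s) +i* y))) (Im a - s) (Im a + s).
  apply: rint1_ext => x _; rewrite /g !ImV !(cReB, cImB) /=.
  by congr (_ / (_ + _)); ring.
have e3 : rint1 (fun x => Im (g (x +i* (Im a - s)))) (Re a - s) (Re a + s) = pi / 2.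
  apply: rint1_atan => // x; rewrite /g ImV cReB cImB /=.
  by congr (_ / (_ + _)); ring.
have e4 : rint1 (fun x => - Im (g (x +i* (Im a + s)))) (Re a - s) (Re a + s) = pi / 2.
  apply: rint1_atan => //.
    move=> x xab; move: (rcontZ (-1) (ht2 x xab)) => h e e0.
    by have [d d0 H] := h e e0; exists d => // y /H; rewrite !mulN1r.
  move=> x; rewrite /g ImV cReB cImB /=.
  by rewrite mulNr opprK; congr (_ / (_ + _)); ring.
have e5 : rint1 (fun y => Re (g ((Re a + s) +i* y))) (Im a - s) (Im a + s) = pi / 2.
  apply: rint1_atan => // x; rewrite /g ReV cReB cImB /= addrC.
  by congr (_ / _); ring.
have e6 : rint1 (fun y => - Re (g ((Re a - s) +i* y))) (Im a - s) (Im a + s) = pi / 2.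
  apply: rint1_atan => //.
    move=> x xab; move: (rcontZ (-1) (vl1 x xab)) => h e e0.
    by have [d d0 H] := h e e0; exists d => // y /H; rewrite !mulN1r.
  move=> x; rewrite /g ReV cReB cImB /= -mulNr.
  by congr (_ / _); ring.
rewrite rint1N// in e4; rewrite rint1N// in e6.
have comb (p q p' q' u v u' v' : R) : p = u -> q' = v' -> q = pi / 2 -> - v = pi / 2 ->
    p' = pi / 2 -> - u' = pi / 2 ->
    (p +i* q) + (0 +i* 1) * (p' +i* v') - (u +i* v) - (0 +i* 1) * (u' +i* q') = 0 +i* (2 * pi).
  move=> h1 h2 h3 h4 h5 h6.
  by apply: complex_ext; rewrite !(cReB, cImB, cReD, cImD, cReM, cImM) /= ?h1 ?h2; lra.
exact: comb e1 e2 e3 e4 e5 e6.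
Qed.

Definition tpi : R[i] := 0 +i* (2 * pi).

Lemma tpi_neq0 : tpi != 0.
Proof. by rewrite eq_complex /= negb_and mulf_neq0 ?orbT// gt_eqF// pi_gt0. Qed.

Lemma square_in Q a : inside Q a -> exists2 s0, 0 < s0 &
  forall s, s <= s0 -> subbox (square a s) Q.
Proof.
rewrite /inside => aQ.
exists (Num.min (Num.min (Re a - lft Q) (rgt Q - Re a)) (Num.min (Im a - bot Q) (top Q - Im a))).
  by rewrite !lt_min; lra.
by move=> s; rewrite !le_min /subbox /=; lra.
Qed.

Lemma winding Q a : inside Q a -> rectint (fun w => (w - a)^-1) Q = tpi.
Proof.
move=> aQ; have [s s0 sQ] := square_in aQ.
rewrite (deform aQ s0 (sQ _ (lexx _))) ?winding_square// => z _ za.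
by eexists; apply: cder_inv_sub; rewrite subr_eq0.
Qed.

(** On a square of side [s] around [a] the difference quotient of [f] is bounded,
    so its integral tends to 0 with [s]. *)
Lemma cauchy_formula f Q a : inside Q a ->
  (forall z, inbox Q z -> exists A, cder f z A) ->
  rectint (fun w => f w * (w - a)^-1) Q = tpi * f a.
Proof.
move=> aQ df; have [s1 s10 s1Q] := square_in aQ.
have [A dA] := df a (inside_inbox aQ).
have [K [d d0 [K0 HK]]] := rder_lip dA.
have dq z : inbox Q z -> z != a -> exists A, cder (fun w => f w * (w - a)^-1) z A.
  move=> zQ za; have [B dB] := df z zQ; eexists; apply: cderM dB _.
  by apply: cder_inv_sub; rewrite subr_eq0.
apply/eqP; rewrite -subr_eq0; apply/eqP; apply: (@cmod_small_eq0 _ _ (16 * K)) => e e0.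
pose s := Num.min e (Num.min s1 (d / 5)).
have s0 : 0 < s by rewrite !lt_min e0 s10 divr_gt0.
have se : s <= e by rewrite ge_min lexx.
have ss1 : s <= s1 by rewrite !ge_min lexx orbT.
have sd : s <= d / 5 by rewrite !ge_min lexx !orbT.
rewrite (deform aQ s0 (s1Q _ ss1) dq) /tpi -(winding_square a s0).
have wS := wf_square a s0; have aS := inside_square a s0.
have sub := s1Q _ ss1.
have bc1 : bdcont (fun w => f w * (w - a)^-1) (square a s).
  move=> z zS; apply: ex_cder_ccont; apply: dq.
    exact: subbox_inbox sub (onbd_inbox zS).
  by rewrite -subr_eq0; exact: inside_bd aS zS.
have bc2 : bdcont (fun w => (w - a)^-1) (square a s).
  move=> z zS; apply: cder_cont; apply: cder_inv_sub; exact: inside_bd aS zS.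
have bc3 : bdcont (fun w => - f a * (w - a)^-1) (square a s).
  by move=> z zS; apply: ccontM (ccont_cst _ _) (bc2 z zS).
rewrite mulrC -mulNr -(rectintZ (- f a) wS bc2) -(rectintD wS bc1 bc3).
have sideE : side (square a s) = 4 * s by rewrite /side /=; ring.
have bd z : onbd (square a s) z -> cmod (f z * (z - a)^-1 + - f a * (z - a)^-1) <= K.
  move=> zS; have za := inside_bd aS zS.
  have h : cmod (z - a) <= 4 * s.
    rewrite -sideE; apply: cmod_inbox; first exact: onbd_inbox.
    exact: inside_inbox.
  rewrite -mulrDl cmodM cmodV ler_pdivrMr ?cmod_gt0//; apply: HK.
  by apply: le_lt_trans h _; lra.
apply: le_trans (rectint_bound wS _ bd) _.
  by move=> z zS; apply: ccontD; [exact: bc1|exact: bc3].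
by rewrite sideE; nra.
Qed.

Lemma bd_bounded g Q : wf Q -> bdcont g Q ->
  exists2 M, 0 < M & forall z, onbd Q z -> cmod (g z) <= M.
Proof.
move=> wQ cg; have [w1 w2] := andP wQ.
have wB : wf (Box (lft Q) (rgt Q) (bot Q) (bot Q)) by rewrite /wf /=; lra.
have wT : wf (Box (lft Q) (rgt Q) (top Q) (top Q)) by rewrite /wf /=; lra.
have wL : wf (Box (lft Q) (lft Q) (bot Q) (top Q)) by rewrite /wf /=; lra.
have wR : wf (Box (rgt Q) (rgt Q) (bot Q) (top Q)) by rewrite /wf /=; lra.
have eqq (u v : R) : v <= u <= v -> u = v by lra.
have [M1 H1] := ccont_bounded wB (g := g) ltac:(by
  move=> [x y] /andP[/= h /eqq ->]; apply: cg; apply: onbd_h; rewrite // eqxx).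
have [M2 H2] := ccont_bounded wT (g := g) ltac:(by
  move=> [x y] /andP[/= h /eqq ->]; apply: cg; apply: onbd_h; rewrite // eqxx orbT).
have [M3 H3] := ccont_bounded wL (g := g) ltac:(by
  move=> [x y] /andP[/= /eqq -> h]; apply: cg; apply: onbd_v; rewrite // eqxx).
have [M4 H4] := ccont_bounded wR (g := g) ltac:(by
  move=> [x y] /andP[/= /eqq -> h]; apply: cg; apply: onbd_v; rewrite // eqxx orbT).
exists (Num.max 1 (Num.max (Num.max M1 M2) (Num.max M3 M4))).
  by rewrite lt_max ltr01.
move=> z /andP[/andP[hx hy]] /or4P[] /eqP e; rewrite !le_max.
- by rewrite H3 ?orbT// /inbox /=; lra.
- by rewrite H4 ?orbT// /inbox /=; lra.
- by rewrite H1 ?orbT// /inbox /=; lra.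
- by rewrite H2 ?orbT// /inbox /=; lra.
Qed.

Lemma inside_dist Q a : inside Q a ->
  exists2 d : R, 0 < d & forall w, onbd Q w -> d <= cmod (w - a).
Proof.
rewrite /inside => aQ.
exists (Num.min (Num.min (Re a - lft Q) (rgt Q - Re a)) (Num.min (Im a - bot Q) (top Q - Im a))).
  by rewrite !lt_min; lra.
move=> w /andP[/andP[hx hy]] /or4P[] /eqP e; rewrite !ge_min.
- have h := Re_le_cmod (w - a); rewrite cReB e ltr0_norm in h; last lra.
  by apply/orP; left; apply/orP; left; lra.
- have h := Re_le_cmod (w - a); rewrite cReB e gtr0_norm in h; last lra.
  by apply/orP; left; apply/orP; right; lra.
- have h := Im_le_cmod (w - a); rewrite cImB e ltr0_norm in h; last lra.
  by apply/orP; right; apply/orP; left; lra.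
- have h := Im_le_cmod (w - a); rewrite cImB e gtr0_norm in h; last lra.
  by apply/orP; right; apply/orP; right; lra.
Qed.

(** The Cauchy type integral of [psi], with the [n]-th power of the kernel.  The
    density [psi] is only continuous on the boundary: besides Cauchy's formula
    and its derivative, this covers the quotients needed to divide out a zero. *)
Definition ctype (psi : R[i] -> R[i]) Q n z :=
  rectint (fun w => psi w * ((w - z)^-1) ^+ n) Q.

Lemma bdcont_ctype psi Q n z : bdcont psi Q -> inside Q z ->
  bdcont (fun w => psi w * ((w - z)^-1) ^+ n) Q.
Proof.
move=> cp zQ w wQ; apply: ccontM; first exact: cp.
have [A dA] := cderX n (cder_inv_sub (inside_bd zQ wQ)).
exact: cder_cont dA.
Qed.

Lemma near_inside Q a : inside Q a ->
  exists2 d : R, 0 < d & forall w, cmod (w - a) < d -> inside Q w.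
Proof.
move=> aQ; have [s s0 sQ] := square_in aQ; exists s => // w wa.
have := sQ s (lexx _); rewrite /subbox /inside /=.
have := Re_le_cmod (w - a); have := Im_le_cmod (w - a).
by rewrite !ler_norml cReB cImB; lra.
Qed.

(** An expansion of the kernel with a quadratic remainder, uniform for [w] at
    distance at least [d] from [z] and [u], passes through the integral. *)
Lemma ctype_der psi Q (k k' : R[i] -> R[i] -> R[i]) (C : R -> R) z : wf Q ->
  bdcont psi Q -> inside Q z ->
  (forall u, inside Q u -> bdcont (fun w => psi w * k u w) Q) ->
  bdcont (fun w => psi w * k' z w) Q ->
  (forall d, 0 < d -> 0 <= C d) ->
  (forall (d : R) u w, 0 < d -> d <= cmod (w - z) -> d <= cmod (w - u) ->
     cmod (k u w - k z w - (u - z) * k' z w) <= C d * cmod (u - z) ^+ 2) ->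
  cder (fun u => rectint (fun w => psi w * k u w) Q) z (rectint (fun w => psi w * k' z w) Q).
Proof.
move=> wQ cp zQ ck ck' C0 Hk; apply/cderP.
have [d d0 Hd] := inside_dist zQ; have [d1 d10 Hd1] := near_inside zQ.
have [M M0 HM] := bd_bounded wQ cp.
have dd : 0 < Num.min d1 (d / 2) by rewrite lt_min d10 divr_gt0.
have d2 : 0 < d / 2 by rewrite divr_gt0.
apply: (little_o_quadratic (K := 4 * (M * C (d / 2)) * side Q) dd) => u.
rewrite lt_min => /andP[/Hd1 uQ ud].
pose E w := psi w * k u w + ((-1) * (psi w * k z w) + (- (u - z)) * (psi w * k' z w)).
have c1 : bdcont (fun w => -1 * (psi w * k z w)) Q.
  by move=> w wQ'; apply: ccontM (ccont_cst _ _) (ck _ zQ w wQ').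
have c2 : bdcont (fun w => - (u - z) * (psi w * k' z w)) Q.
  by move=> w wQ'; apply: ccontM (ccont_cst _ _) (ck' w wQ').
have c3 : bdcont (fun w => -1 * (psi w * k z w) + - (u - z) * (psi w * k' z w)) Q.
  by move=> w wQ'; exact: ccontD (c1 w wQ') (c2 w wQ').
have cE : bdcont E Q by move=> w wQ'; exact: ccontD (ck _ uQ w wQ') (c3 w wQ').
have -> : rectint (fun w => psi w * k u w) Q - rectint (fun w => psi w * k z w) Q
    - rectint (fun w => psi w * k' z w) Q * (u - z) = rectint E Q.
  rewrite /E (rectintD wQ (ck _ uQ) c3) (rectintD wQ c1 c2).
  rewrite (rectintZ (-1) wQ (ck _ zQ)) (rectintZ (- (u - z)) wQ ck').
  by ring.
rewrite (_ : 4 * _ * _ * _ = 4 * (M * (C (d / 2) * cmod (u - z) ^+ 2)) * side Q); last by ring.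
apply: rectint_bound => // w wQ'.
have -> : E w = psi w * (k u w - k z w - (u - z) * k' z w) by rewrite /E; ring.
rewrite cmodM; apply: ler_pM; rewrite ?cmod_ge0 ?HM//.
have h := Hd w wQ'; apply: Hk => //; first lra.
have := cmodD (w - u) (u - z); rewrite (_ : w - u + (u - z) = w - z); last by ring.
by lra.
Qed.

Lemma inv_le (d : R) u : 0 < d -> d <= cmod u -> cmod u^-1 <= d^-1.
Proof. by move=> d0 du; rewrite cmodV lef_pV2// posrE// (lt_le_trans d0). Qed.

Lemma cmod_neq0 (d : R) u : 0 < d -> d <= cmod u -> u != 0.
Proof. by move=> d0 du; rewrite -cmod_gt0; exact: lt_le_trans du. Qed.

Lemma ctype1_der psi Q z : wf Q -> bdcont psi Q -> inside Q z ->
  cder (ctype psi Q 1) z (ctype psi Q 2 z).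
Proof.
move=> wQ cp zQ; apply: (@ctype_der psi Q (fun u w => ((w - u)^-1) ^+ 1)
  (fun u w => ((w - u)^-1) ^+ 2) (fun d => d^-1 ^+ 2 * d^-1)) => //.
- by move=> u uQ; exact: bdcont_ctype.
- exact: bdcont_ctype.
- by move=> d d0; rewrite ltW// mulr_gt0 ?exprn_gt0 ?invr_gt0.
- move=> d u w d0 wz wu.
  have -> : (w - u)^-1 ^+ 1 - (w - z)^-1 ^+ 1 - (u - z) * (w - z)^-1 ^+ 2
      = (w - z)^-1 ^+ 2 * (w - u)^-1 * (u - z) ^+ 2.
    by field; rewrite (cmod_neq0 d0 wz) (cmod_neq0 d0 wu).
  rewrite cmodM cmodX ler_wpM2r ?sqr_ge0// cmodM cmodX.
  apply: ler_pM; rewrite ?exprn_ge0 ?cmod_ge0//; last exact: inv_le.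
  by rewrite lerXn2r ?nnegrE ?cmod_ge0 ?invr_ge0 ?(ltW d0)//; exact: inv_le.
Qed.

Lemma ctype2_der psi Q z : wf Q -> bdcont psi Q -> inside Q z ->
  exists A, cder (ctype psi Q 2) z A.
Proof.
move=> wQ cp zQ; exists (rectint (fun w => psi w * (2 * ((w - z)^-1) ^+ 3)) Q).
have b3 : bdcont (fun w => psi w * (2 * (w - z)^-1 ^+ 3)) Q.
  move=> w wQ'; apply: ccont_ext (ccontM (ccont_cst 2 w) (bdcont_ctype 3 cp zQ wQ')) => v.
  by ring.
apply: (@ctype_der psi Q (fun u w => ((w - u)^-1) ^+ 2)
  (fun u w => 2 * ((w - u)^-1) ^+ 3) (fun d => d^-1 ^+ 2 * d^-1 * (3 * d^-1))) => //.
- by move=> u uQ; exact: bdcont_ctype.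
- by move=> d d0; rewrite ltW// !mulr_gt0 ?exprn_gt0 ?invr_gt0.
- move=> d u w d0 wz wu.
  have -> : (w - u)^-1 ^+ 2 - (w - z)^-1 ^+ 2 - (u - z) * (2 * (w - z)^-1 ^+ 3)
      = (w - z)^-1 ^+ 2 * (w - u)^-1 * ((w - u)^-1 + (w - z)^-1 + (w - z)^-1) * (u - z) ^+ 2.
    by field; rewrite (cmod_neq0 d0 wz) (cmod_neq0 d0 wu).
  rewrite cmodM cmodX ler_wpM2r ?sqr_ge0// cmodM.
  apply: ler_pM; rewrite ?cmod_ge0//.
    rewrite cmodM cmodX; apply: ler_pM; rewrite ?exprn_ge0 ?cmod_ge0//; last exact: inv_le.
    by rewrite lerXn2r ?nnegrE ?cmod_ge0 ?invr_ge0 ?(ltW d0)//; exact: inv_le.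
  apply: le_trans (cmodD _ _) _; apply: le_trans (lerD (cmodD _ _) (lexx _)) _.
  by have := inv_le d0 wz; have := inv_le d0 wu; lra.
Qed.

Lemma cder_uniq f z A B : cder f z A -> cder f z B -> A = B.
Proof.
move=> /cderP dA /cderP dB; apply/eqP; rewrite -subr_eq0; apply/eqP.
apply: (@cmod_small_eq0 _ _ 2) => e e0.
have [d d0 Hd] := dA e e0; have [d' d'0 Hd'] := dB e e0.
pose m := Num.min d d' / 2.
have m0 : 0 < m by rewrite divr_gt0// lt_min d0.
have := Hd (z + m%:C); have := Hd' (z + m%:C).
rewrite (addrC z) addrK cmodR gtr0_norm//.
have md : m < d by rewrite /m; case: (lerP d d') => ?; lra.
have md' : m < d' by rewrite /m; case: (lerP d d') => ?; lra.
move=> /(_ md') h1 /(_ md) h2.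
have := cmodD (f (m%:C + z) - f z - B * m%:C) (- (f (m%:C + z) - f z - A * m%:C)).
rewrite cmodN (_ : _ + - _ = (A - B) * m%:C); last by ring.
by rewrite cmodM cmodR gtr0_norm//; nra.
Qed.

Definition dv f z := xget 0 [set A | cder f z A].

Lemma dvP f z : (exists A, cder f z A) -> cder f z (dv f z).
Proof. by move=> [A dA]; exact: (xgetI 0 dA). Qed.

Lemma dvE f z A : cder f z A -> dv f z = A.
Proof. by move=> dA; exact: cder_uniq (dvP (ex_intro _ A dA)) dA. Qed.

Definition holo f (U : set R[i]) := forall z, U z -> exists A, cder f z A.

Definition copen (U : set R[i]) := forall z, U z ->
  exists2 d : R, 0 < d & forall w, cmod (w - z) < d -> U w.

Lemma copen_square U a : copen U -> U a ->
  exists2 s, 0 < s & forall z, inbox (square a s) z -> U z.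
Proof.
move=> oU /oU[d d0 H]; exists (d / 5); first by rewrite divr_gt0.
move=> z zS; apply: H; have d5 : 0 < d / 5 by rewrite divr_gt0.
have := cmod_inbox zS (inside_inbox (inside_square a d5)).
by rewrite /side /=; lra.
Qed.

Lemma holo_bdcont f U Q : holo f U -> (forall z, inbox Q z -> U z) -> bdcont f Q.
Proof. by move=> hf QU z /onbd_inbox /QU /hf; exact: ex_cder_ccont. Qed.

Lemma cauchy_repr f U Q z : holo f U -> (forall z, inbox Q z -> U z) -> inside Q z ->
  f z = tpi^-1 * ctype f Q 1 z.
Proof.
move=> hf QU zQ; rewrite /ctype (@cauchy_formula f)//; last by move=> w /QU /hf.
by rewrite mulKf// tpi_neq0.
Qed.

Lemma inside_wf Q z : inside Q z -> wf Q.
Proof. by rewrite /inside /wf; lra. Qed.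

Lemma cauchy_repr_der f U Q z : holo f U -> (forall z, inbox Q z -> U z) -> inside Q z ->
  dv f z = tpi^-1 * ctype f Q 2 z.
Proof.
move=> hf QU zQ; apply: dvE.
have c1 := ctype1_der (inside_wf zQ) (holo_bdcont hf QU) zQ.
have := cderM (cder_cst tpi^-1 z) c1; rewrite mul0r add0r; apply: cder_near.
have [d d0 H] := near_inside zQ; exists d => // w /H wQ.
exact/esym/(cauchy_repr hf QU wQ).
Qed.

(** By Cauchy's formula the derivative is locally a Cauchy type integral with the
    squared kernel, which is differentiable again. *)
Lemma holo_dv f U : copen U -> holo f U -> holo (dv f) U.
Proof.
move=> oU hf a Ua; have [s s0 QU] := copen_square oU Ua.
have aQ := inside_square a s0.
have [A dA] := ctype2_der (inside_wf aQ) (holo_bdcont hf QU) aQ.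
exists (0 * ctype f (square a s) 2 a + tpi^-1 * A).
apply: cder_near (cderM (cder_cst tpi^-1 a) dA).
have [d d0 H] := near_inside aQ; exists d => // w /H wQ.
exact/esym/(cauchy_repr_der hf QU wQ).
Qed.

(** The quotient can fail to be differentiable only at [a].  Near [a] it is the
    Cauchy type integral with density [f w / (w - a)], by partial fractions of
    [1 / ((w - a) (w - z))] and [f a = 0]. *)
Lemma holo_factor f U a : copen U -> holo f U -> U a -> f a = 0 ->
  exists2 h, holo h U & forall z, f z = (z - a) * h z.
Proof.
move=> oU hf Ua fa; pose h z := if z == a then dv f a else f z * (z - a)^-1.
exists h; last first.
  move=> z; rewrite /h; case: eqP => [->|/eqP za]; first by rewrite fa subrr mul0r.
  by rewrite mulrCA mulfV ?mulr1// subr_eq0.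
move=> z Uz; have [->{z Uz}|za] := eqVneq z a; last first.
  have [A dA] := hf z Uz; have za' : z - a != 0 by rewrite subr_eq0.
  eexists; apply: cder_near (cderM dA (cder_inv_sub za')).
  exists (cmod (z - a)); first by rewrite cmod_gt0.
  move=> w wz; rewrite /h; case: eqP => // wa.
  by move: wz; rewrite wa cmodC ltxx.
have [s s0 QU] := copen_square oU Ua; have aQ := inside_square a s0.
set Q := square a s in QU aQ; have wQ := inside_wf aQ.
pose psi w := f w * (w - a)^-1.
have cf := holo_bdcont hf QU.
have cp : bdcont psi Q.
  by move=> w wQ'; apply: ccontM (cf w wQ') _;
     apply: cder_cont (cder_inv_sub (inside_bd aQ wQ')).
exists (0 * ctype psi Q 1 a + tpi^-1 * ctype psi Q 2 a).
apply: cder_near (cderM (cder_cst tpi^-1 a) (ctype1_der wQ cp aQ)).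
have [d d0 H] := near_inside aQ; exists d => // w /H wI.
rewrite /h; case: eqP => [->|/eqP wa].
  rewrite (cauchy_repr_der hf QU aQ); congr (_ * _).
  by apply: rectint_ext => // v vQ; rewrite /psi expr1 expr2 mulrA.
have wa' : w - a != 0 by rewrite subr_eq0.
have -> : ctype psi Q 1 w = (w - a)^-1 * (ctype f Q 1 w + (-1) * ctype f Q 1 a).
  have b1 := bdcont_ctype 1 cf wI; have b2 := bdcont_ctype 1 cf aQ.
  have b3 : bdcont (fun v => -1 * (f v * (v - a)^-1 ^+ 1)) Q.
    by move=> v vQ; apply: ccontM (ccont_cst _ _) (b2 v vQ).
  have b4 : bdcont (fun v => f v * (v - w)^-1 ^+ 1 + -1 * (f v * (v - a)^-1 ^+ 1)) Q.
    by move=> v vQ; apply: ccontD (b1 v vQ) (b3 v vQ).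
  rewrite /ctype -(rectintZ (-1) wQ b2) -(rectintD wQ b1 b3).
  rewrite -(rectintZ _ wQ b4); apply: rectint_ext => // v vQ.
  have va := inside_bd aQ vQ; have vw := inside_bd wI vQ.
  by rewrite /psi !expr1; field; rewrite va vw wa'.
rewrite mulrCA mulrDr mulrCA -(cauchy_repr hf QU wI) -(cauchy_repr hf QU aQ) fa.
by rewrite mulr0 addr0 mulrC.
Qed.

(** Cauchy's formula for [f ^+ n] gives [|f z| ^+ n <= K * M ^+ n] for every
    [M > m], with [K] independent of [n]. *)
Lemma max_principle f Q (m : R) z : (forall z, inbox Q z -> exists A, cder f z A) ->
  (forall w, onbd Q w -> cmod (f w) <= m) -> inbox Q z -> cmod (f z) <= m.
Proof.
move=> df fm zQ; have [zI|zI] := boolP (inside Q z); last first.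
  by apply: fm; exact: inboxP.
have wQ := inside_wf zI.
apply/ler_addgt0Pr => e e0; rewrite leNgt; apply/negP => mf.
have m0 : 0 <= m.
  have : onbd Q (lft Q +i* bot Q).
    by move: wQ; rewrite /wf /onbd /inbox /= eqxx !lexx /= andbT => /andP[-> ->].
  by move=> /fm; apply: le_trans; exact: cmod_ge0.
pose M := m + e; have M0 : 0 < M by rewrite /M; lra.
have [d d0 Hd] := inside_dist zI.
pose q := cmod (f z) / M; have q1 : 1 < q by rewrite ltr_pdivlMr// mul1r.
pose K := 4 * d^-1 * side Q / (2 * pi).
have pi0 := pi_gt0 R.
have bnd n : q ^+ n <= K.
  rewrite /q /K expr_div_n ler_pdivrMr ?exprn_gt0//.
  rewrite mulrAC ler_pdivlMr; last lra.
  have dfn w : inbox Q w -> exists A, cder (fun v => f v ^+ n) w A.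
    by move=> /df[A dA]; exact: cderX dA.
  have := cauchy_formula zI dfn => cF.
  have -> : cmod (f z) ^+ n * (2 * pi) = cmod (tpi * f z ^+ n).
    rewrite cmodM cmodX mulrC; congr (_ * _).
    by rewrite /tpi /= expr0n add0r sqrtr_sqr gtr0_norm//; lra.
  rewrite -cF (_ : _ * M ^+ n = 4 * (M ^+ n * d^-1) * side Q); last by ring.
  apply: rectint_bound => //.
    move=> w wQ'; apply: ccontM; first exact: ex_cder_ccont (dfn w (onbd_inbox wQ')).
    exact: cder_cont (cder_inv_sub (inside_bd zI wQ')).
  move=> w wQ'; rewrite cmodM cmodX; apply: ler_pM; rewrite ?exprn_ge0 ?cmod_ge0//.
    rewrite lerXn2r ?nnegrE ?cmod_ge0 ?(ltW M0)//.
    by apply: le_trans (fm w wQ') _; rewrite /M; lra.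
  by apply: inv_le => //; exact: Hd.
have [n nK] := pow_unbounded K q1.
by have := bnd n; lra.
Qed.

End Cauchy.

(** * Area integrals over rectangles *)

Section PlaneMeasure.
Variable R : realType.
Implicit Types (Q S : box R) (z w a p : R[i]) (f g : R[i] -> R[i]) (U : set R[i]).
Implicit Types (phi : R[i] -> R).

Notation mu2 := (@lebesgue_measure R \x @lebesgue_measure R)%E.

Definition plane U : set (R * R) := [set p | U (p.1 +i* p.2)].

(** Half-open, so that the four quarters of a box form a partition of it. *)
Definition hbox Q : set (R * R) := `]lft Q, rgt Q] `*` `]bot Q, top Q].

Lemma hboxE Q (p : R * R) : hbox Q p <->
  lft Q < p.1 <= rgt Q /\ bot Q < p.2 <= top Q.
Proof. by rewrite /hbox /= !in_itv. Qed.

Lemma hbox_plane Q U : (forall z, inbox Q z -> U z) -> hbox Q `<=` plane U.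
Proof. by move=> QU p /hboxE[h1 h2]; apply: QU; rewrite /inbox /=; lra. Qed.

Lemma measurable_hbox Q : measurable (hbox Q).
Proof. by apply: measurableX; exact: measurable_itv. Qed.

Lemma mu2_hbox Q : wf Q -> mu2 (hbox Q) = (barea Q)%:E.
Proof.
move=> /andP[w1 w2]; rewrite /hbox product_measure1E; try exact: measurable_itv.
rewrite /= !lebesgue_measure_itv /= !lte_fin.
have E (u v : R) : u <= v -> (if u < v then (v%:E - u%:E)%E else 0%E) = (v - u)%:E.
  by rewrite le_eqVlt => /predU1P[->|->]; rewrite ?ltxx ?subrr -?EFinB.
by rewrite !E.
Qed.

Definition ratbox (q : rat * rat * rat * rat) : set (R * R) :=
  `]ratr q.1.1.1, ratr q.1.1.2[ `*` `]ratr q.1.2, ratr q.2[.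

(** An open set is the union of the countably many boxes with rational corners
    that it contains. *)
Lemma measurable_plane U : copen U -> measurable (plane U).
Proof.
move=> oU.
pose F (n : nat) : set (R * R) := if unpickle n is Some q then
   (if `[< ratbox q `<=` plane U >] then ratbox q else set0) else set0.
suff -> : plane U = \bigcup_n F n.
  apply: bigcupT_measurable => n; rewrite /F; case: unpickle => [q|] //.
  by case: asboolP => // _; apply: measurableX; exact: measurable_itv.
apply/seteqP; split => [[x y] Up|p [n _]]; last first.
  by rewrite /F; case: unpickle => [q|] //; case: asboolP => // h; exact: h.
have [d d0 Hd] := oU _ Up; have d2 : 0 < d / 2 by rewrite divr_gt0.
have lt1 (u : R) : u - d / 2 < u by lra.
have lt2 (u : R) : u < u + d / 2 by lra.
have [l] := rat_in_itvoo (lt1 x); have [r] := rat_in_itvoo (lt2 x).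
have [b] := rat_in_itvoo (lt1 y); have [t] := rat_in_itvoo (lt2 y).
rewrite !in_itv /= => ht hb hr hl.
suff H : F (pickle (l, r, b, t)) (x, y) by move: (pickle _) H => n H; exists n.
rewrite /F pickleK.
case: asboolP => [_|].
  by rewrite /ratbox /= !in_itv /=; lra.
case=> -[u v]; rewrite /ratbox /= !in_itv /= => -[hu hv]; apply: Hd.
apply: le_lt_trans (cmod_le_ReIm _) _; rewrite cReB cImB /=.
have : `|u - x| < d / 2 by rewrite ltr_norml; lra.
have : `|v - y| < d / 2 by rewrite ltr_norml; lra.
lra.
Qed.

(** Continuity of a real-valued function on the plane, cast so that it takes part
    in products with complex functions and in the rules for [rder]. *)
Definition cre phi z := ccont (fun w => (phi w)%:C) z.

Lemma creP phi z : cre phi z <-> forall e : R, 0 < e ->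
  exists2 d : R, 0 < d & forall w, cmod (w - z) < d -> `|phi w - phi z| <= e.
Proof.
by split=> c e e0; have [d d0 H] := c e e0; exists d => // w /H;
  rewrite -rmorphB cmodR.
Qed.

Lemma measurable_fun_plane phi U : copen U -> (forall z, U z -> cre phi z) ->
  measurable_fun (plane U) (fun p : R * R => phi (p.1 +i* p.2)).
Proof.
move=> oU cphi; apply: (measurability _ (RGenOInfty.measurableE R)) => /=.
move=> _ [_ [r ->] <-].
have -> : plane U `&` (fun p : R * R => phi (p.1 +i* p.2)) @^-1` `]r, +oo[%classic
    = plane [set z | U z /\ r < phi z].
  by apply/seteqP; split => p /=; rewrite /plane /= in_itv /= andbT.
apply: measurable_plane => z [Uz rz].
have [d d0 Hd] := oU z Uz; have h0 : 0 < (phi z - r) / 2 by rewrite divr_gt0// subr_gt0.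
have [d' d'0 Hd'] := (creP phi z).1 (cphi z Uz) _ h0.
exists (Num.min d d'); first by rewrite lt_min d0.
move=> w; rewrite lt_min => /andP[/Hd Uw /Hd' b]; split=> //.
by move: b; rewrite ler_norml; lra.
Qed.

Definition aint phi Q : R := \int[mu2]_(p in hbox Q) phi (p.1 +i* p.2).

Section AreaIntegral.
Variables (phi : R[i] -> R) (U : set R[i]) (Q : box R).
Hypotheses (oU : copen U) (wQ : wf Q) (QU : forall z, inbox Q z -> U z)
  (cphi : forall z, U z -> cre phi z).

Lemma aint_integrable S : wf S -> subbox S Q ->
  mu2.-integrable (hbox S) (EFin \o (fun p : R * R => phi (p.1 +i* p.2))).
Proof.
move=> wS sS; have SU z : inbox S z -> U z by move=> /(subbox_inbox sS)/QU.
apply: measurable_bounded_integrable.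
- exact: measurable_hbox.
- by rewrite [X in (X < _)%E](mu2_hbox wS) ltry.
- apply: measurable_funS (measurable_fun_plane oU cphi); last exact: hbox_plane.
  exact: measurable_plane.
- have [M HM] := @ccont_bounded _ (fun z => (phi z)%:C) S wS (fun z zS => cphi (SU z zS)).
  exists M; split; first by rewrite num_real.
  move=> x Mx p /hboxE[h1 h2]; apply: ltW; apply: le_lt_trans Mx.
  by rewrite -cmodR; apply: HM; rewrite /inbox /=; lra.
Qed.

Lemma aint_quarter S : wf S -> subbox S Q ->
  aint phi S = aint phi (quarter S false false) + aint phi (quarter S true false)
     + aint phi (quarter S false true) + aint phi (quarter S true true).
Proof.
move=> wS sS; have sq i j := subbox_trans (sub_quarter i j wS) sS.
have split2 (T A B : box R) : wf T -> subbox T Q -> hbox T = hbox A `|` hbox B ->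
    [disjoint hbox A & hbox B] -> aint phi T = aint phi A + aint phi B.
  move=> wT sT e dis; rewrite /aint e Rintegral_setU//.
  - exact: measurable_hbox.
  - exact: measurable_hbox.
  - by rewrite -e; exact: aint_integrable.
pose L := Box (lft S) (midx S) (bot S) (top S).
pose T := Box (midx S) (rgt S) (bot S) (top S).
have [w1 w2] := andP wS.
have wL : wf L by rewrite /wf /L /midx /=; lra.
have wT : wf T by rewrite /wf /T /midx /=; lra.
have sL : subbox L S by rewrite /subbox /L /midx /=; lra.
have sT : subbox T S by rewrite /subbox /T /midx /=; lra.
rewrite (split2 S L T)//; first last.
- apply/disj_setPS => p [/hboxE[/= h1 h2] /hboxE[/= h3 h4]]; lra.
- apply/seteqP; split=> p.
    by case: (leP p.1 (midx S)) => h /hboxE h1; [left|right]; apply/hboxE; move: h1 => /=; lra.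
  by move=> [/hboxE h1|/hboxE h1]; apply/hboxE; move: h1; rewrite /L /T /= /midx; lra.
rewrite (split2 L (quarter S false false) (quarter S false true))//; first last.
- apply/disj_setPS => p [/hboxE[/= h1 h2] /hboxE[/= h3 h4]]; lra.
- apply/seteqP; split=> p.
    by case: (leP p.2 (midy S)) => h /hboxE h1; [left|right]; apply/hboxE; move: h1 => /=; lra.
  by move=> [/hboxE h1|/hboxE h1]; apply/hboxE; move: h1; rewrite /L /T /= /midy; lra.
- exact: subbox_trans sS.
rewrite (split2 T (quarter S true false) (quarter S true true))//; first last.
- apply/disj_setPS => p [/hboxE[/= h1 h2] /hboxE[/= h3 h4]]; lra.
- apply/seteqP; split=> p.
    by case: (leP p.2 (midy S)) => h /hboxE h1; [left|right]; apply/hboxE; move: h1 => /=; lra.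
  by move=> [/hboxE h1|/hboxE h1]; apply/hboxE; move: h1; rewrite /L /T /= /midy; lra.
- exact: subbox_trans sS.
by rewrite addrACA addrA.
Qed.

Lemma aint_local p : inbox Q p -> forall e : R, 0 < e ->
  exists2 d : R, 0 < d & forall S, wf S -> subbox S Q -> inbox S p -> side S < d ->
     `|aint phi S - phi p * barea S| <= e * side S ^+ 2.
Proof.
move=> pQ e e0; have [d d0 Hd] := (creP phi p).1 (cphi (QU pQ)) e e0.
exists d => // S wS sS pS sd; have iS := aint_integrable wS sS.
have mS := measurable_hbox S.
have finS k : mu2.-integrable (hbox S) (EFin \o (fun _ : R * R => k : R)).
  apply: measurable_bounded_integrable => //; first by rewrite [X in (X < _)%E](mu2_hbox wS) ltry.
  by exists `|k|; split; [rewrite num_real|move=> x kx v _; exact: ltW].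
have cstE k : \int[mu2]_(p in hbox S) k = k * barea S.
  by rewrite Rintegral_cst// [X in fine X](mu2_hbox wS).
have [w1 w2] := andP wS.
have a0 : 0 <= barea S by rewrite /barea mulr_ge0// subr_ge0.
have a1 : barea S <= side S ^+ 2 by rewrite /barea /side; nra.
have le1 v : hbox S v -> phi p - e <= phi (v.1 +i* v.2) <= phi p + e.
  move=> /hboxE[h1 h2].
  have vS : inbox S (v.1 +i* v.2) by rewrite /inbox /=; lra.
  by have := Hd _ (le_lt_trans (cmod_inbox vS pS) sd); rewrite ler_norml; lra.
have hi : aint phi S <= (phi p + e) * barea S.
  by rewrite -cstE; apply: le_Rintegral => // v /le1 /andP[].
have lo : (phi p - e) * barea S <= aint phi S.
  by rewrite -cstE; apply: le_Rintegral => // v /le1 /andP[].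
rewrite ler_norml; nra.
Qed.

(** The lemmas above say that the area integral meets the two conditions which
    [green_goursat] puts on its right-hand side. *)
Lemma green_area g : (forall z, inbox Q z -> exists A, rder g z A (phi z)%:C) ->
  rectint g Q = 0 +i* (2 * aint phi Q).
Proof. by move=> dg; apply: green_goursat wQ dg aint_quarter aint_local. Qed.

Lemma aint_E :
  ((aint phi Q)%:E = \int[mu2]_(p in hbox Q) (phi (p.1 +i* p.2))%:E)%E.
Proof.
rewrite /aint /Rintegral fineK//.
apply: integrable_fin_num; first exact: measurable_hbox.
exact: aint_integrable wQ (subbox_refl Q).
Qed.

End AreaIntegral.

End PlaneMeasure.

(** * Area of the image and number of zeros *)

Section AreaLemma.
Variable R : realType.
Implicit Types (Q S : box R) (z w a p : R[i]) (f g h : R[i] -> R[i]) (U : set R[i]).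
Implicit Types (phi psi : R[i] -> R).

Notation mu2 := (@lebesgue_measure R \x @lebesgue_measure R)%E.

Lemma creM phi psi z : cre phi z -> cre psi z -> cre (fun w => phi w * psi w) z.
Proof. by move=> c1 c2; apply: ccont_ext (ccontM c1 c2) => w; rewrite rmorphM. Qed.

Lemma cre_cmod f z : ccont f z -> cre (fun w => cmod (f w)) z.
Proof.
move=> cf; apply/creP => e e0; have [d d0 H] := cf e e0; exists d => // w /H.
have := cmodB_ge (f w) (f z); have := cmodB_ge (f z) (f w).
by rewrite (cmodC (f z)) ler_norml; lra.
Qed.

Lemma creX phi n z : cre phi z -> cre (fun w => phi w ^+ n) z.
Proof.
move=> c; elim: n => [|n IH]; first by apply: ccont_ext (ccont_cst 1 z) => w; rewrite expr0.
by apply: ccont_ext (ccontM c IH) => w; rewrite -rmorphM exprS.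
Qed.

Lemma cre_lip (F : R -> R) (L : R) phi z : 0 < L ->
  (forall s t, `|F s - F t| <= L * `|s - t|) -> cre phi z -> cre (fun w => F (phi w)) z.
Proof.
move=> L0 FL /creP c; apply/creP => e e0; have [d d0 H] := c _ (divr_gt0 e0 L0).
exists d => // w /H h; apply: le_trans (FL _ _) _.
by rewrite mulrC -ler_pdivlMr.
Qed.

Lemma rder_comp_real (F : R -> R) (k K : R) phi z A B :
  (forall s, `|F s - F (phi z) - k * (s - phi z)| <= K * (s - phi z) ^+ 2) ->
  rder (fun w => (phi w)%:C) z A B ->
  rder (fun w => (F (phi w))%:C) z (k%:C * A) (k%:C * B).
Proof.
move=> FK du; have [L [d d0 [L0 HL]]] := rder_lip du.
have q : little_o (fun w => (F (phi w) - F (phi z) - k * (phi w - phi z))%:C) z.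
  apply: (little_o_quadratic (K := `|K| * L ^+ 2) d0) => w /HL.
  rewrite -rmorphB !cmodR => h; apply: le_trans (FK _) _.
  have -> : `|K| * L ^+ 2 * cmod (w - z) ^+ 2 = `|K| * (L * cmod (w - z)) ^+ 2 by ring.
  have h2 : (phi w - phi z) ^+ 2 <= (L * cmod (w - z)) ^+ 2.
    rewrite -[leLHS]real_normK ?num_real// lerXn2r ?nnegrE//.
    by rewrite mulr_ge0 ?cmod_ge0// ltW.
  apply: le_trans (ler_wpM2l (normr_ge0 _) h2).
  by rewrite ler_wpM2r ?sqr_ge0// ler_norm.
apply: little_o_ext (little_oD q (little_oZ k%:C du)) => w.
by rewrite !(rmorphB, rmorphM) /=; ring.
Qed.

Definition pos (x : R) := Num.max 0 x.

(** The square of the positive part is continuously differentiable with a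
    quadratic error, which is what [rder_comp_real] asks for. *)
Lemma pos_sqr_approx (x y : R) :
  `|pos y ^+ 2 - pos x ^+ 2 - 2 * pos x * (y - x)| <= (y - x) ^+ 2.
Proof. by rewrite /pos ler_norml; apply/andP; case: (lerP 0 x) => h1; case: (lerP 0 y) => h2;
  have h3 := sqr_ge0 (y - x); have h4 := sqr_ge0 x; have h5 := sqr_ge0 y; split; nra. Qed.

Lemma pos_lip (x y : R) : `|pos x - pos y| <= `|x - y|.
Proof.
rewrite /pos; case: (lerP 0 x) => h1; case: (lerP 0 y) => h2 //; rewrite ?subrr ?normr0//.
  by rewrite subr0 !ger0_norm//; lra.
by rewrite sub0r normrN (ler0_norm (x := x - y)) ?ger0_norm//; lra.
Qed.

Lemma pos_id (x : R) : 0 <= x -> pos x = x. Proof. exact: max_r. Qed.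
Lemma pos_eq0 (x : R) : x <= 0 -> pos x = 0. Proof. exact: max_l. Qed.

(** A continuously differentiable version of [min s T]: its derivative [dtrunc] is
    1 up to [T - e], decreases linearly to 0 at [T], and so replaces the
    indicator function of [s < T] by a continuous function. *)
Definition trunc (T e s : R) :=
  (T ^+ 2 - pos (T - s) ^+ 2 - ((T - e) ^+ 2 - pos (T - e - s) ^+ 2)) / (2 * e).

Definition dtrunc (T e s : R) := (pos (T - s) - pos (T - e - s)) / e.

Section Trunc.
Variables (T e : R).
Hypotheses (e0 : 0 < e) (eT : e < T).

Lemma trunc_small (s : R) : s <= T - e -> trunc T e s = s.
Proof.
have e0' := e0; have eT' := eT.
move=> h; have h1 : 0 <= T - s by lra. have h2 : 0 <= T - e - s by lra.
rewrite /trunc (pos_id h1) (pos_id h2).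
by field; rewrite gt_eqF.
Qed.

Lemma trunc_large (s : R) : T <= s -> trunc T e s = T - e / 2.
Proof.
have e0' := e0; have eT' := eT.
move=> h; have h1 : T - s <= 0 by lra. have h2 : T - e - s <= 0 by lra.
rewrite /trunc (pos_eq0 h1) (pos_eq0 h2).
by field; rewrite gt_eqF.
Qed.

Lemma trunc_approx (s t : R) :
  `|trunc T e s - trunc T e t - dtrunc T e t * (s - t)| <= e^-1 * (s - t) ^+ 2.
Proof.
have e0' := e0; have eT' := eT.
have h1 := pos_sqr_approx (T - t) (T - s).
have h2 := pos_sqr_approx (T - e - t) (T - e - s).
have -> : trunc T e s - trunc T e t - dtrunc T e t * (s - t) =
  (2 * e)^-1 * ((pos (T - e - s) ^+ 2 - pos (T - e - t) ^+ 2
       - 2 * pos (T - e - t) * (T - e - s - (T - e - t)))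
   - (pos (T - s) ^+ 2 - pos (T - t) ^+ 2 - 2 * pos (T - t) * (T - s - (T - t)))).
  by rewrite /trunc /dtrunc; field; rewrite gt_eqF.
rewrite normrM gtr0_norm ?invr_gt0; last lra.
rewrite (_ : e^-1 * _ = (2 * e)^-1 * (2 * (s - t) ^+ 2)); last by field; rewrite gt_eqF.
rewrite ler_wpM2l//; first by rewrite invr_ge0; lra.
apply: le_trans (ler_normB _ _) _.
have -> : 2 * (s - t) ^+ 2 = (T - e - s - (T - e - t)) ^+ 2 + (T - s - (T - t)) ^+ 2 by ring.
exact: lerD.
Qed.

Lemma dtrunc_bound (s : R) : 0 <= dtrunc T e s <= 1.
Proof.
have e0' := e0; have eT' := eT.
rewrite /dtrunc /pos; apply/andP; split.
  by apply: divr_ge0; last lra; case: (lerP 0 (T - s)) => ?; case: (lerP 0 (T - e - s)) => ?; lra.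
by rewrite ler_pdivrMr//; case: (lerP 0 (T - s)) => ?; case: (lerP 0 (T - e - s)) => ?; lra.
Qed.

Lemma dtrunc_large (s : R) : T <= s -> dtrunc T e s = 0.
Proof.
have e0' := e0; have eT' := eT.
move=> h; have h1 : T - s <= 0 by lra. have h2 : T - e - s <= 0 by lra.
by rewrite /dtrunc (pos_eq0 h1) (pos_eq0 h2) subrr mul0r.
Qed.

Lemma dtrunc0 : dtrunc T e 0 = 1.
Proof.
have e0' := e0; have eT' := eT.
have h1 : 0 <= T - 0 by lra. have h2 : 0 <= T - e - 0 by lra.
by rewrite /dtrunc (pos_id h1) (pos_id h2); field; rewrite gt_eqF.
Qed.

Lemma dtrunc_lip (s t : R) : `|dtrunc T e s - dtrunc T e t| <= 2 / e * `|s - t|.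
Proof.
have e0' := e0; have eT' := eT.
have -> : dtrunc T e s - dtrunc T e t =
  e^-1 * ((pos (T - s) - pos (T - t)) - (pos (T - e - s) - pos (T - e - t))).
  by rewrite /dtrunc; field; rewrite gt_eqF.
rewrite normrM gtr0_norm ?invr_gt0// (_ : 2 / e * _ = e^-1 * (`|s - t| + `|s - t|)); last first.
  by ring.
rewrite ler_wpM2l ?invr_ge0 ?(ltW e0)//; apply: le_trans (ler_normB _ _) _.
have := pos_lip (T - s) (T - t); have := pos_lip (T - e - s) (T - e - t).
rewrite (_ : T - s - (T - t) = - (s - t)); last by ring.
rewrite (_ : T - e - s - (T - e - t) = - (s - t)); last by ring.
by rewrite normrN => h1 h2; exact: lerD.
Qed.

End Trunc.

Definition sublevel f U (t : R) : set R[i] := [set z | U z /\ cmod (f z) < t].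

Definition energy f U t : \bar R :=
  (\int[mu2]_(p in plane (sublevel f U t)) ((cmod (dv f (p.1 +i* p.2)) ^+ 2)%:E))%E.

Lemma copen_sublevel f U t : copen U -> holo f U -> copen (sublevel f U t).
Proof.
move=> oU hf z [Uz zt]; have [d d0 Hd] := oU z Uz.
have h0 : 0 < (t - cmod (f z)) / 2 by lra.
have [d' d'0 Hd'] := (creP _ z).1 (cre_cmod (ex_cder_ccont (hf z Uz))) _ h0.
exists (Num.min d d'); first by rewrite lt_min d0.
move=> w; rewrite lt_min => /andP[/Hd Uw /Hd' b]; split=> //.
by move: b; rewrite ler_norml; lra.
Qed.

Lemma cre_dv2 f U z : copen U -> holo f U -> U z -> cre (fun w => cmod (dv f w) ^+ 2) z.
Proof.
move=> oU hf Uz; apply: creX; apply: cre_cmod; apply: ex_cder_ccont.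
exact: (holo_dv oU hf) Uz.
Qed.

Lemma energy_ge f U t phi (c : R) : copen U -> holo f U -> 0 <= c ->
  (forall z, U z -> cre phi z) -> (forall z, U z -> 0 <= phi z) ->
  (forall z, U z -> cmod (f z) < t -> phi z <= c * cmod (dv f z) ^+ 2) ->
  (forall z, U z -> t <= cmod (f z) -> phi z = 0) ->
  (\int[mu2]_(p in plane U) (phi (p.1 +i* p.2))%:E <= c%:E * energy f U t)%E.
Proof.
move=> oU hf c0 cphi phi0 phi1 phi2.
have mU := measurable_plane oU.
have oW := copen_sublevel (t := t) oU hf; have mW := measurable_plane oW.
have WU : plane (sublevel f U t) `<=` plane U by move=> p [].
have mdv : measurable_fun (plane U) (fun p : R * R => cmod (dv f (p.1 +i* p.2)) ^+ 2).
  by apply: (measurable_fun_plane (phi := fun z => cmod (dv f z) ^+ 2) oU) => z Uz; exact: (cre_dv2 oU hf Uz).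
have mdvW := measurable_funS mU WU mdv.
rewrite /energy -ge0_integralZl_EFin//; first last.
- exact/measurable_EFinP.
- by move=> p _; rewrite lee_fin sqr_ge0.
rewrite (_ : plane (sublevel f U t) = plane U `&` plane (sublevel f U t)); last first.
  by apply/esym/setIidPr.
rewrite integral_mkcondr; apply: ge0_le_integral => //.
- by move=> p Up; rewrite lee_fin; exact: phi0.
- by apply/measurable_EFinP; exact: (measurable_fun_plane oU cphi).
- apply/(measurable_restrict _ mW mU).
  rewrite (_ : plane U `&` plane (sublevel f U t) = plane (sublevel f U t)); last exact/setIidPr.
  by apply: measurable_funeM; exact/measurable_EFinP.
- move=> p Up; rewrite patchE; case: ifPn => [/set_mem [_ h]|].
    by rewrite -EFinM lee_fin phi1.
  move=> /negP; rewrite inE => nW; rewrite phi2// leNgt; apply/negP => h.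
  by apply: nW.
Qed.

Lemma bd_lower f U Q : holo f U -> (forall z, inbox Q z -> U z) -> wf Q ->
  (forall z, onbd Q z -> f z != 0) ->
  exists2 t : R, 0 < t & forall z, onbd Q z -> t <= cmod (f z).
Proof.
move=> hf QU wQ fbd.
have cV : bdcont (fun z => (f z)^-1) Q.
  move=> z zQ; have [A dA] := hf z (QU z (onbd_inbox zQ)).
  exact: cder_cont (cderV dA (fbd z zQ)).
have [M M0 HM] := bd_bounded wQ cV; exists M^-1; first by rewrite invr_gt0.
move=> z zQ; have := HM z zQ; rewrite cmodV => h.
by rewrite -[cmod _]invrK lef_pV2 ?posrE// invr_gt0 cmod_gt0 fbd.
Qed.

Section Truncated.
Variables (f : R[i] -> R[i]) (U : set R[i]) (Q : box R) (t e : R).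
Hypotheses (oU : copen U) (hf : holo f U) (wQ : wf Q) (QU : forall z, inbox Q z -> U z).
Hypotheses (t0 : 0 < t) (e0 : 0 < e) (et : e < t ^+ 2).
Hypothesis fbd : forall z, onbd Q z -> t <= cmod (f z).

Definition density z := dtrunc (t ^+ 2) e (cmod (f z) ^+ 2) * cmod (dv f z) ^+ 2.

Lemma density_ge0 z : 0 <= density z.
Proof. by rewrite /density mulr_ge0 ?sqr_ge0//; have /andP[] := dtrunc_bound e0 et (cmod (f z) ^+ 2). Qed.

Lemma cre_density z : U z -> cre density z.
Proof.
move=> Uz; apply: creM; last exact: (cre_dv2 oU hf Uz).
apply: (cre_lip (L := 2 / e)); first by rewrite divr_gt0.
  by move=> *; exact: dtrunc_lip.
by apply: creX; apply: cre_cmod; exact: ex_cder_ccont (hf Uz).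
Qed.

(** With [F = trunc (t ^+ 2) e], the form [F (|f|^2) f' / f dz]; its derivative
    with respect to the conjugate of [z] is [F' (|f|^2) |f'|^2 = density].  Near
    a zero of [f], where [F] is the identity, it is [conj f * f'], so that there
    is no singularity. *)
Let g z := if f z == 0 then 0 else (trunc (t ^+ 2) e (cmod (f z) ^+ 2))%:C * (dv f z / f z).

Lemma truncated_green :
  rectint g Q = 0 +i* (2 * aint density Q).
Proof.
apply: (green_area oU wQ QU cre_density) => z zQ.
have Uz := QU zQ; have dfz := dvP (hf Uz); have [A dA] := holo_dv oU hf Uz.
have sq w : (cmod (f w) ^+ 2)%:C = f w * conjc (f w) by rewrite conjcM_cmod.
have du := rderM dfz (rder_conj dfz).
have [fz0|fz0] := eqVneq (f z) 0.
  have := rderM (rder_conj dfz) dA; set AA := (X in rder _ _ X _); set BB := (X in rder _ _ _ X).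
  move=> D; exists AA.
  have -> : (density z)%:C = BB.
    rewrite /BB /density fz0 cmod0 expr0n /= dtrunc0// mul1r -conjcM_cmod mulr0 addr0.
    by rewrite mulrC.
  apply: rder_near D; have [d d0 Hd] := (creP _ _).1 (creX 2 (cre_cmod (cder_cont dfz))) (t ^+ 2 - e) ltac:(by have := et; lra).
  exists d => // w /Hd; rewrite fz0 cmod0 expr0n subr0 => h.
  rewrite /g; case: eqP => [->|/eqP fw0]; first by rewrite conjc0 mul0r.
  rewrite trunc_small//; last by apply: le_trans h; exact: ler_norm.
  by rewrite sq; field.
have dF : rder (fun w => (trunc (t ^+ 2) e (cmod (f w) ^+ 2))%:C) z
   ((dtrunc (t ^+ 2) e (cmod (f z) ^+ 2))%:C * (dv f z * conjc (f z) + f z * conjc 0))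
   ((dtrunc (t ^+ 2) e (cmod (f z) ^+ 2))%:C * (0 * conjc (f z) + f z * conjc (dv f z))).
  apply: (@rder_comp_real _ _ e^-1 (fun w => cmod (f w) ^+ 2)).
    by move=> s; exact: trunc_approx.
  by apply: rder_ext du.
have dq := cderM dA (cderV dfz fz0).
have := rderM dF dq; set AA := (X in rder _ _ X _); set BB := (X in rder _ _ _ X).
move=> D; exists AA.
have -> : (density z)%:C = BB.
  rewrite /BB /density rmorphM /= -conjcM_cmod; field; exact: fz0.
apply: rder_near D; have [d d0 Hd] := ccont_neq0 (cder_cont dfz) fz0.
exists d => // w /Hd h; rewrite /g; case: eqP => // fw0.
by exfalso; move: h; rewrite fw0 cmod0; have := cmod_gt0 (f z); rewrite fz0; lra.
Qed.

(** On the boundary [F (|f|^2)] is the constant [t ^+ 2 - e / 2]. *)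
Lemma truncated_identity :
  (t ^+ 2 - e / 2) * Im (rectint (fun z => dv f z / f z) Q) = 2 * aint density Q.
Proof.
have fn0 z : onbd Q z -> f z != 0.
  by move=> /fbd h; rewrite -cmod_gt0; exact: lt_le_trans h.
have cq : bdcont (fun z => dv f z / f z) Q.
  move=> z zQ; have Uz := QU (onbd_inbox zQ); apply: ccontM.
    exact: ex_cder_ccont (holo_dv oU hf Uz).
  exact: cder_cont (cderV (dvP (hf Uz)) (fn0 z zQ)).
have : rectint g Q = (t ^+ 2 - e / 2)%:C * rectint (fun z => dv f z / f z) Q.
  rewrite -(rectintZ _ wQ cq); apply: rectint_ext => // z zQ.
  rewrite /g (negbTE (fn0 z zQ)) trunc_large//.
  by rewrite lerXn2r ?nnegrE ?cmod_ge0 ?(ltW t0)// fbd.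
rewrite truncated_green; move: (rectint _ _) => r /(congr1 (@complex.Im R)).
by rewrite cImM /= mul0r addr0 => ->.
Qed.

Lemma density_energy : ((aint density Q)%:E <= energy f U t)%E.
Proof.
rewrite (aint_E oU wQ QU cre_density).
have mU := measurable_plane oU.
apply: (@le_trans _ _ (\int[mu2]_(p in plane U) (density (p.1 +i* p.2))%:E)%E).
  apply: ge0_subset_integral => //.
  - exact: measurable_hbox.
  - by apply/measurable_EFinP; exact: (measurable_fun_plane oU cre_density).
  - by move=> p _; rewrite lee_fin density_ge0.
  - exact: hbox_plane.
rewrite -[leRHS]mul1e; apply: energy_ge => //; first exact: cre_density.
- by move=> *; exact: density_ge0.
- move=> z Uz _; rewrite /density ler_wpM2r ?sqr_ge0//.
  by have /andP[] := dtrunc_bound e0 et (cmod (f z) ^+ 2).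
- move=> z Uz h; rewrite /density dtrunc_large ?mul0r//.
  by rewrite lerXn2r ?nnegrE ?cmod_ge0 ?(ltW t0).
Qed.

End Truncated.

Section ArgumentPrinciple.
Variables (U : set R[i]) (Q : box R).
Hypotheses (oU : copen U) (wQ : wf Q) (QU : forall z, inbox Q z -> U z).

(** [2 * pi] times the number of zeros of [f] in [Q], if none is on the boundary. *)
Definition logint f := Im (rectint (fun z => dv f z / f z) Q).

(** By [truncated_identity] it is a positive multiple of the area integral of a
    nonnegative function; so it has a sign without any counting of zeros. *)
Lemma logint_ge0 f : holo f U -> (forall z, onbd Q z -> f z != 0) -> 0 <= logint f.
Proof.
move=> hf fbd; have [t t0 Ht] := bd_lower hf QU wQ fbd.
have t2 : 0 < t ^+ 2 by rewrite exprn_gt0.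
have e0 : 0 < t ^+ 2 / 2 by lra.
have et : t ^+ 2 / 2 < t ^+ 2 by lra.
have := truncated_identity oU hf wQ QU t0 e0 et Ht; rewrite -/(logint f).
have : 0 <= aint (density f t (t ^+ 2 / 2)) Q.
  by apply: Rintegral_ge0 => p _; exact: density_ge0.
move: (aint _ _) (logint f) => I J I0 E.
have E2 : (3 / 4 * t ^+ 2) * J = 2 * I by rewrite -E; field.
have : 0 <= (3 / 4 * t ^+ 2) * J by rewrite E2 mulr_ge0.
by rewrite pmulr_rge0//; lra.
Qed.

(** The limit of [truncated_identity] as [e] tends to 0. *)
Lemma logint_energy f (t : R) : holo f U -> 0 < t ->
  (forall z, onbd Q z -> t <= cmod (f z)) ->
  ((t ^+ 2 / 2 * logint f)%:E <= energy f U t)%E.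
Proof.
move=> hf t0 Ht.
have t2 : 0 < t ^+ 2 by rewrite exprn_gt0.
have fbd z : onbd Q z -> f z != 0.
  by move=> /Ht h; rewrite -cmod_gt0; exact: lt_le_trans h.
have J0 := logint_ge0 hf fbd.
have bnd e : 0 < e -> e < t ^+ 2 -> (((t ^+ 2 - e / 2) / 2 * logint f)%:E <= energy f U t)%E.
  move=> e0 et; apply: le_trans (density_energy oU hf wQ QU t0 e0 et).
  by rewrite lee_fin mulrAC (truncated_identity oU hf wQ QU t0 e0 et Ht) mulrC mulKf.
case E : (energy f U t) bnd => [x| |] bnd; last 2 first.
- by rewrite leey.
- by have := bnd (t ^+ 2 / 2) ltac:(by lra) ltac:(by lra); rewrite leeNy_eq.
rewrite lee_fin; apply/ler_addgt0Pr => dl dl0; move: bnd J0; move: (logint f) => J bnd J0.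
pose e := Num.min (t ^+ 2 / 2) (4 * dl / (J + 1)).
have J1 : 0 < J + 1 by lra.
have e0 : 0 < e by rewrite lt_min !divr_gt0// mulr_gt0.
have et : e <= t ^+ 2 / 2 by rewrite ge_min lexx.
have ed : e * (J + 1) <= 4 * dl by rewrite -ler_pdivlMr// ge_min lexx orbT.
have := bnd e e0; rewrite lee_fin => /(_ ltac:(by lra)) h.
by have := mulr_ge0 (ltW e0) J0; nra.
Qed.

Lemma logint_factor f h a : holo h U -> (forall z, f z = (z - a) * h z) -> inside Q a ->
  (forall z, onbd Q z -> f z != 0) -> logint f = 2 * pi + logint h.
Proof.
move=> hh fE aQ fbd.
have hbd z : onbd Q z -> h z != 0.
  by move=> /fbd; rewrite fE mulf_eq0 negb_or => /andP[].
have cq : bdcont (fun z => dv h z / h z) Q.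
  move=> z zQ; have Uz := QU (onbd_inbox zQ); apply: ccontM.
    exact: ex_cder_ccont (holo_dv oU hh Uz).
  exact: cder_cont (cderV (dvP (hh z Uz)) (hbd z zQ)).
have c1 : bdcont (fun z => (z - a)^-1) Q.
  by move=> z zQ; apply: cder_cont; apply: cder_inv_sub; exact: inside_bd aQ zQ.
have : rectint (fun z => dv f z / f z) Q = tpi R + rectint (fun z => dv h z / h z) Q.
  rewrite -(winding aQ) -(rectintD wQ c1 cq); apply: rectint_ext => // z zQ.
  have Uz := QU (onbd_inbox zQ).
  have df : cder f z (1 * h z + (z - a) * dv h z).
    by apply: rder_ext (cderM (cder_subr a z) (dvP (hh z Uz))).
  rewrite (dvE df) fE; field.
  by rewrite (hbd z zQ) (inside_bd aQ zQ).
rewrite /logint => ->; move: (rectint _ _) => r; by rewrite cImD.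
Qed.

End ArgumentPrinciple.

End AreaLemma.

(** * Slices and increments *)

Section LengthArea.
Variable R : realType.
Implicit Types (Q S : box R) (z w a p : R[i]) (f g h : R[i] -> R[i]) (U : set R[i]).
Implicit Types (phi psi : R[i] -> R) (x y b t l r : R).

Notation mu := (@lebesgue_measure R).
Notation mu2 := (@lebesgue_measure R \x @lebesgue_measure R)%E.

Lemma cre_hline phi y b t : (forall x, b <= x <= t -> cre phi (x +i* y)) ->
  rcont_on (fun x => phi (x +i* y)) b t.
Proof. by move=> c; have [c1 _] := ccont_h c. Qed.

Lemma cre_vline phi x b t : (forall y, b <= y <= t -> cre phi (x +i* y)) ->
  rcont_on (fun y => phi (x +i* y)) b t.
Proof. by move=> c; have [c1 _] := ccont_v c. Qed.

(** From [F'^2 <= k] follows [|F'| <= lam + k / (4 lam)], by the inequality between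
    the arithmetic and the geometric mean; choosing [lam] afterwards replaces
    the Cauchy-Schwarz inequality. *)
Lemma increment_bound (F D k : R -> R) (a b x1 x2 lam : R) :
  0 < lam -> a <= x1 -> x1 <= x2 -> x2 <= b ->
  rcont_on D a b -> rcont_on k a b ->
  (forall x, a <= x <= b -> is_derive x 1 F (D x)) ->
  (forall x, a <= x <= b -> D x ^+ 2 <= k x) ->
  `|F x2 - F x1| <= lam * (b - a) + rint1 k a b / (4 * lam).
Proof.
move=> l0 ax1 x12 x2b cD ck dF Dk.
pose H x := lam + (4 * lam)^-1 * k x.
have cH : rcont_on H a b.
  by move=> x xab; apply: rcontD; [exact: rcont_cst|apply: rcontZ; exact: ck].
have k0 x : a <= x <= b -> 0 <= k x by move=> /Dk; apply: le_trans; exact: sqr_ge0.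
have HD x : a <= x <= b -> `|D x| <= H x.
  move=> xab; rewrite /H -(ler_pM2l (x := 4 * lam)); last lra.
  rewrite mulrDr mulVKf; last by rewrite gt_eqF//; lra.
  have := Dk x xab; rewrite -(real_normK (num_real (D x))).
  by have := sqr_ge0 (2 * lam - `|D x|); nra.
have H0 x : a <= x <= b -> 0 <= H x by move=> /HD; apply: le_trans.
have -> : lam * (b - a) + rint1 k a b / (4 * lam) = rint1 H a b.
  rewrite /H rint1D ?rint1Z ?rint1_cst//; first by ring.
  - by lra.
  - by move=> *; exact: rcont_cst.
  - by move=> x xab; apply: rcontZ; exact: ck.
have c12 (u : R -> R) : rcont_on u a b -> rcont_on u x1 x2.
  by move=> cu; exact: rcont_onW cu ax1 x2b.
have -> : F x2 - F x1 = rint1 D x1 x2.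
  by apply/esym; apply: (rint1_FTC x12 (c12 _ cD)) => x h; apply: dF; lra.
have h1 : rint1 D x1 x2 <= rint1 H x1 x2.
  apply: rint1_le; try exact: c12.
  by move=> x h; have : a <= x <= b by [lra]; move=> /HD; rewrite ler_norml; lra.
have h2 : - rint1 D x1 x2 <= rint1 H x1 x2.
  rewrite -rint1N; last exact: c12.
  apply: rint1_le; try exact: c12.
    move=> x h; have xab : a <= x <= b by lra.
    move: (rcontZ (-1) (cD x xab)) => c e e0.
    by have [d d0 Hd] := c e e0; exists d => // y' /Hd; rewrite !mulN1r.
  by move=> x h; have : a <= x <= b by [lra]; move=> /HD; rewrite ler_norml; lra.
have p0 u v : a <= u -> u <= v -> v <= b -> 0 <= rint1 H u v.
  move=> au uv vb; have -> : 0 = rint1 (fun=> 0) u v by rewrite rint1_cst// mul0r.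
  apply: rint1_le; first by move=> *; exact: rcont_cst.
    exact: rcont_onW cH au vb.
  by move=> x h; apply: H0; lra.
have -> : rint1 H a b = rint1 H a x1 + (rint1 H x1 x2 + rint1 H x2 b).
  rewrite -(rint1_chasles (a := x1)); last by exact: rcont_onW cH ax1 _.
    by rewrite -rint1_chasles//; lra.
  by lra.
have h3 := p0 a x1 (lexx a) ax1 (le_trans x12 x2b).
have h4 := p0 x2 b (le_trans ax1 x12) x2b (lexx b).
by rewrite ler_norml; lra.
Qed.

Lemma rder_hline phi z A B : rder (fun w => (phi w)%:C) z A B ->
  is_derive (Re z) 1 (fun x => phi (x +i* Im z)) (Re (A + B)).
Proof.
move=> d; apply: is_derive_of_approx => e e0; have [dl dl0 H] := d e e0.
exists dl => // x xz; have := H (x +i* Im z).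
have zE : Re z +i* Im z = z by case: (z).
have -> : (x +i* Im z) - z = (x - Re z)%:C.
  by apply: complex_ext; rewrite ?cReB ?cImB //= subrr.
rewrite cmodR => /(_ xz); apply: le_trans; apply: le_trans (Re_le_cmod _).
rewrite -[X in _ <= X]/(`|_|) !(cReB, cReD, cReM) conjc_real /= !mulr0 !subr0 zE.
by rewrite mulrDl.
Qed.

Lemma rder_vline phi z A B : rder (fun w => (phi w)%:C) z A B ->
  is_derive (Im z) 1 (fun y => phi (Re z +i* y)) (Im (B - A)).
Proof.
move=> d; apply: is_derive_of_approx => e e0; have [dl dl0 H] := d e e0.
exists dl => // y yz; have := H (Re z +i* y).
have zE : Re z +i* Im z = z by case: (z).
have -> : (Re z +i* y) - z = (0 +i* (y - Im z)).
  by apply: complex_ext; rewrite ?cReB ?cImB //= subrr.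
have -> : cmod (0 +i* (y - Im z)) = `|y - Im z|.
  by rewrite /= expr0n add0r sqrtr_sqr.
move=> /(_ yz); apply: le_trans; apply: le_trans (Re_le_cmod _).
rewrite !(cReB, cReD, cReM, cImB) /= zE.
by rewrite le_eqVlt; apply/orP; left; apply/eqP; congr `|_|; ring.
Qed.

Section Slices.
Variables (phi : R[i] -> R) (U : set R[i]) (Q : box R).
Hypotheses (oU : copen U) (wQ : wf Q) (QU : forall z, inbox Q z -> U z)
  (cphi : forall z, U z -> cre phi z) (phi0 : forall z, U z -> 0 <= phi z).

Let F := ((fun p : R * R => (phi (p.1 +i* p.2))%:E) \_ (hbox Q)).

Let mF : measurable_fun setT F.
Proof.
have h : measurable_fun (hbox Q) (EFin \o (fun p : R * R => phi (p.1 +i* p.2))).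
  apply/measurable_EFinP.
  apply: measurable_funS (measurable_fun_plane oU cphi); last exact: hbox_plane.
  exact: measurable_plane.
exact: ((measurable_restrictT _ (measurable_hbox Q)).1 h).
Qed.

Let F0 (p : R * R) : (0 <= F p)%E.
Proof.
rewrite /F patchE; case: ifPn => // /set_mem /hboxE[h1 h2].
by rewrite lee_fin phi0//; apply: QU; rewrite /inbox /=; lra.
Qed.

(** Fubini's theorem: if all vertical slices have a large integral, so has the
    box. *)
Lemma area_ge_vslices (c : R) : 0 <= c ->
  (forall x, lft Q < x <= rgt Q -> c <= rint1 (fun y => phi (x +i* y)) (bot Q) (top Q)) ->
  ((c * (rgt Q - lft Q))%:E <= \int[mu2]_(p in hbox Q) (phi (p.1 +i* p.2))%:E)%E.
Proof.
move=> c0 H; have [w1 w2] := andP wQ.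
have -> : (\int[mu2]_(p in hbox Q) (phi (p.1 +i* p.2))%:E = \int[mu]_x fubini_F mu F x)%E.
  have h := @fubini_tonelli1 _ _ _ _ R mu mu F mF F0.
  by rewrite integral_mkcond; exact h.
apply: (@le_trans _ _ (\int[mu]_x (cst c%:E \_ (`]lft Q, rgt Q])) x)%E).
  rewrite -integral_mkcond integral_cst//= lebesgue_measure_itv /= lte_fin.
  case: ltP => h; first by rewrite -EFinB -EFinM.
  by have -> : rgt Q = lft Q by [lra]; rewrite subrr mulr0 mule0.
apply: ge0_le_integral => //.
- by move=> x _; rewrite patchE; case: ifP.
- have h : measurable_fun `]lft Q, rgt Q] (cst c%:E : R -> \bar R) by exact: measurable_cst.
  exact: ((measurable_restrictT _ (measurable_itv _)).1 h).
- have h := @measurable_fun_fubini_tonelli_F _ _ _ _ R mu F mF F0.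
  by exact h.
move=> x _; rewrite patchE; case: ifPn => [|_]; last by apply: integral_ge0 => y _.
rewrite inE /= in_itv /= => xQ; rewrite /fubini_F.
have cx : rcont_on (fun y => phi (x +i* y)) (bot Q) (top Q).
  by apply: cre_vline => y yQ; apply: cphi; apply: QU; rewrite /inbox /=; lra.
have -> : (\int[mu]_y F (x, y) = (rint1 (fun y => phi (x +i* y)) (bot Q) (top Q))%:E)%E.
  rewrite /rint1 /Rintegral fineK; last first.
    by apply: integrable_fin_num => //; exact: rcont_on_integrable.
  rewrite -[RHS]integral_itv_obnd_cbnd; last first.
    apply: measurable_funS (measurable_int _ (rcont_on_integrable cx)) => //.
    by move=> v /=; rewrite !in_itv /=; lra.
  rewrite [RHS]integral_mkcond; apply: eq_integral => y _.
  rewrite /F !patchE; congr (if _ then _ else _).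
  apply/idP/idP; rewrite !inE => h.
    by move: h => /hboxE[_ h]; rewrite /= in_itv.
  by apply/hboxE; rewrite /= in_itv /= in h *.
by rewrite lee_fin; exact: H.
Qed.

Lemma area_ge_hslices (c : R) : 0 <= c ->
  (forall y, bot Q < y <= top Q -> c <= rint1 (fun x => phi (x +i* y)) (lft Q) (rgt Q)) ->
  ((c * (top Q - bot Q))%:E <= \int[mu2]_(p in hbox Q) (phi (p.1 +i* p.2))%:E)%E.
Proof.
move=> c0 H; have [w1 w2] := andP wQ.
have -> : (\int[mu2]_(p in hbox Q) (phi (p.1 +i* p.2))%:E = \int[mu]_x fubini_G mu F x)%E.
  have h := @fubini_tonelli2 _ _ _ _ R mu mu F mF F0.
  by rewrite integral_mkcond; exact h.
apply: (@le_trans _ _ (\int[mu]_x (cst c%:E \_ (`]bot Q, top Q])) x)%E).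
  rewrite -integral_mkcond integral_cst//= lebesgue_measure_itv /= lte_fin.
  case: ltP => h; first by rewrite -EFinB -EFinM.
  by have -> : top Q = bot Q by [lra]; rewrite subrr mulr0 mule0.
apply: ge0_le_integral => //.
- by move=> x _; rewrite patchE; case: ifP.
- have h : measurable_fun `]bot Q, top Q] (cst c%:E : R -> \bar R) by exact: measurable_cst.
  exact: ((measurable_restrictT _ (measurable_itv _)).1 h).
- have h := @measurable_fun_fubini_tonelli_G _ _ _ _ R mu F mF F0.
  by exact h.
move=> y _; rewrite patchE; case: ifPn => [|_]; last by apply: integral_ge0 => x _.
rewrite inE /= in_itv /= => yQ; rewrite /fubini_G.
have cx : rcont_on (fun x => phi (x +i* y)) (lft Q) (rgt Q).
  by apply: cre_hline => x xQ; apply: cphi; apply: QU; rewrite /inbox /=; lra.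
have -> : (\int[mu]_x F (x, y) = (rint1 (fun x => phi (x +i* y)) (lft Q) (rgt Q))%:E)%E.
  rewrite /rint1 /Rintegral fineK; last first.
    by apply: integrable_fin_num => //; exact: rcont_on_integrable.
  rewrite -[RHS]integral_itv_obnd_cbnd; last first.
    apply: measurable_funS (measurable_int _ (rcont_on_integrable cx)) => //.
    by move=> v /=; rewrite !in_itv /=; lra.
  rewrite [RHS]integral_mkcond; apply: eq_integral => x _.
  rewrite /F !patchE; congr (if _ then _ else _).
  apply/idP/idP; rewrite !inE => h.
    by move: h => /hboxE[h _]; rewrite /= in_itv.
  by apply/hboxE; rewrite /= in_itv /= in h *.
by rewrite lee_fin; exact: H.
Qed.

End Slices.

End LengthArea.

(** * Rectangles on which the modulus hardly varies *)

Section GoodLoop.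
Variable R : realType.
Implicit Types (Q S : box R) (z w a p : R[i]) (f g h : R[i] -> R[i]) (U : set R[i]).
Implicit Types (phi psi : R[i] -> R) (x y b t l r s : R).

Notation mu := (@lebesgue_measure R).
Notation mu2 := (@lebesgue_measure R \x @lebesgue_measure R)%E.

(** A continuously differentiable increasing function of [|f|] that is constant,
    equal to 0, where [1 <= |f|]: its gradient lives on the set over which the
    energy is taken. *)
Definition height f z : R := - pos (1 - cmod (f z) ^+ 2) ^+ 2.

(** The squared sum of the moduli of the two Wirtinger derivatives of [height f];
    it bounds the squares of both partial derivatives, and is a continuous
    function of [z]. *)
Definition slope f z : R :=
  (4 * pos (1 - cmod (f z) ^+ 2)) ^+ 2 * (cmod (f z) * cmod (dv f z)) ^+ 2.

Lemma ccont_conj g z : ccont g z -> ccont (fun w => conjc (g w)) z.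
Proof.
by move=> c e e0; have [d d0 H] := c e e0; exists d => // w /H; rewrite -rmorphB cmod_conj.
Qed.

Lemma cre_Re g z : ccont g z -> cre (fun w => Re (g w)) z.
Proof.
move=> c; apply/creP => e e0; have [d d0 H] := c e e0; exists d => // w /H.
by apply: le_trans; rewrite -cReB Re_le_cmod.
Qed.

Lemma cre_Im g z : ccont g z -> cre (fun w => Im (g w)) z.
Proof.
move=> c; apply/creP => e e0; have [d d0 H] := c e e0; exists d => // w /H.
by apply: le_trans; rewrite -cImB Im_le_cmod.
Qed.

Lemma pos_ge0 (x : R) : 0 <= pos x. Proof. by rewrite /pos le_max lexx. Qed.

Section Height.
Variables (f : R[i] -> R[i]) (U : set R[i]).
Hypotheses (oU : copen U) (hf : holo f U).

Let cp z : U z -> cre (fun w => pos (1 - cmod (f w) ^+ 2)) z.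
Proof.
move=> Uz; apply: (@cre_lip _ (fun s => pos (1 - s)) 1) => //.
  move=> s t; apply: le_trans (pos_lip _ _) _; rewrite mul1r.
  by rewrite (_ : 1 - s - (1 - t) = - (s - t)) ?normrN//; ring.
by apply: creX; apply: cre_cmod; exact: ex_cder_ccont (hf Uz).
Qed.

Lemma cre_slope z : U z -> cre (slope f) z.
Proof.
move=> Uz; apply: creM; apply: creX; apply: creM.
- exact: ccont_cst.
- exact: cp.
- by apply: cre_cmod; exact: ex_cder_ccont (hf Uz).
- by apply: cre_cmod; exact: ex_cder_ccont (holo_dv oU hf Uz).
Qed.

Lemma slope_ge0 z : 0 <= slope f z.
Proof. by rewrite /slope mulr_ge0 ?sqr_ge0. Qed.

Lemma slope_le z : cmod (f z) < 1 -> slope f z <= 16 * cmod (dv f z) ^+ 2.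
Proof.
move=> h; have c0 := cmod_ge0 (f z).
have h1 : 0 <= 1 - cmod (f z) ^+ 2 by nra.
rewrite /slope (pos_id h1).
rewrite (_ : _ * _ = 16 * ((1 - cmod (f z) ^+ 2) ^+ 2 * cmod (f z) ^+ 2 * cmod (dv f z) ^+ 2)); last by ring.
rewrite ler_wpM2l// ler_piMl ?sqr_ge0// mulr_ile1 ?sqr_ge0//.
  by rewrite expr_le1//; have := sqr_ge0 (cmod (f z)); lra.
by rewrite expr_le1// ltW.
Qed.

Lemma slope_eq0 z : 1 <= cmod (f z) -> slope f z = 0.
Proof.
move=> h; have h1 : 1 - cmod (f z) ^+ 2 <= 0 by nra.
by rewrite /slope (pos_eq0 h1) mulr0 expr0n mul0r.
Qed.

Lemma slope_energy :
  (\int[mu2]_(p in plane U) (slope f (p.1 +i* p.2))%:E <= 16%:E * energy f U 1)%E.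
Proof.
apply: energy_ge => //.
- exact: cre_slope.
- by move=> *; exact: slope_ge0.
- by move=> z _; exact: slope_le.
- by move=> z _; exact: slope_eq0.
Qed.

(** [A] and [B] are the Wirtinger derivatives of the height. *)
Let k z := 2 * pos (1 - cmod (f z) ^+ 2).
Let A z := (k z)%:C * (dv f z * conjc (f z)).
Let B z := (k z)%:C * (f z * conjc (dv f z)).

Let dheight z : U z -> rder (fun w => (height f w)%:C) z (A z) (B z).
Proof.
move=> Uz; have dfz := dvP (hf Uz).
have sq w : f w * conjc (f w) = (cmod (f w) ^+ 2)%:C by rewrite conjcM_cmod.
have du := rderM dfz (rder_conj dfz).
apply: (@rder_comp_real _ (fun s => - pos (1 - s) ^+ 2) _ 1 (fun w => cmod (f w) ^+ 2)).
  move=> s; have := pos_sqr_approx (1 - cmod (f z) ^+ 2) (1 - s).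
  rewrite mul1r (_ : 1 - s - _ = - (s - cmod (f z) ^+ 2)); last by ring.
  rewrite sqrrN -normrN; apply: le_trans; rewrite le_eqVlt; apply/orP; left; apply/eqP.
  by congr `|_|; rewrite /k; ring.
by apply: rder_ext du => //; rewrite ?conjc0; ring.
Qed.

Let cA z : U z -> ccont A z /\ ccont B z.
Proof.
move=> Uz; have cf := ex_cder_ccont (hf Uz); have cd := ex_cder_ccont (holo_dv oU hf Uz).
have ck : cre k z by apply: creM; [exact: ccont_cst|exact: cp].
by split; apply: ccontM => //; apply: ccontM => //; exact: ccont_conj.
Qed.

Let AB_le z : (cmod (A z) + cmod (B z)) ^+ 2 = slope f z.
Proof.
rewrite /A /B /slope !cmodM !cmod_conj cmodR ger0_norm; last first.
  by rewrite /k mulr_ge0// pos_ge0.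
by rewrite /k; ring.
Qed.

Let sqr_le_of_norm (u v : R) : 0 <= v -> `|u| <= v -> u ^+ 2 <= v ^+ 2.
Proof. by move=> v0 h; rewrite -[leLHS]real_normK ?num_real// lerXn2r ?nnegrE. Qed.

Lemma height_hline y l r s (K : R) (x1 x2 : R) : 0 < s ->
  (forall x, l <= x <= r -> U (x +i* y)) -> l <= x1 <= r -> l <= x2 <= r ->
  rint1 (fun x => slope f (x +i* y)) l r <= K ->
  `|height f (x2 +i* y) - height f (x1 +i* y)| <= s * (r - l) + K / (4 * s).
Proof.
move=> s0 lU; wlog x12 : x1 x2 / x1 <= x2.
  move=> H h1 h2 hK; have [|/ltW] := leP x1 x2 => h; first exact: H.
  by rewrite distrC; exact: H.
move=> /andP[h1 h2] /andP[h3 h4] hK.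
pose D x := Re (A (x +i* y) + B (x +i* y)).
apply: (le_trans (increment_bound (F := fun x => height f (x +i* y)) (D := D)
  (k := fun x => slope f (x +i* y)) s0 h1 x12 h4 _ _ _ _)).
- apply: (@cre_hline _ (fun z => Re (A z + B z))) => x /lU Uz.
  by have [c1 c2] := cA Uz; apply: cre_Re; exact: ccontD.
- by apply: cre_hline => x /lU; exact: cre_slope.
- by move=> x /lU Uz; have := rder_hline (dheight Uz).
- move=> x _; rewrite -AB_le; apply: sqr_le_of_norm; first by rewrite addr_ge0 ?cmod_ge0.
  by apply: le_trans (Re_le_cmod _) (cmodD _ _).
by rewrite lerD2l ler_wpM2r// invr_ge0; lra.
Qed.

Lemma height_vline x l r s (K : R) (y1 y2 : R) : 0 < s ->
  (forall y, l <= y <= r -> U (x +i* y)) -> l <= y1 <= r -> l <= y2 <= r ->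
  rint1 (fun y => slope f (x +i* y)) l r <= K ->
  `|height f (x +i* y2) - height f (x +i* y1)| <= s * (r - l) + K / (4 * s).
Proof.
move=> s0 lU; wlog y12 : y1 y2 / y1 <= y2.
  move=> H h1 h2 hK; have [|/ltW] := leP y1 y2 => h; first exact: H.
  by rewrite distrC; exact: H.
move=> /andP[h1 h2] /andP[h3 h4] hK.
pose D y := Im (B (x +i* y) - A (x +i* y)).
apply: (le_trans (increment_bound (F := fun y => height f (x +i* y)) (D := D)
  (k := fun y => slope f (x +i* y)) s0 h1 y12 h4 _ _ _ _)).
- apply: (@cre_vline _ (fun z => Im (B z - A z))) => y /lU Uz.
  have [c1 c2] := cA Uz; apply: cre_Im; apply: ccontD => //.
  by apply: ccont_ext (ccontM (ccont_cst (-1) _) c1) => w; rewrite mulN1r.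
- by apply: cre_vline => y /lU; exact: cre_slope.
- by move=> y /lU Uz; have := rder_vline (dheight Uz).
- move=> y _; rewrite -AB_le; apply: sqr_le_of_norm; first by rewrite addr_ge0 ?cmod_ge0.
  by apply: le_trans (Im_le_cmod _) _; rewrite addrC -(cmodN (A _)); exact: cmodD.
by rewrite lerD2l ler_wpM2r// invr_ge0; lra.
Qed.

Definition slope_mass Q := (\int[mu2]_(p in hbox Q) (slope f (p.1 +i* p.2))%:E)%E.

Let slope_mass_disjoint (S1 S2 T : box R) : (forall z, inbox T z -> U z) ->
  hbox S1 `<=` hbox T -> hbox S2 `<=` hbox T -> [disjoint hbox S1 & hbox S2] ->
  (slope_mass S1 + slope_mass S2 <= slope_mass T)%E.
Proof.
move=> TU s1 s2 dis.
have mT : measurable_fun (hbox T) (EFin \o (fun p : R * R => slope f (p.1 +i* p.2))).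
  apply/measurable_EFinP.
  apply: measurable_funS (measurable_fun_plane oU cre_slope); last exact: hbox_plane.
  exact: measurable_plane.
have sU : hbox S1 `|` hbox S2 `<=` hbox T by rewrite subUset.
have mU : measurable (hbox S1 `|` hbox S2).
  by apply: measurableU; exact: measurable_hbox.
rewrite /slope_mass -ge0_integral_setU//; try exact: measurable_hbox.
- apply: ge0_subset_integral => //; first exact: measurable_hbox.
  by move=> p _; rewrite lee_fin slope_ge0.
- exact: measurable_funS (measurable_hbox T) sU mT.
- by move=> p _; rewrite lee_fin slope_ge0.
Qed.

(** The sides of a good box lie in the annulus between the squares of half-sides
    [s] and [2 s]. *)
Definition good_box (m s : R) B := [/\ -(2 * s) <= lft B <= - s, s <= rgt B <= 2 * s,
   -(2 * s) <= bot B <= - s, s <= top B <= 2 * s &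
   forall z w, onbd B z -> onbd B w -> `|height f z - height f w| <= 32 * m].

(** The annulus contains four strips of width [s], one along each side.  A strip
    all of whose lengthwise segments have slope integral above [c = 16 m^2 / s]
    carries a slope mass [16 m^2], which adds to that of the inner square.
    Otherwise each strip has a segment with slope integral at most [c], and these
    four bound a good box: by [increment_bound] with [lam = m / s] the height
    varies by at most [4 m + 4 m] along a side, any boundary point is joined to
    the lower left corner by at most two sides, and any two boundary points through that
    corner. *)
Lemma one_scale (m s : R) : 0 < m -> 0 < s -> (forall z, inbox (square 0%R (2 * s)) z -> U z) ->
  (exists B, good_box m s B) \/
  (slope_mass (square 0%R s) + (16 * m ^+ 2)%:E <= slope_mass (square 0%R (2 * s)))%E.
Proof.
move=> m0 s0 QU.
pose c := 16 * m ^+ 2 / s; have c0 : 0 <= c by rewrite divr_ge0 ?mulr_ge0 ?sqr_ge0// ltW.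
have cs : c * s = 16 * m ^+ 2 by rewrite /c mulfVK// gt_eqF.
pose V x := rint1 (fun y => slope f (x +i* y)) (- (2 * s)) (2 * s).
pose H y := rint1 (fun x => slope f (x +i* y)) (- (2 * s)) (2 * s).
have Us x y : - (2 * s) <= x <= 2 * s -> - (2 * s) <= y <= 2 * s -> U (x +i* y).
  by move=> hx hy; apply: QU; rewrite /inbox /square /=; lra.
have strip S : wf S -> subbox S (square 0%R (2 * s)) ->
    [disjoint hbox (square 0%R s) & hbox S] -> ((c * s)%:E <= slope_mass S)%E ->
    (slope_mass (square 0%R s) + (16 * m ^+ 2)%:E <= slope_mass (square 0%R (2 * s)))%E.
  move=> wS sS dis; rewrite cs => h; apply: le_trans (leeD2l _ h) _.
  apply: slope_mass_disjoint => //.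
    by move=> p /hboxE; rewrite /square /= => h'; apply/hboxE => /=; lra.
  by move=> p /hboxE h'; apply/hboxE => /=; move: sS h'; rewrite /subbox /=; lra.
have nV S : wf S -> subbox S (square 0%R (2 * s)) -> bot S = - (2 * s) -> top S = 2 * s ->
    rgt S - lft S = s -> ~ (exists2 x, lft S < x <= rgt S & V x <= c) ->
    ((c * s)%:E <= slope_mass S)%E.
  move=> wS sS e1 e2 e3 nx; rewrite -e3.
  have SU z : inbox S z -> U z by move=> /(subbox_inbox sS); exact: QU.
  apply: (area_ge_vslices oU wS SU cre_slope (fun z _ => slope_ge0 z) c0) => x xS.
  by rewrite e1 e2 leNgt; apply/negP => h; apply: nx; exists x => //; exact: ltW.
have nH S : wf S -> subbox S (square 0%R (2 * s)) -> lft S = - (2 * s) -> rgt S = 2 * s ->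
    top S - bot S = s -> ~ (exists2 y, bot S < y <= top S & H y <= c) ->
    ((c * s)%:E <= slope_mass S)%E.
  move=> wS sS e1 e2 e3 nx; rewrite -e3.
  have SU z : inbox S z -> U z by move=> /(subbox_inbox sS); exact: QU.
  apply: (area_ge_hslices oU wS SU cre_slope (fun z _ => slope_ge0 z) c0) => x xS.
  by rewrite e1 e2 leNgt; apply/negP => h; apply: nx; exists x => //; exact: ltW.
pose Bx2 := Box s (2 * s) (- (2 * s)) (2 * s).
have [wx2 sx2] : wf Bx2 /\ subbox Bx2 (square 0%R (2 * s)) by rewrite /wf /subbox /=; lra.
have dx2 : [disjoint hbox (square 0%R s) & hbox Bx2].
  by apply/disj_setPS => p [/hboxE/= h1 /hboxE/= h2]; lra.
pose Bx1 := Box (- (2 * s)) (- s) (- (2 * s)) (2 * s).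
have [wx1 sx1] : wf Bx1 /\ subbox Bx1 (square 0%R (2 * s)) by rewrite /wf /subbox /=; lra.
have dx1 : [disjoint hbox (square 0%R s) & hbox Bx1].
  by apply/disj_setPS => p [/hboxE/= h1 /hboxE/= h2]; lra.
pose By2 := Box (- (2 * s)) (2 * s) s (2 * s).
have [wy2 sy2] : wf By2 /\ subbox By2 (square 0%R (2 * s)) by rewrite /wf /subbox /=; lra.
have dy2 : [disjoint hbox (square 0%R s) & hbox By2].
  by apply/disj_setPS => p [/hboxE/= h1 /hboxE/= h2]; lra.
pose By1 := Box (- (2 * s)) (2 * s) (- (2 * s)) (- s).
have [wy1 sy1] : wf By1 /\ subbox By1 (square 0%R (2 * s)) by rewrite /wf /subbox /=; lra.
have dy1 : [disjoint hbox (square 0%R s) & hbox By1].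
  by apply/disj_setPS => p [/hboxE/= h1 /hboxE/= h2]; lra.
have len1 : 2 * s - s = s by ring.
have len2 : - s - - (2 * s) = s by ring.
have t1 (p q r : R) : `|p - q| <= 8 * m -> `|q - r| <= 8 * m -> `|p - r| <= 16 * m.
  by rewrite !ler_norml; lra.
have t2 (p q : R) : `|p - q| <= 8 * m -> `|p - q| <= 16 * m by lra.
have t3 (p q r : R) : `|p - r| <= 16 * m -> `|q - r| <= 16 * m -> `|p - q| <= 32 * m.
  by rewrite !ler_norml; lra.
have [[x2 x2S Vx2]|nx2] := pselect (exists2 x, s < x <= 2 * s & V x <= c); last first.
  by right; exact: strip _ wx2 sx2 dx2 (nV _ wx2 sx2 erefl erefl len1 nx2).
have [[x1 x1S Vx1]|nx1] := pselect (exists2 x, - (2 * s) < x <= - s & V x <= c); last first.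
  by right; exact: strip _ wx1 sx1 dx1 (nV _ wx1 sx1 erefl erefl len2 nx1).
have [[y2 y2S Hy2]|ny2] := pselect (exists2 y, s < y <= 2 * s & H y <= c); last first.
  by right; exact: strip _ wy2 sy2 dy2 (nH _ wy2 sy2 erefl erefl len1 ny2).
have [[y1 y1S Hy1]|ny1] := pselect (exists2 y, - (2 * s) < y <= - s & H y <= c); last first.
  by right; exact: strip _ wy1 sy1 dy1 (nH _ wy1 sy1 erefl erefl len2 ny1).
left; exists (Box x1 x2 y1 y2).
move: x1S x2S y1S y2S Vx1 Vx2 Hy1 Hy2.
move=> /andP[? ?] /andP[? ?] /andP[? ?] /andP[? ?] {strip nV nH}.
have xx1 : x1 <= x1 <= x2 by lra. have xx2 : x1 <= x2 <= x2 by lra.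
have yy1 : y1 <= y1 <= y2 by lra. have yy2 : y1 <= y2 <= y2 by lra.
have inx x : x1 <= x <= x2 -> - (2 * s) <= x <= 2 * s by lra.
have iny y : y1 <= y <= y2 -> - (2 * s) <= y <= 2 * s by lra.
have b1 : - (2 * s) <= x1 <= - s by lra. have b2 : s <= x2 <= 2 * s by lra.
have b3 : - (2 * s) <= y1 <= - s by lra. have b4 : s <= y2 <= 2 * s by lra.
move=> Vx1 Vx2 Hy1 Hy2; split; [exact: b1|exact: b2|exact: b3|exact: b4|].
have ms0 : 0 < m / s by rewrite divr_gt0.
have val : m / s * (2 * s - - (2 * s)) + c / (4 * (m / s)) = 8 * m.
  by rewrite /c; field; rewrite !gt_eqF.
have vv x u v : x1 <= x <= x2 -> V x <= c -> y1 <= u <= y2 -> y1 <= v <= y2 ->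
    `|height f (x +i* v) - height f (x +i* u)| <= 8 * m.
  move=> hx hV hu hv; rewrite -val.
  apply: (height_vline ms0 _ (iny _ hu) (iny _ hv) hV) => y hy.
  exact: Us (inx _ hx) hy.
have hh y u v : y1 <= y <= y2 -> H y <= c -> x1 <= u <= x2 -> x1 <= v <= x2 ->
    `|height f (v +i* y) - height f (u +i* y)| <= 8 * m.
  move=> hy hH hu hv; rewrite -val.
  apply: (height_hline ms0 _ (inx _ hu) (inx _ hv) hH) => x hx.
  exact: Us hx (iny _ hy).
move: xx1 xx2 yy1 yy2 => xx1 xx2 yy1 yy2.
have corner z : onbd (Box x1 x2 y1 y2) z -> `|height f z - height f (x1 +i* y1)| <= 16 * m.
  case: z => x y /andP[/= /andP[hx hy]].
  move=> /or4P[] /eqP /= ->.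
  - exact: t2 (vv _ _ _ xx1 Vx1 yy1 hy).
  - exact: t1 (vv _ _ _ xx2 Vx2 yy1 hy) (hh _ _ _ yy1 Hy1 xx1 xx2).
  - exact: t2 (hh _ _ _ yy1 Hy1 xx1 hx).
  - exact: t1 (hh _ _ _ yy2 Hy2 xx1 hx) (vv _ _ _ xx1 Vx1 yy1 yy2).
by move=> z w /corner h1 /corner h2; exact: t3 h1 h2.
Qed.

(** Without a good box at the scales [s, 2 s, ..., 2^n s], each doubling of the
    square adds [16 m^2] to its slope mass. *)
Lemma good_loop (m s : R) n : 0 < m -> 0 < s -> (forall z, inbox (square 0%R (2 ^+ n * s)) z -> U z) ->
  (16%:E * energy f U 1 < (n%:R * (16 * m ^+ 2))%:E)%E ->
  exists2 s', s <= s' & 2 * s' <= 2 ^+ n * s /\ exists B, good_box m s' B.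
Proof.
move=> m0 s0 QU Esmall; apply: contrapT => nex.
have mono j : (j <= n)%N -> 2 ^+ j * s <= 2 ^+ n * s.
  by move=> jn; rewrite ler_wpM2r ?ler_weXn2l ?(ltW s0)// ler1n.
have ge1 j : s <= 2 ^+ j * s by rewrite ler_peMl ?(ltW s0)// exprn_ege1// ler1n.
have mass j : (j <= n)%N -> ((j%:R * (16 * m ^+ 2))%:E <= slope_mass (square 0%R (2 ^+ j * s)))%E.
  elim: j => [|j IH] jn.
    by rewrite mul0r; apply: integral_ge0 => p _; rewrite lee_fin slope_ge0.
  have sj : 2 * (2 ^+ j * s) = 2 ^+ j.+1 * s by rewrite exprS mulrA.
  have j0 : 0 < 2 ^+ j * s by rewrite (lt_le_trans s0).
  have [z zj|h|h] := one_scale m0 j0.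
  - apply: QU; move: zj; rewrite sj; have := mono _ jn.
    by rewrite /inbox /square /=; lra.
  - exfalso; apply: nex; exists (2 ^+ j * s) => //; split => //.
    by rewrite sj; exact: mono.
  - rewrite sj in h; apply: le_trans h; rewrite -natr1 mulrDl mul1r EFinD.
    by apply: leeD2r; apply: IH; exact: ltnW.
have := mass n (leqnn n); rewrite leNgt => /negP; apply.
apply: le_lt_trans Esmall; apply: le_trans slope_energy.
apply: ge0_subset_integral.
- exact: measurable_hbox.
- exact: measurable_plane.
- by apply/measurable_EFinP; exact: (measurable_fun_plane oU cre_slope).
- by move=> p _; rewrite lee_fin slope_ge0.
- exact: hbox_plane.
Qed.

End Height.

End GoodLoop.

(** * Primitives and the logarithm of the modulus *)

Section Primitive.
Variable R : realType.
Implicit Types (Q S : box R) (z w a p : R[i]) (f g h : R[i] -> R[i]) (U : set R[i]).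
Implicit Types (x y : R).

Lemma pcontW (g : R -> R[i]) (a b a' b' : R) :
  pcont g a b -> a <= a' -> b' <= b -> pcont g a' b'.
Proof.
by move=> [c1 c2] h1 h2; split; [exact: rcont_onW c1 h1 h2|exact: rcont_onW c2 h1 h2].
Qed.

Lemma cint_near_cst (g : R -> R[i]) (k : R[i]) (u v M : R) : u <= v -> pcont g u v ->
  (forall t, u <= t <= v -> cmod (g t - k) <= M) ->
  cmod (cint g u v - k * (v - u)%:C) <= 2 * M * (v - u).
Proof.
move=> uv pc H.
have pk : pcont (fun=> - k) u v by split=> t _; exact: rcont_cst.
have e : cint (fun=> - k) u v = - (k * (v - u)%:C).
  rewrite (_ : cint _ u v = cint (fun t => 0 * t%:C + - k) u v); last first.
    by apply: cint_ext => t _; rewrite mul0r add0r.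
  by rewrite cint_affine// mul0r add0r mulNr.
rewrite -e -cintD//; apply: cint_bound => //.
by split=> t ht; [case: pc => c _|case: pc => _ c]; case: pk => d1 d2;
  move=> ee ee0; [have [dl dl0 Hd] := c t ht ee ee0|have [dl dl0 Hd] := c t ht ee ee0];
  exists dl => // y0 /Hd; rewrite !(cReD, cImD) opprD addrACA subrr addr0.
Qed.

(** If the increments of [P] are integrals of [g] in the direction [c], and [g] is
    within [M] of the constant [k], then [P] is linear up to [2 M] times the
    length. *)
Lemma increment_near_linear (P g : R -> R[i]) (c k : R[i]) (a b y y' M : R) :
  (forall u v, a <= u -> u <= v -> v <= b -> P v - P u = c * cint g u v) ->
  cmod c = 1 -> pcont g a b -> a <= y <= b -> a <= y' <= b ->
  (forall t, a <= t <= b -> `|t - y| <= `|y' - y| -> cmod (g t - k) <= M) ->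
  cmod (P y' - P y - c * (k * (y' - y)%:C)) <= 2 * M * `|y' - y|.
Proof.
move=> PE c1 pc.
have aux u v : a <= u -> u <= v -> v <= b ->
    (forall t, u <= t <= v -> cmod (g t - k) <= M) ->
    cmod (P v - P u - c * (k * (v - u)%:C)) <= 2 * M * (v - u).
  move=> h1 h2 h3 H; rewrite PE// -mulrBr cmodM c1 mul1r.
  by apply: cint_near_cst => //; exact: pcontW pc h1 h3.
move=> /andP[? ?] /andP[? ?] H; have [yy|/ltW yy] := leP y y'.
  rewrite ger0_norm ?subr_ge0//; apply: aux => // t /andP[t1 t2]; apply: H; first lra.
  by rewrite !ger0_norm ?subr_ge0//; lra.
rewrite ler0_norm ?subr_le0// opprB -cmodN.
rewrite (_ : - _ = P y - P y' - c * (k * (y - y')%:C)); last by rewrite !rmorphB /=; ring.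
apply: aux => // t /andP[t1 t2]; apply: H; first lra.
by rewrite !ler0_norm ?subr_le0//; lra.
Qed.

Section PrimitiveOnBox.
Variables (q : R[i] -> R[i]) (V : set R[i]) (B : box R).
Hypotheses (hq : holo q V) (BV : forall z, inbox B z -> V z).

(** The integral of [q] from the lower left corner to [z], first along the bottom
    side and then upwards.  Increments in [x] are also integrals of [q], because
    by Goursat's theorem the two ways around a rectangle agree. *)
Definition corner_primitive z : R[i] :=
  cint (fun t => q (t +i* bot B)) (lft B) (Re z)
  + (0 +i* 1) * cint (fun t => q (Re z +i* t)) (bot B) (Im z).

Let cq x y : lft B <= x <= rgt B -> bot B <= y <= top B -> ccont q (x +i* y).
Proof.
by move=> hx hy; apply: ex_cder_ccont; apply: hq; apply: BV; rewrite /inbox /= hx hy.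
Qed.

Let pcv x : lft B <= x <= rgt B -> pcont (fun t => q (x +i* t)) (bot B) (top B).
Proof. by move=> hx; apply: ccont_v => y hy; exact: cq. Qed.

Let pch y : bot B <= y <= top B -> pcont (fun t => q (t +i* y)) (lft B) (rgt B).
Proof. by move=> hy; apply: ccont_h => x hx; exact: cq. Qed.

Lemma primitive_v x y y' : lft B <= x <= rgt B -> bot B <= y -> y <= y' -> y' <= top B ->
  corner_primitive (x +i* y') - corner_primitive (x +i* y)
  = (0 +i* 1) * cint (fun t => q (x +i* t)) y y'.
Proof.
move=> hx h1 h2 h3; rewrite /corner_primitive; cbn [complex.Re complex.Im].
have hy : bot B <= y <= y' by rewrite h1.
rewrite (cint_chasles hy); last exact: pcontW (pcv hx) (lexx _) h3.
by rewrite mulrDr opprD addrACA subrr add0r addrAC subrr add0r.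
Qed.

Lemma primitive_h x x' y : bot B <= y <= top B -> lft B <= x -> x <= x' -> x' <= rgt B ->
  corner_primitive (x' +i* y) - corner_primitive (x +i* y)
  = cint (fun t => q (t +i* y)) x x'.
Proof.
move=> /andP[hy1 hy2] h1 h2 h3; rewrite /corner_primitive; cbn [complex.Re complex.Im].
have hx : lft B <= x <= x' by rewrite h1.
have bb : bot B <= bot B <= top B by rewrite lexx (le_trans hy1).
rewrite (cint_chasles hx); last exact: pcontW (pch bb) (lexx _) h3.
have : rectint q (Box x x' (bot B) y) = 0.
  apply: goursat; first by rewrite /wf /= h2 hy1.
  by move=> z zQ; apply: hq; apply: BV; move: zQ; rewrite /inbox /=; lra.
rewrite /rectint /hint /vint; cbn [lft rgt bot top].
set i1 := cint _ (lft B) x; set i2 := cint (fun t => q (t +i* bot B)) x x'.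
set i3 := cint (fun t => q (x' +i* t)) _ _; set i4 := cint (fun t => q (x +i* t)) _ _.
set i5 := cint (fun t => q (t +i* y)) _ _ => e.
by apply/eqP; rewrite -subr_eq0 -{}e; apply/eqP; ring.
Qed.

Lemma cmod_le_coord (x y u v : R) : `|x| <= `|u| -> `|y| <= `|v| ->
  cmod (x +i* y) <= cmod (u +i* v).
Proof.
move=> h1 h2; rewrite -(@ler_pXn2r _ 2) ?nnegrE ?cmod_ge0// !cmod_sqr /=.
rewrite -(@real_normK _ x) ?num_real// -(@real_normK _ y) ?num_real//.
rewrite -(@real_normK _ u) ?num_real// -(@real_normK _ v) ?num_real//.
by apply: lerD; rewrite lerXn2r ?nnegrE.
Qed.

Lemma primitive_cder z : inside B z -> cder corner_primitive z (q z).
Proof.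
move=> zB; apply/cderP => e e0; have zB' := inside_inbox zB.
have e4 : 0 < e / 4 by lra.
have [d d0 Hd] := ex_cder_ccont (hq (BV zB')) e4.
have [d' d'0 Hd'] := near_inside zB.
exists (Num.min d d'); first by rewrite lt_min d0.
move=> w; rewrite lt_min => /andP[wd /Hd'/inside_inbox wB].
case: z zB zB' Hd {Hd'} wd => x y zB zB' Hd wd.
case: w wB wd => u v wB wd.
move: wB zB'; rewrite /inbox /= => /andP[hu hv] /andP[hx hy].
have E : (u +i* v) - (x +i* y) = (u - x) +i* (v - y) by [].
have h1 := @increment_near_linear (fun t => corner_primitive (u +i* t)) (fun t => q (u +i* t))
  (0 +i* 1) (q (x +i* y)) (bot B) (top B) y v (e / 4)
  (fun t t' => @primitive_v u t t' hu) (@cmodi R) (pcv hu) hy hv ltac:(by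
  move=> t ht tt; apply: Hd; apply: le_lt_trans wd; apply: cmod_le_coord => //).
have h2 := @increment_near_linear (fun t => corner_primitive (t +i* y)) (fun t => q (t +i* y))
  1 (q (x +i* y)) (lft B) (rgt B) x u (e / 4)
  (fun t t' l1 l2 l3 => etrans (@primitive_h t t' y hy l1 l2 l3) (esym (mul1r _)))
  (cmod1 R) (pch hy) hx hu ltac:(by
  move=> t ht tt; apply: Hd; apply: le_lt_trans wd; apply: cmod_le_coord;
  rewrite ?subrr ?normr0).
rewrite mul1r in h2.
have -> : corner_primitive (u +i* v) - corner_primitive (x +i* y)
      - q (x +i* y) * ((u +i* v) - (x +i* y)) =
   (corner_primitive (u +i* v) - corner_primitive (u +i* y)
      - (0 +i* 1) * (q (x +i* y) * (v - y)%:C)) +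
   (corner_primitive (u +i* y) - corner_primitive (x +i* y) - q (x +i* y) * (u - x)%:C).
  rewrite E (_ : (u - x) +i* (v - y) = (u - x)%:C + (0 +i* 1) * (v - y)%:C); last first.
    by apply: complex_ext; rewrite !(cReD, cImD, cReM, cImM) /=; ring.
  by ring.
apply: le_trans (cmodD _ _) _; apply: le_trans (lerD h1 h2) _.
have := Re_le_cmod ((u +i* v) - (x +i* y)); have := Im_le_cmod ((u +i* v) - (x +i* y)).
by rewrite E /= => h3 h4; have := lerD h3 h4; nra.
Qed.

End PrimitiveOnBox.

(** [2 Re (h' / h)] is the derivative of [ln |h|^2] along the path that defines the
    primitive; so no logarithm of [h] itself is needed. *)
Lemma primitive_ln h (V : set R[i]) B z : copen V -> holo h V ->
  (forall z, inbox B z -> V z) -> (forall z, V z -> h z != 0) -> inbox B z ->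
  2 * Re (corner_primitive (fun w => dv h w / h w) B z)
  = ln (cmod (h z) ^+ 2) - ln (cmod (h (lft B +i* bot B)) ^+ 2).
Proof.
move=> oV hh BV h0; case: z => x y zB.
have /andP[/andP[x1 x2] /andP[y1 y2]] :
  (lft B <= x <= rgt B) && (bot B <= y <= top B) := zB.
pose q w := dv h w / h w.
have cq w : V w -> ccont q w.
  move=> Vw; apply: ccontM; first exact: ex_cder_ccont (holo_dv oV hh Vw).
  exact: cder_cont (cderV (dvP (hh w Vw)) (h0 w Vw)).
have dN w : V w -> rder (fun w => (cmod (h w) ^+ 2)%:C) w
    (dv h w * conjc (h w)) (h w * conjc (dv h w)).
  move=> Vw; have du := rderM (dvP (hh w Vw)) (rder_conj (dvP (hh w Vw))).
  apply: rder_ext du; rewrite ?conjc0; try ring.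
  by move=> v; rewrite conjcM_cmod.
have lnd (N : R -> R) (t D : R) : 0 < N t -> is_derive t 1 N D ->
    is_derive t 1 (fun s => ln (N s)) (D / N t).
  move=> N0 dN1; have := @is_derive1_comp R (@ln R) N t _ _ (is_derive1_ln N0) dN1.
  by move=> H; apply: (is_derive_eq H); rewrite mulrC.
have pos2 w : V w -> 0 < cmod (h w) ^+ 2.
  by move=> Vw; rewrite exprn_gt0// cmod_gt0 h0.
have divE (X Y p : R) : 0 < p -> X = Y * p -> X / p = Y.
  by move=> p0 ->; rewrite mulfK// gt_eqF.
have qE w : V w -> q w * (cmod (h w) ^+ 2)%:C = dv h w * conjc (h w).
  by move=> Vw; rewrite -conjcM_cmod /q mulrA mulfVK// h0.
have E1 w : V w -> Re (dv h w * conjc (h w) + h w * conjc (dv h w)) / cmod (h w) ^+ 2 = 2 * Re (q w).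
  move=> Vw; apply: divE; first exact: pos2.
  have -> : 2 * Re (q w) * cmod (h w) ^+ 2 = 2 * Re (q w * (cmod (h w) ^+ 2)%:C).
    by rewrite cReM /=; ring.
  by rewrite (qE w Vw); case: (h w) => a b; case: (dv h w) => c d /=; ring.
have E2 w : V w -> Im (h w * conjc (dv h w) - dv h w * conjc (h w)) / cmod (h w) ^+ 2 = 2 * Re ((0 +i* 1) * q w).
  move=> Vw; apply: divE; first exact: pos2.
  have -> : 2 * Re ((0 +i* 1) * q w) * cmod (h w) ^+ 2 = - (2 * Im (q w * (cmod (h w) ^+ 2)%:C)).
    by rewrite cReM cImM /=; ring.
  by rewrite (qE w Vw); case: (h w) => a b; case: (dv h w) => c d /=; ring.
have Vh t : lft B <= t <= x -> V (t +i* bot B).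
  by move=> ht; apply: BV; rewrite /inbox /=; lra.
have Vv t : bot B <= t <= y -> V (x +i* t).
  by move=> ht; apply: BV; rewrite /inbox /=; lra.
have c1 : rcont_on (fun t => Re (q (t +i* bot B))) (lft B) x.
  by have [] := ccont_h (fun t ht => cq _ (Vh t ht)).
have c2 : rcont_on (fun t => Re ((0 +i* 1) * q (x +i* t))) (bot B) y.
  by have [] := ccont_v (g := fun w => (0 +i* 1) * q w) (fun t ht => ccontM (ccont_cst _ _) (cq _ (Vv t ht))).
have c3 : rcont_on (fun t => Im (q (x +i* t))) (bot B) y.
  by have [] := ccont_v (fun t ht => cq _ (Vv t ht)).
have F1 : 2 * rint1 (fun t => Re (q (t +i* bot B))) (lft B) x
    = ln (cmod (h (x +i* bot B)) ^+ 2) - ln (cmod (h (lft B +i* bot B)) ^+ 2).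
  rewrite -rint1Z//; apply: (rint1_FTC (F := fun t => ln (cmod (h (t +i* bot B)) ^+ 2))) => //.
    by move=> t ht; apply: rcontZ; exact: c1.
  move=> t /Vh Vt; rewrite -(E1 _ Vt).
  exact: (lnd (fun t => cmod (h (t +i* bot B)) ^+ 2) t _ (pos2 _ Vt) (rder_hline (dN _ Vt))).
have F2 : 2 * rint1 (fun t => Re ((0 +i* 1) * q (x +i* t))) (bot B) y
    = ln (cmod (h (x +i* y)) ^+ 2) - ln (cmod (h (x +i* bot B)) ^+ 2).
  rewrite -rint1Z//; apply: (rint1_FTC (F := fun t => ln (cmod (h (x +i* t)) ^+ 2))) => //.
    by move=> t ht; apply: rcontZ; exact: c2.
  move=> t /Vv Vt; rewrite -(E2 _ Vt).
  exact: (lnd (fun t => cmod (h (x +i* t)) ^+ 2) t _ (pos2 _ Vt) (rder_vline (dN _ Vt))).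
have e3 : rint1 (fun t => Re ((0 +i* 1) * q (x +i* t))) (bot B) y
    = - rint1 (fun t => Im (q (x +i* t))) (bot B) y.
  by rewrite -rint1N//; apply: rint1_ext => t _; rewrite cReM /= mul0r sub0r mul1r.
rewrite -/q; have -> : Re (corner_primitive q B (x +i* y)) =
    rint1 (fun t => Re (q (t +i* bot B))) (lft B) x
  + rint1 (fun t => Re ((0 +i* 1) * q (x +i* t))) (bot B) y.
  by rewrite e3 /corner_primitive cReD cReM /cint; cbn [complex.Re complex.Im]; rewrite mul0r sub0r mul1r.
by rewrite mulrDr F1 F2; ring.
Qed.

End Primitive.

(** * Harnack's inequality *)

Section Harnack.
Variable R : realType.
Implicit Types (Q S : box R) (z w a p : R[i]) (f g h : R[i] -> R[i]) (U : set R[i]).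
Implicit Types (x y : R).

Lemma copen_inside Q : copen (fun z => inside Q z).
Proof. by move=> z zQ; exact: near_inside. Qed.

Lemma copen_neq0 h U : copen U -> holo h U -> copen [set z | U z /\ h z != 0].
Proof.
move=> oU hh z [Uz hz]; have [d d0 Hd] := oU z Uz.
have [d' d'0 Hd'] := ccont_neq0 (ex_cder_ccont (hh z Uz)) hz.
exists (Num.min d d'); first by rewrite lt_min d0.
move=> w; rewrite lt_min => /andP[/Hd Uw /Hd' hw]; split=> //.
by rewrite -cmod_gt0; have := cmod_gt0 (h z); rewrite hz; lra.
Qed.

(** Schwarz's lemma: the quotient of [g] by [z - z1] is at most [1 / d] on the
    boundary, hence inside. *)
Lemma schwarz_square g U (s d : R) z1 w : copen U -> holo g U ->
  (forall z, inbox (square 0 s) z -> U z) -> inbox (square 0 s) z1 -> 0 < d ->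
  g z1 = 0 -> (forall z, U z -> cmod (g z) <= 1) ->
  (forall z, onbd (square 0 s) z -> d <= cmod (z - z1)) ->
  inbox (square 0 s) w -> cmod (g w) <= cmod (w - z1) / d.
Proof.
move=> oU hg QU z1Q d0 gz1 g1 dist wQ.
have [k hk gE] := holo_factor oU hg (QU _ z1Q) gz1.
have kd : cmod (k w) <= d^-1.
  apply: (@max_principle _ k (square 0 s)) => //; first by move=> z /QU/hk.
  move=> z zQ; have dz := dist z zQ; have z0 : 0 < cmod (z - z1) by lra.
  have := g1 z (QU z (onbd_inbox zQ)); rewrite gE cmodM => h.
  rewrite -(ler_pM2l z0); apply: le_trans h _.
  by rewrite ler_pdivlMr// mul1r.
by rewrite gE cmodM ler_wpM2l ?cmod_ge0.
Qed.

Lemma half_plane_mobius a u : 0 < Re a -> 0 <= Re u ->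
  u + conjc a != 0 /\ cmod ((u - a) / (u + conjc a)) <= 1.
Proof.
move=> a0 u0.
have n0 : u + conjc a != 0.
  apply/eqP => /(congr1 (@complex.Re R)); rewrite cReD.
  by case: a a0 => p q /= p0 E; lra.
split=> //; rewrite cmodM cmodV ler_pdivrMr ?cmod_gt0// mul1r.
rewrite -(@ler_pXn2r _ 2) ?nnegrE ?cmod_ge0// !cmod_sqr.
by case: a u a0 u0 {n0} => p q [r t] /= p0 r0; nra.
Qed.

(** If the Mobius map of the right half-plane onto the disk that sends [a] to 0
    sends [u] into the disk of radius [1/3], then [Re u] is at least half of
    [Re a]. *)
Lemma half_plane_third a u : 0 < Re a -> 0 <= Re u ->
  cmod ((u - a) / (u + conjc a)) <= 3^-1 -> Re a <= 2 * Re u.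
Proof.
move=> a0 u0; have [n0 _] := half_plane_mobius a0 u0.
rewrite cmodM cmodV ler_pdivrMr ?cmod_gt0//.
move=> h; have : (3 * cmod (u - a)) ^+ 2 <= cmod (u + conjc a) ^+ 2.
  by rewrite lerXn2r ?nnegrE ?mulr_ge0 ?cmod_ge0//; lra.
rewrite exprMn !cmod_sqr.
case: a u a0 u0 {n0 h} => p q [r t] /= p0 r0 h.
have h1 : 9 * (r - p) ^+ 2 <= (r + p) ^+ 2.
  by have := sqr_ge0 (t - q); nra.
by rewrite leNgt; apply/negP => h2; nra.
Qed.

(** [ln (|h|^2 / c^2)] is nonnegative on the boundary, hence inside, by the maximum
    principle for [1 / h]; it is the real part of a holomorphic [p].  Sending the
    half-plane to the disk with [p z1] at the centre, Schwarz's lemma on the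
    square of half-side [s / 2], whose boundary is at distance at least [s / 4]
    from [z1], gives a modulus at most [(s / 12) / (s / 4) = 1/3] at [w].  So
    [Re (p z1) <= 2 Re (p w)], which is the claim after exponentiation. *)
Lemma harnack h V B (s c : R) z1 w : copen V -> holo h V ->
  (forall z, inbox B z -> V z) -> 0 < s -> subbox (square 0 s) B ->
  (forall z, inbox B z -> h z != 0) -> 0 < c -> (forall z, onbd B z -> c <= cmod (h z)) ->
  cmod z1 <= s / 24 -> inbox (square 0 (s / 48)) w ->
  c * cmod (h z1) <= cmod (h w) ^+ 2.
Proof.
move=> oV hh BV s0 sB h0 c0 hc z1s ws.
pose V' := [set z | V z /\ h z != 0].
have oV' : copen V' by exact: copen_neq0.
have hh' : holo h V' by move=> z [Vz _]; exact: hh.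
have BV' z : inbox B z -> V' z by move=> zB; split; [exact: BV|exact: h0].
have hV' z : V' z -> h z != 0 by case.
have hq : holo (fun w => dv h w / h w) V'.
  move=> z Vz; have [A dA] := holo_dv oV' hh' Vz; eexists.
  exact: cderM dA (cderV (dvP (hh' z Vz)) (hV' z Vz)).
have lowB z : inbox B z -> c <= cmod (h z).
  move=> zB; have hz : 0 < cmod (h z) by rewrite cmod_gt0 h0.
  have : cmod ((h z)^-1) <= c^-1.
    apply: (@max_principle _ (fun z => (h z)^-1) B) => //.
      by move=> v /BV' Vv; eexists; exact: cderV (dvP (hh' v Vv)) (hV' v Vv).
    by move=> v vB; rewrite cmodV lef_pV2 ?posrE ?hc// (lt_le_trans c0) ?hc.
  by rewrite cmodV lef_pV2 ?posrE.
pose L := corner_primitive (fun w => dv h w / h w) B.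
pose K := ln (cmod (h (lft B +i* bot B)) ^+ 2) - ln (c ^+ 2).
pose p z := 2 * L z + K%:C.
have Rep z : inbox B z -> Re (p z) = ln (cmod (h z) ^+ 2) - ln (c ^+ 2).
  move=> zB; rewrite /p cReD (_ : Re (2 * L z) = 2 * Re (L z)); last first.
    by case: (L z) => ? ?; rewrite mulrC; simpc => /=; ring.
  by rewrite (primitive_ln oV' hh' BV' hV' zB) /= /K; ring.
have Rep0 z : inbox B z -> 0 <= Re (p z).
  move=> zB; rewrite Rep// subr_ge0 ler_ln ?posrE ?exprn_gt0//; last first.
    by rewrite cmod_gt0 h0.
  by rewrite lerXn2r ?nnegrE ?cmod_ge0 ?(ltW c0) ?lowB.
have hp : holo p (fun z => inside B z).
  move=> z zB; have dL := primitive_cder hq BV' zB.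
  by eexists; apply: cderD (cderM (cder_cst 2 z) dL) (cder_cst _ z).
have sqB t z : t < s -> inbox (square 0 t) z -> inside B z.
  by move: sB; rewrite /subbox /inside /inbox /square /=; lra.
have z1Q t : s / 24 <= t -> inbox (square 0 t) z1.
  have := Re_le_cmod z1; have := Im_le_cmod z1.
  by rewrite !ler_norml /inbox /square /=; lra.
have z1B : inbox B z1.
  by apply: inside_inbox; apply: (@sqB (s / 2)); [lra|apply: z1Q; lra].
have wB : inbox B w.
  by apply: inside_inbox; apply: (@sqB (s / 48)) => //; lra.
pose a := p z1.
suff main : Re a <= 2 * Re (p w).
  move: main; rewrite /a (Rep _ z1B) (Rep _ wB) => main.
  have hz1 : 0 < cmod (h z1) by rewrite cmod_gt0 h0.
  have hw : 0 < cmod (h w) by rewrite cmod_gt0 h0.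
  move: main; rewrite !lnXn// => main.
  rewrite -ler_ln ?posrE ?mulr_gt0 ?exprn_gt0// lnM ?posrE// lnXn//.
  by move: main; rewrite !mulr2n; lra.
have [a0|a0] := ltP 0 (Re a); last first.
  by apply: le_trans a0 _; rewrite mulr_ge0// Rep0.
pose T z := (p z - a) / (p z + conjc a).
have hT : holo T (fun z => inside B z).
  move=> z zB; have [A dA] := hp z zB.
  have [n0 _] := half_plane_mobius a0 (Rep0 z (inside_inbox zB)).
  eexists; apply: cderM (cderD dA (cder_cst (- a) z)) (cderV (cderD dA (cder_cst (conjc a) z)) n0).
apply: half_plane_third => //; first exact: Rep0.
rewrite -/(T w).
have s2 : s / 2 < s by lra.
have wz1 : cmod (w - z1) <= s / 12.
  have := cmodD w (- z1); rewrite cmodN => h1; apply: le_trans h1 _.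
  have := cmod_le_ReIm w; have : `|Re w| <= s / 48 /\ `|Im w| <= s / 48.
    by move: ws; rewrite !ler_norml /inbox /square /=; lra.
  by lra.
have s4 : 0 < s / 4 by lra.
apply: (le_trans (@schwarz_square T (fun z => inside B z) (s / 2) (s / 4) z1 w _ _ _ _ _ _ _ _ _)) => //.
- exact: copen_inside.
- by move=> z; apply: sqB; lra.
- by apply: z1Q; lra.
- by rewrite /T subrr mul0r.
- by move=> z zB; have [] := half_plane_mobius a0 (Rep0 z (inside_inbox zB)).
- move=> z; rewrite /onbd /square /= => /andP[_] h1.
  have h2 : s / 2 <= cmod z.
    have := Re_le_cmod z; have := Im_le_cmod z; rewrite !ler_norml.
    by case/or4P: h1 => /eqP ->; lra.
  by have := cmodB_ge z z1; lra.
- by move: ws; rewrite /inbox /square /=; lra.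
by rewrite ler_pdivrMr//; lra.
Qed.

End Harnack.

(** * The identity theorem on the disk *)

Section IdentityTheorem.
Variable R : realType.
Implicit Types (z w a p : R[i]) (f g h : R[i] -> R[i]) (U : set R[i]).

Definition zeros_cluster f a := forall d : R, 0 < d ->
  exists z, [/\ z != a, cmod (z - a) < d & f z = 0].

Lemma cluster_zero f a : ccont f a -> zeros_cluster f a -> f a = 0.
Proof.
move=> cf acc; apply: (@cmod_small_eq0 _ _ 1) => e e0; rewrite mulr1.
have [d d0 Hd] := cf e e0; have [z [_ zd fz]] := acc d d0.
by have := Hd z zd; rewrite fz sub0r cmodN.
Qed.

(** A zero at which other zeros cluster can be divided out any number of times:
    the cofactor still has these other zeros. *)
Lemma cluster_factor f U a n : copen U -> holo f U -> U a -> zeros_cluster f a ->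
  exists2 h, holo h U & forall z, f z = (z - a) ^+ n * h z.
Proof.
move=> oU hf Ua acc; elim: n => [|n [h hh fE]].
  by exists f => // z; rewrite expr0 mul1r.
have acch : zeros_cluster h a.
  move=> d /acc[z [za zd fz]]; exists z; split=> //; apply/eqP.
  have := fz; rewrite fE => /eqP; rewrite mulf_eq0 expf_eq0 subr_eq0 (negbTE za).
  by rewrite andbF.
have ha := cluster_zero (ex_cder_ccont (hh a Ua)) acch.
have [k hk hE] := holo_factor oU hh Ua ha.
by exists k => // z; rewrite fE hE exprSr mulrA.
Qed.

(** Write [f = (z - a) ^+ n * h].  The maximum principle bounds [h] by [M / s ^+ n]
    with [M] independent of [n], so [|f z| <= M * (|z - a| / s) ^+ n] for all
    [n]. *)
Lemma cluster_vanish f U a (s : R) z : copen U -> holo f U -> 0 < s ->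
  (forall z, inbox (square a s) z -> U z) -> zeros_cluster f a ->
  cmod (z - a) < s -> f z = 0.
Proof.
move=> oU hf s0 QU acc zs.
have aQ := inside_square a s0; have wQ := wf_square a s0.
have Ua := QU a (inside_inbox aQ).
have [M M0 HM] := bd_bounded wQ (holo_bdcont hf QU).
have bd w : onbd (square a s) w -> s <= cmod (w - a).
  move=> /andP[_] h1; have := Re_le_cmod (w - a); have := Im_le_cmod (w - a).
  rewrite cReB cImB !ler_norml; move: h1; rewrite /square /=.
  by move=> /or4P[] /eqP ->; lra.
have zQ : inbox (square a s) z.
  have := Re_le_cmod (z - a); have := Im_le_cmod (z - a).
  by rewrite cReB cImB !ler_norml /inbox /square /=; lra.
pose r := cmod (z - a) / s.
have r0 : 0 <= r by rewrite divr_ge0 ?cmod_ge0// ltW.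
have r1 : r < 1 by rewrite ltr_pdivrMr// mul1r.
have bnd n : cmod (f z) <= M * r ^+ n.
  have [h hh fE] := cluster_factor n oU hf Ua acc.
  have hM : cmod (h z) <= M / s ^+ n.
    apply: (@max_principle _ h (square a s)) => //; first by move=> w /QU/hh.
    move=> w wQ'; rewrite ler_pdivlMr ?exprn_gt0//; apply: le_trans (HM w wQ').
    rewrite fE cmodM cmodX mulrC ler_wpM2r ?cmod_ge0//.
    by rewrite lerXn2r ?nnegrE ?cmod_ge0 ?(ltW s0)//; exact: bd.
  rewrite fE cmodM cmodX /r expr_div_n.
  have -> : M * (cmod (z - a) ^+ n / s ^+ n) = cmod (z - a) ^+ n * (M / s ^+ n) by ring.
  by rewrite ler_wpM2l// exprn_ge0// cmod_ge0.
apply: (@cmod_small_eq0 _ _ 1) => e e0; rewrite mulr1.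
have [r00|rn0] := eqVneq r 0.
  by apply: le_trans (bnd 1%N) _; rewrite r00 expr1 mulr0 ltW.
have rp : 0 < r by rewrite lt_def rn0.
have [n nK] := @pow_unbounded R r^-1 (M / e) ltac:(by rewrite invf_gt1).
apply: le_trans (bnd n) _; rewrite -[r]invrK exprVn.
have rn : 0 < r^-1 ^+ n by rewrite exprn_gt0// invr_gt0.
by rewrite ler_pdivrMr//; move: nK; rewrite ltr_pdivrMr//; lra.
Qed.

Lemma copen_disk : copen (@unit_disk R).
Proof.
move=> z; rewrite /unit_disk /= => z1; exists (1 - cmod z); first lra.
by move=> w wz; have := cmodD (w - z) z; rewrite subrK; lra.
Qed.

Lemma square_disk (s m : R) a z : cmod a <= m -> m + 2 * s < 1 ->
  inbox (square a s) z -> unit_disk z.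
Proof.
move=> am ms zQ; rewrite /unit_disk /=.
have := cmodD (z - a) a; rewrite subrK.
have : cmod (z - a) <= 2 * s.
  apply: le_trans (cmod_le_ReIm _) _; rewrite cReB cImB.
  have -> : 2 * s = s + s by ring.
  by apply: lerD; rewrite ler_norml; move: zQ; rewrite /inbox /square /=; lra.
lra.
Qed.

(** The squares of half-side [s] around the points of the segment from [a] to [b]
    all lie in the disk, so the property of being a cluster point of zeros passes
    along the segment in steps shorter than [s]. *)
Lemma identity_disk f a b : holo f (@unit_disk R) -> unit_disk a -> unit_disk b ->
  zeros_cluster f a -> f b = 0.
Proof.
move=> hf; rewrite /unit_disk /= => a1 b1 acc.
pose m := Num.max (cmod a) (cmod b).
have ma : cmod a <= m by rewrite le_max lexx.
have mb : cmod b <= m by rewrite le_max lexx orbT.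
have m1 : m < 1 by rewrite gt_max a1.
pose s := (1 - m) / 3; have s0 : 0 < s by rewrite divr_gt0// subr_gt0.
have vanish c z : cmod c <= m -> zeros_cluster f c -> cmod (z - c) < s -> f z = 0.
  move=> cm; apply: (cluster_vanish copen_disk hf s0) => v.
  by apply: square_disk cm _; rewrite /s; lra.
have accz c z : cmod c <= m -> zeros_cluster f c -> cmod (z - c) < s -> zeros_cluster f z.
  move=> cm accc zc d d0.
  have e0 : 0 < Num.min d (s - cmod (z - c)) / 2 by rewrite divr_gt0// lt_min d0 subr_gt0.
  set e := _ / 2 in e0; have ed : e < d /\ e < s - cmod (z - c).
    have : 2 * e <= d by rewrite /e mulrC divfK// ge_min lexx.
    have : 2 * e <= s - cmod (z - c) by rewrite /e mulrC divfK// ge_min lexx orbT.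
    by lra.
  have ce : cmod (e%:C : R[i]) = e by rewrite cmodR gtr0_norm.
  have eE : z + e%:C - z = e%:C by rewrite addrC addKr.
  exists (z + e%:C); split.
  - by rewrite -subr_eq0 eE -cmod_gt0 ce.
  - by rewrite eE ce; case: ed.
  - apply: (vanish c) => //; rewrite addrAC; apply: le_lt_trans (cmodD _ _) _.
    by rewrite ce; lra.
have [n nK] := nat_above (cmod (b - a) / s).
have n0 : 0 < (n%:R : R) by apply: le_lt_trans nK; rewrite divr_ge0 ?cmod_ge0// ltW.
pose c k := a + ((k%:R / n%:R : R)%:C) * (b - a).
have cm k : (k <= n)%N -> cmod (c k) <= m.
  move=> kn; pose t := (k%:R / n%:R : R).
  have t0 : 0 <= t by rewrite divr_ge0.
  have t1 : t <= 1 by rewrite ler_pdivrMr// mul1r ler_nat.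
  rewrite /c -/t (_ : _ + _ = (1 - t)%:C * a + t%:C * b); last by rewrite rmorphB /=; ring.
  apply: le_trans (cmodD _ _) _; rewrite !cmodM !cmodR !ger0_norm ?subr_ge0//.
  nra.
have step k : (k <= n)%N -> zeros_cluster f (c k).
  elim: k => [|k IH] kn; first by rewrite /c mul0r mul0r addr0.
  apply: (accz (c k)); [exact: cm (ltnW kn)|exact: IH (ltnW kn)|].
  rewrite /c -natr1 mulrDl rmorphD /= (_ : _ - _ = ((1 / n%:R : R)%:C) * (b - a)); last by ring.
  rewrite cmodM cmodR ger0_norm ?divr_ge0// mul1r mulrC ltr_pdivrMr//.
  by move: nK; rewrite ltr_pdivrMr// mulrC.
have := step n (leqnn n); rewrite /c divff ?gt_eqF// mul1r addrC subrK => accb.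
exact: cluster_zero (ex_cder_ccont (hf b b1)) accb.
Qed.

(** The rational parametrization of the circle, at a parameter [t] near 0, gives
    points close to [r]. *)
Lemma circle_cluster f (r : R) : 0 < r -> (forall z, cmod z = r -> f z = 0) ->
  zeros_cluster f (r%:C).
Proof.
move=> r0 fr d d0.
pose t := d / (2 * r + d); have rd : 0 < 2 * r + d by lra.
have t0 : 0 < t by rewrite divr_gt0.
have td : 2 * r * t < d.
  by rewrite mulrA ltr_pdivrMr//; nra.
have q0 : 0 < 1 + t ^+ 2 by have := sqr_ge0 t; lra.
clearbody t.
pose z : R[i] := (r * (1 - t ^+ 2) / (1 + t ^+ 2)) +i* (2 * r * t / (1 + t ^+ 2)).
exists z.
have im : Im (z - r%:C) = 2 * r * t / (1 + t ^+ 2) by rewrite cImB /= subr0.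
have re : Re (z - r%:C) = - (2 * r * t ^+ 2 / (1 + t ^+ 2)).
  by rewrite cReB /=; field; rewrite gt_eqF.
split.
- have h1 : 0 < 2 * r * t / (1 + t ^+ 2) by rewrite divr_gt0// !mulr_gt0.
  rewrite -subr_eq0; apply/eqP => /(congr1 (@complex.Im R)); rewrite im /= => E.
  by move: h1; rewrite E ltxx.
- rewrite cmod_lt_sqr ?(ltW d0)// im re sqrrN.
  have -> : (2 * r * t ^+ 2 / (1 + t ^+ 2)) ^+ 2 + (2 * r * t / (1 + t ^+ 2)) ^+ 2
     = (2 * r * t) ^+ 2 / (1 + t ^+ 2) by field; rewrite gt_eqF.
  rewrite ltr_pdivrMr//; have h1 : 0 < 2 * r * t by rewrite !mulr_gt0.
  have h2 : (2 * r * t) ^+ 2 < d ^+ 2 by rewrite ltrXn2r ?nnegrE ?(ltW h1) ?(ltW d0)//.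
  by have := mulr_ge0 (sqr_ge0 d) (sqr_ge0 t); lra.
- apply: fr; apply/eqP; rewrite -(@eqrXn2 _ 2) ?cmod_ge0 ?(ltW r0)// cmod_sqr /=.
  by apply/eqP; field; rewrite gt_eqF.
Qed.

End IdentityTheorem.

(** * Analytic functions and the derivatives used here *)

Section Link.
Variable R : realType.
Implicit Types (z w a p : R[i]) (f g h : R[i] -> R[i]).

Lemma normr_cmod z : `|z| = (cmod z)%:C.
Proof. by rewrite normc_def; case: z. Qed.

Lemma derivable_cder f z : derivable f z 1 -> cder f z (derive1 f z).
Proof.
rewrite derive1E => df; apply/cderP => e e0.
have L : (h^-1 *: ((f \o shift z) (h *: (1 : R[i])) - f z)) @[h --> 0^'] --> 'D_1 f z by exact: df.
move/cvgrPdist_le: L => /(_ e%:C); rewrite ltcR => /(_ e0).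
rewrite near_withinE => /nbhs_ballP[d /= d0 Hd].
have dR : d = (Re d)%:C.
  by move: d0; rewrite ltcE /= => /andP[/eqP i0 _]; apply: complex_ext.
exists (Re d); first by move: d0; rewrite dR ltcR.
move=> w wz; have [->|wz0] := eqVneq w z.
  by rewrite !subrr mulr0 subr0 cmod0 mulr0.
have h0 : w - z != 0 by rewrite subr_eq0.
have := Hd (w - z); rewrite /ball /= sub0r normrN normr_cmod dR ltcR => /(_ wz h0).
rewrite /shift /= [(w - z) *: 1]mulr1 subrK normr_cmod lecR => h.
rewrite (_ : _ - _ = - ((w - z) * ('D_1 f z - (w - z)^-1 *: (f w - f z)))); last first.
  have -> : (w - z)^-1 *: (f w - f z) = (w - z)^-1 * (f w - f z) by [].
  move: ('D_1 f z) => d1; field; exact: h0.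
by rewrite cmodN cmodM mulrC ler_wpM2r// cmod_ge0.
Qed.

Lemma analytic_holo f : analytic_on_disk f -> holo f (@unit_disk R).
Proof. by move=> hf z /hf/derivable_cder d; eexists; exact: d. Qed.

Lemma analytic_dv f z : analytic_on_disk f -> unit_disk z -> derive1 f z = dv f z.
Proof. by move=> hf /hf/derivable_cder d; rewrite (dvE d). Qed.

End Link.

(** * The theorem *)

Section Main.
Variable R : realType.
Implicit Types (z w a p : R[i]) (f g h : R[i] -> R[i]).

Let D := @unit_disk R.

Lemma energy_mono f (U : set R[i]) (t t' : R) : copen U -> holo f U -> t <= t' ->
  (energy f U t <= energy f U t')%E.
Proof.
move=> oU hf tt; apply: ge0_subset_integral.
- exact: measurable_plane (copen_sublevel oU hf).
- exact: measurable_plane (copen_sublevel oU hf).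
- apply/measurable_EFinP.
  apply: measurable_funS (measurable_fun_plane (phi := fun z => cmod (dv f z) ^+ 2) oU _).
  + exact: measurable_plane.
  + by move=> p [].
  + by move=> z Uz; exact: cre_dv2 oU hf Uz.
- by move=> p _; rewrite lee_fin sqr_ge0.
- by move=> p [Up h]; split=> //; exact: lt_le_trans tt.
Qed.

Section GoodBox.
Variables (f : R[i] -> R[i]) (U : set R[i]) (B : box R).
Hypotheses (oU : copen U) (hf : holo f U) (wB : wf B) (BU : forall z, inbox B z -> U z).

(** Through the height, an oscillation of [1/8] forces the following: a boundary
    point with [|f| < 3/4] has height at most [- (7/16) ^+ 2 = - 49/256], so the
    height is at most [- 1/16] on the boundary, that is [|f| <= 7/8] there,
    against the maximum principle and the value at [z1]. *)
Lemma good_box_lower (m s : R) z1 : 32 * m <= 8^-1 -> good_box f m s B ->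
  inbox B z1 -> 1 <= cmod (f z1) -> forall z, onbd B z -> 3 / 4 <= cmod (f z).
Proof.
move=> m32 [_ _ _ _ osc] B1 fz1 z zB; rewrite leNgt; apply/negP => fz.
have hz : height f z <= - (49 / 256).
  have c0 := cmod_ge0 (f z).
  have q1 : 7 / 16 <= 1 - cmod (f z) ^+ 2 by nra.
  by rewrite /height pos_id; [nra|lra].
have : cmod (f z1) <= 7 / 8.
  apply: (@max_principle _ f B) => //; first by move=> w /BU/hf.
  move=> w wB'; have := osc w z wB' zB; rewrite ler_norml => /andP[_ h1].
  have h2 : height f w <= - 16^-1 by lra.
  rewrite leNgt; apply/negP => fw.
  have q2 : 1 - cmod (f w) ^+ 2 <= 1 / 4 by nra.
  move: h2; rewrite /height /pos; case: (lerP 0 (1 - cmod (f w) ^+ 2)) => q3.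
    by nra.
  by rewrite expr0n /=; lra.
by lra.
Qed.

Variables (h : R[i] -> R[i]) (a : R[i]) (t : R).
Hypotheses (hh : holo h U) (fE : forall z, f z = (z - a) * h z) (aB : inside B a).
Hypotheses (t0 : 0 < t) (low : forall z, onbd B z -> t <= cmod (f z)).

Let fbd z : onbd B z -> f z != 0.
Proof. by move=> /low ft; rewrite -cmod_gt0; exact: lt_le_trans ft. Qed.

Let hbd z : onbd B z -> h z != 0.
Proof. by move=> /fbd; rewrite fE mulf_eq0 negb_or => /andP[]. Qed.

Lemma energy_one_zero : ((t ^+ 2 * pi)%:E <= energy f U t)%E.
Proof.
apply: le_trans (logint_energy oU wB BU hf t0 low).
rewrite (logint_factor oU wB BU hh fE aB fbd) lee_fin.
have := mulr_ge0 (sqr_ge0 t) (logint_ge0 oU wB BU hh hbd); lra.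
Qed.

Lemma energy_two_zeros b : inbox B b -> h b = 0 ->
  ((2 * (t ^+ 2 * pi))%:E <= energy f U t)%E.
Proof.
move=> bB hb; have bI : inside B b.
  by apply: contraTT isT => bN; have := hbd (inboxP bB bN); rewrite hb eqxx.
have [k hk hE] := holo_factor oU hh (BU bB) hb.
have kbd z : onbd B z -> k z != 0.
  by move=> /hbd; rewrite hE mulf_eq0 negb_or => /andP[].
apply: le_trans (logint_energy oU wB BU hf t0 low).
rewrite (logint_factor oU wB BU hh fE aB fbd) (logint_factor oU wB BU hk hE bI hbd) lee_fin.
have := mulr_ge0 (sqr_ge0 t) (logint_ge0 oU wB BU hk kbd); lra.
Qed.

End GoodBox.

(** On the boundary of [B], at distance at most [4 s] from 0, [|h|] is at least
    [(3/4) / (4 s)], while [|h z1| >= 1 / r]; the product of the two bounds is a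
    lower bound for [|h| ^+ 2] on the square, whose boundary keeps distance
    [s / 48] from 0.  A large ratio [s / r] then gives [1 <= |f|]. *)
Lemma zero_free_large (U : set R[i]) h B (s r C : R) z1 w : copen U -> holo h U ->
  (forall z, inbox B z -> U z) -> (forall z, inbox B z -> h z != 0) ->
  0 < s -> subbox (square 0 s) B -> subbox B (square 0 (2 * s)) ->
  (forall z, onbd B z -> 3 / 4 <= cmod (z * h z)) ->
  0 < r -> 48 * 48 * 16 <= 3 * C -> C * r <= s ->
  cmod z1 <= r -> 1 <= cmod (z1 * h z1) -> onbd (square 0 (s / 48)) w ->
  1 <= cmod (w * h w).
Proof.
move=> oU hh BU hz s0 sB Bs low r0 C1 Cr z1r fz1 wS.
have C24 : 24 <= C by lra.
pose c := 3 / (16 * s); have c0 : 0 < c by rewrite divr_gt0 ?mulr_gt0.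
have hc z : onbd B z -> c <= cmod (h z).
  move=> zB; have := low z zB; rewrite cmodM => h1.
  have z4 : cmod z <= 4 * s.
    apply: le_trans (cmod_le_ReIm z) _.
    have [z2 z3] : `|Re z| <= 2 * s /\ `|Im z| <= 2 * s.
      move: (subbox_inbox Bs (onbd_inbox zB)).
      by rewrite !ler_norml /inbox /square /=; lra.
    by lra.
  rewrite /c ler_pdivrMr ?mulr_gt0//.
  by have := cmod_ge0 (h z); nra.
have z1s : cmod z1 <= s / 24.
  have : 24 * r <= C * r by rewrite ler_wpM2r// ltW.
  by lra.
have hz1 : r^-1 <= cmod (h z1).
  move: fz1; rewrite cmodM => h1; have hz0 := cmod_ge0 (h z1).
  by rewrite -[r^-1]mul1r ler_pdivrMr//; nra.
have H := harnack oU hh BU s0 sB hz c0 hc z1s (onbd_inbox wS).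
have w48 : s / 48 <= cmod w.
  have := Re_le_cmod w; have := Im_le_cmod w; rewrite !ler_norml.
  move: wS; rewrite /onbd /square /= => /andP[_].
  by move=> /or4P[] /eqP ->; lra.
have H2 : c * r^-1 <= cmod (h w) ^+ 2.
  by apply: le_trans H; rewrite ler_wpM2l// ltW.
have s48 : 0 <= s / 48 by lra.
have w2 : (s / 48) ^+ 2 <= cmod w ^+ 2 by rewrite lerXn2r ?nnegrE ?cmod_ge0.
have cr0 : 0 <= c * r^-1 by rewrite mulr_ge0 ?invr_ge0 ?ltW.
have : 1 <= cmod (w * h w) ^+ 2.
  rewrite cmodM exprMn; apply: le_trans (ler_pM (sqr_ge0 (s / 48)) cr0 w2 H2).
  have -> : (s / 48) ^+ 2 * (c * r^-1) = 3 * s / (48 * 48 * 16 * r).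
    by rewrite /c; field; rewrite !gt_eqF.
  rewrite ler_pdivlMr ?mulr_gt0// mul1r.
  apply: le_trans (ler_wpM2r (ltW r0) C1) _; rewrite -mulrA.
  by rewrite ler_wpM2l.
by move: (w * h w) => v h1; have := cmod_ge0 v; nra.
Qed.

(** The theorem after normalization.  The [n] dyadic annuli start at the size
    [C * r], so that Harnack's inequality applies on a square far larger than
    [|z1|], and end inside the disk; [n] is so large that an energy below [pi]
    leaves less than [16 * m ^+ 2] of slope integral in one of them. *)
Lemma energy_ge_pi (m C r : R) n f z1 :
  0 < m -> 32 * m <= 8^-1 -> 64 <= n%:R * (16 * m ^+ 2) -> 48 * 48 * 16 <= 3 * C ->
  0 < r -> 2 ^+ n * (C * r) <= 4^-1 ->
  holo f D -> f 0 = 0 -> cmod z1 <= r -> 1 <= cmod (f z1) ->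
  (pi%:E <= energy f D 1)%E.
Proof.
move=> m0 m32 nm C1 r0 nr hf f0 z1r fz1.
have C24 : 24 <= C by lra.
have oD : copen D := @copen_disk R.
have D0 : D 0 by change (is_true (cmod (0 : R[i]) < 1)); rewrite cmod0.
have sqD s z : s <= 4^-1 -> inbox (square 0 s) z -> D z.
  move=> s4; apply: (@square_disk _ s 0); first by rewrite cmod0.
  by lra.
rewrite leNgt; apply/negP => Esmall.
have E16 : (16%:E * energy f D 1 < (n%:R * (16 * m ^+ 2))%:E)%E.
  have E0 : (0 <= energy f D 1)%E by apply: integral_ge0 => p _; rewrite lee_fin sqr_ge0.
  have p4 : pi < 4 :> R by have := pihalf_lt2 R; lra.
  move: Esmall E0; case: (energy f D 1) => [x| |] //.
  by rewrite lte_fin => xp _; rewrite -EFinM lte_fin; lra.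
have Cr0 : 0 < C * r by rewrite mulr_gt0//; lra.
have [s sC [sn [B gB]]] := good_loop oD hf m0 Cr0 (fun z => sqD _ z nr) E16.
have s0 : 0 < s by lra.
have s4 : 2 * s <= 4^-1 by lra.
have [wB sB Bs B0] :
    [/\ wf B, subbox (square 0 s) B, subbox B (square 0 (2 * s)) & inside B 0].
  by case: gB => b1 b2 b3 b4 _; split;
    rewrite /wf /subbox /inside /square /=; lra.
have BD z : inbox B z -> D z by move=> /(subbox_inbox Bs); exact: sqD.
have rs : r <= s by nra.
have B1 : inbox B z1.
  apply: subbox_inbox sB _; have := Re_le_cmod z1; have := Im_le_cmod z1.
  by rewrite !ler_norml /inbox /square /=; lra.
have low := good_box_lower hf BD m32 gB B1 fz1.
have lt34 : 0 < 3 / 4 :> R by lra.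
(* the zero at the origin is divided out; the zeros of [h] decide *)
have [h hh fE] := holo_factor oD hf D0 f0.
have fE' z : f z = z * h z by rewrite fE subr0.
have [[b bB hb]|nz] := pselect (exists2 b, inbox B b & h b = 0).
  (* a second zero: 2 * (3/4) ^+ 2 > 1 *)
  have := energy_two_zeros oD hf wB BD hh fE B0 lt34 low bB hb.
  move=> h1; move: Esmall; rewrite ltNge => /negP; apply.
  have le34 : 3 / 4 <= 1 :> R by lra.
  apply: le_trans (energy_mono oD hf le34); apply: le_trans h1.
  by rewrite lee_fin; have := pi_gt0 R; lra.
have hz z : inbox B z -> h z != 0.
  by move=> zB; apply/eqP => hz0; apply: nz; exists z.
(* no second zero: the area lemma applies at level 1 on a smaller square *)
have s48 : 0 < s / 48 by lra.
have big w : onbd (square 0 (s / 48)) w -> 1 <= cmod (f w).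
  rewrite fE'; apply: (zero_free_large oD hh BD hz s0 sB Bs _ r0 C1 sC z1r).
    by move=> z /low; rewrite fE'.
  by rewrite -fE'.
have SD z : inbox (square 0 (s / 48)) z -> D z by apply: sqD; lra.
have := energy_one_zero oD hf (wf_square (0 : R[i]) s48) SD hh fE (inside_square 0 s48) ltr01 big.
by rewrite expr1n mul1r leNgt Esmall.
Qed.

(** Division by a value [k] of modulus [t] brings level [t] to level 1. *)
Lemma energy_scale f (t : R) k : holo f D -> 0 < t -> cmod k = t ->
  (energy f D t = (t ^+ 2)%:E * energy (fun z => k^-1 * f z)%R D 1)%E.
Proof.
move=> hf t0 kt; have oD : copen D := @copen_disk R.
have k0 : k != 0 by rewrite -cmod_gt0 kt.
have hg : holo (fun z => k^-1 * f z) D.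
  by move=> z /hf[A dA]; eexists; exact: cderM (cder_cst _ z) dA.
have dg z : D z -> dv (fun z => k^-1 * f z) z = k^-1 * dv f z.
  move=> /hf dz; apply: dvE; apply: rder_ext (cderM (cder_cst k^-1 z) (dvP dz)) => //.
  by rewrite mul0r add0r.
have sE : sublevel f D t = sublevel (fun z => k^-1 * f z) D 1.
  have E z : (cmod (k^-1 * f z) < 1) = (cmod (f z) < t).
    by rewrite cmodM cmodV kt mulrC ltr_pdivrMr// mul1r.
  by apply/seteqP; split=> z [Dz h]; split=> //; move: h; rewrite E.
rewrite /energy sE -ge0_integralZl_EFin//.
- apply: eq_integral => p; rewrite inE => -[Dp _].
  rewrite -EFinM dg// cmodM cmodV kt exprMn exprVn mulVKf//.
  by rewrite gt_eqF// exprn_gt0.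
- exact: measurable_plane (copen_sublevel oD hg).
- by move=> p _; rewrite lee_fin sqr_ge0.
- apply/measurable_EFinP.
  apply: measurable_funS (measurable_fun_plane (phi := fun z => cmod (dv (fun z => k^-1 * f z) z) ^+ 2) oD _).
  + exact: measurable_plane.
  + by move=> p [].
  + by move=> z Dz; exact: cre_dv2 oD hg Dz.
- exact: sqr_ge0.
Qed.

Lemma area_energy f (M t : R) : analytic_on_disk f -> t <= M ->
  (energy f D t <= area f M)%E.
Proof.
move=> af tM; have hf := analytic_holo af; have oD : copen D := @copen_disk R.
have -> : area f M = energy f D M.
  rewrite /area /energy; apply: eq_integral => p; rewrite inE => -[Dp _].
  by rewrite analytic_dv.
exact: energy_mono.
Qed.

End Main.

Theorem corollary1p2 (R : realType) :
  exists r0 : R, 0 < r0 < 1 /\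
    forall f : R[i] -> R[i],
      analytic_on_disk f ->
      f 0 = 0 ->
      (exists2 z, unit_disk z & f z != 0) ->
      forall r : R, 0 < r < r0 -> (1%:E <= area_ratio f r)%E.
Proof.
(* the constants of energy_ge_pi: the oscillation [32 m], the ratio [C] between
   the innermost annulus and the circle, and the number [n] of annuli *)
have [m m0 m32] : exists2 m : R, 0 < m & 32 * m <= 8^-1 by exists (256^-1); lra.
have [C C1] : exists C : R, 48 * 48 * 16 <= 3 * C by exists (48 * 48 * 16); lra.
have C24 : 24 <= C by lra.
have m2 : 0 < 16 * m ^+ 2 by rewrite mulr_gt0// exprn_gt0.
have [n nm] : exists n, 64 <= n%:R * (16 * m ^+ 2).
  by have [n /ltW nm] := nat_above (64 / (16 * m ^+ 2)); exists n; rewrite -ler_pdivrMr.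
have P1 : 1 <= 2 ^+ n :> R by rewrite exprn_ege1// ler1n.
have CP : 24 <= C * 2 ^+ n by nra.
have q0 : 0 < 4 * (C * 2 ^+ n) by lra.
exists (4 * (C * 2 ^+ n))^-1; split.
  by rewrite invr_gt0 q0 invf_lt1//; lra.
move=> f af f0 [b b1 fb] r /andP[r0 rr].
have nr : 2 ^+ n * (C * r) <= 4^-1.
  have h : r * (4 * (C * 2 ^+ n)) <= 1 by rewrite -ler_pdivlMr// mul1r ltW.
  by lra.
have r4 : r <= 4^-1 by nra.
have hf := analytic_holo af.
have circD z : cmod z = r -> unit_disk z.
  by move=> zr; change (is_true (cmod z < 1)); rewrite zr; lra.
have sqD z : inbox (square 0 r) z -> unit_disk z.
  by apply: (@square_disk _ r 0); [rewrite cmod0|lra].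
have wS := wf_square (0 : R[i]) r0.
have [Mb HMb] := ccont_bounded wS (g := f) (fun z zS => ex_cder_ccont (hf z (sqD z zS))).
set M := max_modulus f r.
have leM z : cmod z = r -> cmod (f z) <= M.
  move=> zr; apply: ub_le_sup; last by exists z.
  exists Mb => _ [w wr <-]; apply: HMb.
  have := Re_le_cmod w; have := Im_le_cmod w; rewrite wr !ler_norml.
  by rewrite /inbox /square /=; lra.
have rE : cmod (r%:C : R[i]) = r by rewrite cmodR gtr0_norm.
(* [M] is positive: otherwise [f] would vanish on the circle *)
have [z1 z1r fz1] : exists2 z, cmod z = r & f z != 0.
  apply: contrapT => nz; move/eqP: fb; apply.
  apply: (@identity_disk _ f r%:C) => //; first exact: circD.
  apply: circle_cluster => // z zr; apply: contrapT => /eqP fz.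
  by apply: nz; exists z.
have M0 : 0 < M by apply: lt_le_trans (leM z1 z1r); rewrite cmod_gt0.
have lower z : cmod z = r -> ((pi * cmod (f z) ^+ 2)%:E <= area f M)%E.
  move=> zr; have [->|fz] := eqVneq (f z) 0.
    rewrite cmod0 expr0n mulr0; apply: integral_ge0 => p _.
    by rewrite lee_fin sqr_ge0.
  apply: le_trans (area_energy af (leM z zr)).
  have t0 : 0 < cmod (f z) by rewrite cmod_gt0.
  rewrite (energy_scale hf t0 erefl) mulrC EFinM lee_pmul2l//; last first.
    by rewrite lte_fin exprn_gt0.
  apply: (energy_ge_pi (z1 := z) m0 m32 nm C1 r0 nr).
  - by move=> w /hf[A dA]; eexists; exact: cderM (cder_cst _ w) dA.
  - by rewrite f0 mulr0.
  - by rewrite zr.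
  - by rewrite mulVf// cmod1.
have pi0 := pi_gt0 R.
have pM : 0 < pi * M ^+ 2 by rewrite mulr_gt0// exprn_gt0.
(* [M] is a supremum, so the bounds [lower] are compared with it before squaring *)
rewrite /area_ratio -/M inver gt_eqF//.
case: (area f M) lower => [A| |] lower.
- rewrite -EFinM lee_fin ler_pdivlMr// mul1r mulrC -ler_pdivlMr//.
  have A0 : 0 <= A / pi.
    rewrite divr_ge0 ?(ltW pi0)//; have := lower z1 z1r; rewrite lee_fin.
    by apply: le_trans; rewrite mulr_ge0 ?sqr_ge0// ltW.
  rewrite -[leRHS](sqr_sqrtr A0) lerXn2r ?nnegrE ?sqrtr_ge0 ?(ltW M0)//.
  apply: ge_sup; first by exists (cmod (f z1)), z1.
  move=> _ [z zr <-]; rewrite -(@ger0_norm _ (cmod (f z))) ?cmod_ge0// -sqrtr_sqr.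
  rewrite ler_sqrt// ler_pdivlMr//.
  by have := lower z zr; rewrite lee_fin mulrC.
- by rewrite gt0_mulye ?leey// lte_fin invr_gt0.
- by have := lower z1 z1r; rewrite leeNy_eq.
Qed.
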